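(* Let $\varepsilon>0$ be a constant and let $p=p_n$ satisfy eventually $n^{-1/3+\varepsilon}\le p\le 1-\varepsilon$. Suppose there exists a non-increasing non-negative sequence $h=h_n$ such that $p_{n+1}/p_n=1-\Theta(h_n/n)$. Let $r=r_n=\min\{k\in\mathbb{N}: f(n,k,p)>1/(pn)\}$, where $f(n,k,p)=\binom{n}{k}(1-(1-p)^k)^{n-k}$. Then there exists a dense set $I\subseteq\mathbb{N}$ such that, with asymptotics restricted to $n\in I$, asymptotically almost surely $$\gamma(\mathcal{G}(n,p))=r\qquad\text{and}\qquad b(\mathcal{G}(n,p))=\Theta(\Delta(\mathcal{G}(n,p)))=\Theta(pn).$$
   Context: $\mathcal{G}(n,p)$ is the binomial random graph on vertex set $[n]$ in which each of the $\binom n2$ pairs is an edge independently with probability $p$. A dominating set of a graph $G=(V,E)$ is a set $D\subseteq V$ such that every vertex not in $D$ has a neighbour in $D$; $\gamma(G)$ is the minimum size of a dominating set. The bondage number of a graph with at least one edge is $b(G)=\min\{|B|: B\subseteq E,\ \gamma(G-B)>\gamma(G)\}$. $\Delta(G)$ is the maximum degree. A set $I\subseteq\mathbb{N}$ is dense if $\lim_{n\to\infty}|I\cap[n]|/n=1$. ''With asymptotics restricted to $n\in I$, a.a.s.'' means the probability of the event tends to $1$ as $n\to\infty$ along $n\in I$. ''Eventually'' means for all but finitely many $n$. Functions hidden in $\Theta(\cdot)$ are positive. Logarithms are natural. *)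

(* Defs.v *)
From HB Require Import structures.
From mathcomp Require Import all_boot all_order all_algebra.
From mathcomp Require Import all_classical all_reals all_analysis.
Set Implicit Arguments.
Unset Strict Implicit.
Unset Printing Implicit Defensive.
Import Order.TTheory GRing.Theory Num.Theory.
Import numFieldNormedType.Exports.
Local Open Scope classical_set_scope.
Local Open Scope ring_scope.

(* A simple graph with vertex set T is given by its edge set, a subset E of
   vpairs T. *)
Definition vpairs (T : finType) : {set {set T}} :=
  [set e : {set T} | #|e| == 2%N]%SET.

Definition adj (T : finType) (E : {set {set T}}) : rel T :=
  fun u v => [set u; v]%SET \in E.

Definition dominating (T : finType) (E : {set {set T}}) (D : {set T}) : bool :=
  [forall v, (v \notin D) ==> [exists u in D, adj E u v]].

Definition domination_number (T : finType) (E : {set {set T}}) : nat :=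
  #|[arg min_(D < [set: T]%SET | dominating E D) #|D| ]|.

(* If E is nonempty, then B = E satisfies the condition; the value for the
   edgeless graph, where the bondage number is undefined, is 0. *)
Definition bondage_number (T : finType) (E : {set {set T}}) : nat :=
  #|[arg min_(B < E | (B \subset E) &&
        (domination_number E < domination_number (E :\: B)%SET)%N) #|B| ]|.

Definition max_degree (T : finType) (E : {set {set T}}) : nat :=
  (\max_(v : T) #|[set u | adj E v u]%SET|)%N.

(* The probability that G(n, p) satisfies A. *)
Definition gnp_prob (R : realType) (n : nat) (p : R)
    (A : pred {set {set 'I_n}}) : R :=
  \sum_(E : {set {set 'I_n}} | (E \subset vpairs 'I_n) && A E)
    \prod_(e in vpairs 'I_n) (if e \in E then p else 1 - p).

(* The expected number of dominating sets of size k in G(n, p). For k > n the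
   truncated exponent n - k is harmless, since 'C(n, k) = 0. *)
Definition expected_dominating (R : realType) (n k : nat) (p : R) : R :=
  'C(n, k)%:R * (1 - (1 - p) ^+ k) ^+ (n - k).

(* The set is nonempty as soon as p * n > 1, because
   expected_dominating n n p = 1; the value for an empty set is 0. *)
Definition dom_threshold (R : realType) (n : nat) (p : R) : nat :=
  if pselect (exists k : nat,
       1 / (p * n%:R) < expected_dominating n k p) is left ex
  then ex_minn ex else 0%N.

Definition density_one (R : realType) (I : set nat) : Prop :=
  ((\sum_(1 <= i < n.+1) (i \in I))%N%:R / n%:R : R) @[n --> \oo] --> (1 : R).

(* A holds asymptotically almost surely for G(n, p n), n ranging over I. *)
Definition aas_along (R : realType) (I : set nat) (p : nat -> R)
    (A : forall n : nat, pred {set {set 'I_n}}) : Prop :=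
  gnp_prob (p n) (A n) @[n --> within I \oo] --> (1 : R).

(* Main.v *)
(* Write r for the threshold, f for the expected number of dominating r-sets and
   x = ln n.  Since f(n, r - 1, p) tends to 0, domination numbers below r are
   excluded by the first moment.  The bondage number is at most 2 Delta because
   isolating both ends of an edge raises the domination number.

   For the lower bound, let B have at most delta p n edges.  A dominating r-set D is
   destroyed only if, for some v, all edges between v and D lie in B.  Charge D to
   these edges, uniformly.  If v has at least tau x neighbours in D, each edge vw
   is charged at most 1/(tau x) by each of the dominating r-sets containing w; these
   number about f r/n by the second moment method, once the few sets meeting
   exceptional vertices are dropped.  If v has fewer neighbours in D, the charges
   are controlled by the sum over (v, w) of the squares of exponentially weighted
   counts.  Both second moments need p^3 n to exceed every power of x, whence the
   exponent 1/3.  The same argument with B empty gives a dominating r-set.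

   The good n are those with f(n, r_n, p_n) >= n^11.  For fixed k, ln f(n, k, p_n)
   decreases in n at a rate that is comparable before and after a change of
   threshold, as h is non-increasing.  Between two changes it falls through an
   interval of length of order x^2, of which only a part of length O(x) is bad, so
   the good n have density one. *)
Require Import Defs.
From HB Require Import structures.
From mathcomp Require Import all_boot all_order all_algebra.
From mathcomp Require Import all_classical all_reals all_analysis.
From mathcomp Require Import ring lra zify.
Set Implicit Arguments.
Unset Strict Implicit.
Unset Printing Implicit Defensive.
Import Order.TTheory GRing.Theory Num.Theory.
Import numFieldNormedType.Exports.
Local Open Scope classical_set_scope.
Local Open Scope ring_scope.

(** * Expectation over a random edge set *)

(** Orders of magnitude: put [q = 1 - p] and [s = q ^ r]. The definition of the threshold forces
    [r p] to be of order [x] and [n s] of order [r x]. For two [r]-sets that share few vertices, the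
    relative excess over independence is about [r s], up to small powers of [n], and the variance
    per vertex costs another factor [r]. Everything thus rests on [r ^ 2 s], which is
    [1 / (p ^ 3 n)] up to powers of [x]. The exponential weight [t ^ N], with [N] the number of
    neighbours of [v] in [D], is chosen because it has an explicit mean: once [v] is exempted from
    being dominated, its star is independent of the rest, and the joint weight of [D] and [D'] has
    mean at most [(q + p t) ^ #|D :|: D'|], close to [s ^ 2] for most pairs. In the density argument
    [n s] is at least of order [x ^ 2], so a fall by [O(x)] takes [O(n / x)] steps. Over such a
    window [p] changes by a relative [O(1 / x)], hence [q ^ r] by a constant factor only, and
    estimates made at its left end serve throughout. *)

Fixpoint expect (R : comPzRingType) (T : finType) (p : R) (l : seq T)
    (F : {set T} -> R) : R :=
  if l is e :: l' then
    p * expect p l' (fun E => F (e |: E)%SET) + (1 - p) * expect p l' F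
  else F finset.set0.

Section Expect.
Import mathcomp.boot.fintype mathcomp.boot.finset.
Variables (R : realType) (T : finType) (p : R).
Implicit Types (l : seq T) (F G : {set T} -> R) (S : {set T}).

Lemma eq_expect_in l F G :
  (forall E : {set T}, E \subset l -> F E = G E) -> expect p l F = expect p l G.
Proof.
elim: l F G => [|e l IH] F G FG /=; first by apply: FG; apply/subsetP => z; rewrite inE.
congr (_ * _ + _ * _); apply: IH => E /subsetP El; apply: FG.
  apply/subsetP => z; rewrite !inE => /orP[->//|/El ->].
  by rewrite orbT.
by apply/subsetP => z /El zl; rewrite inE zl orbT.
Qed.

Lemma eq_expect l F G : F =1 G -> expect p l F = expect p l G.
Proof. by move=> FG; apply: eq_expect_in => E _. Qed.

Lemma expectD l F G :
  expect p l (fun E => F E + G E) = expect p l F + expect p l G.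
Proof. by elim: l F G => [|e l IH] F G //=; rewrite !IH; ring. Qed.

Lemma expectZ l c F : expect p l (fun E => c * F E) = c * expect p l F.
Proof. by elim: l F => [|e l IH] F //=; rewrite !IH; ring. Qed.

Lemma expect_cst l c : expect p l (fun=> c) = c.
Proof. by elim: l => [|e l IH] //=; rewrite !IH; ring. Qed.

Lemma expectB l F G :
  expect p l (fun E => F E - G E) = expect p l F - expect p l G.
Proof. by elim: l F G => [|e l IH] F G //=; rewrite !IH; ring. Qed.

Lemma expect_sum (I : Type) (s : seq I) (P : pred I) l (F : I -> {set T} -> R) :
  expect p l (fun E => \sum_(i <- s | P i) F i E) =
  \sum_(i <- s | P i) expect p l (F i).
Proof.
elim: s => [|i s IH].
  by under eq_expect do rewrite big_nil; rewrite expect_cst big_nil.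
under eq_expect do rewrite big_cons; rewrite big_cons; case: (P i) => //.
by rewrite expectD IH.
Qed.

Lemma expect_le l F G : 0 <= p -> p <= 1 -> (forall E, F E <= G E) ->
  expect p l F <= expect p l G.
Proof.
move=> p0 p1; elim: l F G => [|e l IH] F G FG /=; first exact: FG.
by apply: lerD; apply: ler_wpM2l; rewrite ?subr_ge0 ?IH.
Qed.

(** Induction on the list: an element of [S] is seen by [F] only, any other element by [G] only. *)
Lemma expect_indep l S F G :
  (forall E, F E = F (E :&: S)%SET) -> (forall E, G E = G (E :\: S)%SET) ->
  expect p l (fun E => F E * G E) = expect p l F * expect p l G.
Proof.
elim: l F G => [|e l IH] F G FS GS //=.
have [eS|eS] := boolP (e \in S).
- have Ge E : G (e |: E)%SET = G E.
    by rewrite GS setDUl (_ : [set e] :\: S = set0)%SET ?set0U -?GS //;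
       apply/eqP; rewrite setD_eq0 sub1set.
  under eq_expect do rewrite Ge.
  under [expect p l (fun E => G _)]eq_expect do rewrite Ge.
  rewrite !IH //; first by ring.
  by move=> E; rewrite [LHS]FS [RHS]FS !setIUl -setIA setIid.
- have Fe E : F (e |: E)%SET = F E.
    rewrite FS setIUl (_ : [set e] :&: S = set0)%SET ?set0U -?FS //.
    by apply/setP => z; rewrite !inE; case: eqP => // ->; rewrite (negbTE eS).
  under eq_expect do rewrite Fe.
  under [expect p l (fun E => F (e |: _)%SET)]eq_expect do rewrite Fe.
  rewrite !IH //; first by ring.
  by move=> E; rewrite [LHS]GS [RHS]GS !setDUl setDDl setUid.
Qed.

(** One generating function serves three ends: [t = 0] gives the probability of having no edge in
    [S], [0 < t < 1] the fragile weights and the lower degree tail, [t > 1] the upper degree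
    tail. *)
Lemma expect_exp l S (t : R) : uniq l -> S \subset l ->
  expect p l (fun E => t ^+ #|E :&: S|) = (1 - p + p * t) ^+ #|S|.
Proof.
move=> ul Sl.
have -> : #|S| = count (mem S) l.
  rewrite -size_filter -(card_uniqP (filter_uniq _ ul)); apply: eq_card => z.
  rewrite mem_filter /=.
  by case: (boolP (z \in S)) => //= /(subsetP Sl) ->.
elim: l ul {Sl} => [|e l IH] /=; first by move=> _; rewrite set0I cards0.
move=> /andP[el ul]; rewrite exprD -IH //.
have -> : expect p l (fun E => t ^+ #|(e |: E) :&: S|) =
  t ^+ (e \in S) * expect p l (fun E => t ^+ #|E :&: S|).
  rewrite -expectZ; apply: eq_expect_in => E /subsetP El.
  rewrite -exprD; congr (_ ^+ _); rewrite setIUl.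
  have eE : e \notin E by apply: contra el => /El.
  have [eS|eS] := boolP (e \in S).
    rewrite (_ : [set e] :&: S = [set e])%SET ?cardsU1 ?inE ?(negbTE eE) //.
    by apply/setIidPl; rewrite sub1set.
  rewrite (_ : [set e] :&: S = set0)%SET ?set0U //.
  by apply/setP => z; rewrite !inE; case: eqP => // ->; rewrite (negbTE eS).
by case: (e \in S); rewrite ?expr0 ?expr1; ring.
Qed.

(** Links the recursive expectation, made for induction over the pairs, with the product measure in
    [gnp_prob]: subsets are split by whether they contain the head of the list. *)
Lemma sum_subset_expect l F : uniq l ->
  \sum_(E : {set T} | E \subset l)
     (\prod_(e <- l) (if e \in E then p else 1 - p)) * F E = expect p l F.
Proof.
elim: l F => [|e l IH] F /=.
  move=> _; rewrite (bigD1 set0) /=; last by apply/subsetP => z; rewrite inE.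
  rewrite big_nil mul1r.
  rewrite big1 ?addr0 // => E /andP[/subsetP El /set0Pn[z /El]].
  by rewrite in_nil.
move=> /andP[el ul]; rewrite -!IH // !mulr_sumr.
rewrite (bigID (fun E : {set T} => e \in E)) /=; congr (_ + _).
  rewrite (reindex_onto (fun E => e |: E)%SET (fun E => E :\ e)%SET) /=; last first.
    by move=> E /andP[_ eE]; rewrite setD1K.
  apply: eq_big => [E|E].
    apply/andP/idP => [[/andP[/subsetP El _] /eqP <-]|/subsetP El].
      apply/subsetP => z; rewrite !inE => /andP[ze zE].
      have /El : z \in (e |: E)%SET by case/orP: zE => zE; rewrite !inE ?zE ?orbT.
      by rewrite inE (negbTE ze).
    split; last first.
      by rewrite setU1K //; apply/negP => /El; exact/negP.
    rewrite !inE eqxx andbT; apply/subsetP => z; rewrite !inE.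
    by case/orP => [->//|/El ->]; rewrite orbT.
  move=> /andP[/andP[_ _] /eqP EE]; rewrite big_cons !inE eqxx /= mulrA.
  congr (_ * _ * _); apply: eq_big_seq => z zl; rewrite !inE.
  by case: eqP => // ze; rewrite -ze zl in el.
apply: eq_big => [E|E].
  apply/andP/idP => [[/subsetP El eE]|/subsetP El].
    apply/subsetP => z zE; move: (El z zE); rewrite inE.
    by case/orP => // /eqP ze; rewrite -ze zE in eE.
  split; last by apply/negP => /El; exact/negP.
  by apply/subsetP => z /El zl; rewrite inE zl orbT.
by move=> /andP[_ eE]; rewrite big_cons (negbTE eE) mulrA.
Qed.

(* Markov's inequality: [1 - A] is at most [H]. *)
Lemma expect_indic_ge l (A : pred {set T}) (H : {set T} -> R) :
  0 <= p -> p <= 1 -> (forall E, 0 <= H E) ->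
  (forall E : {set T}, E \subset l -> ~~ A E -> 1 <= H E) ->
  1 - expect p l H <= expect p l (fun E => (A E)%:R).
Proof.
move=> p0 p1 H0 HA; rewrite lerBlDr -expectD -[leLHS](expect_cst l 1).
(* [HA] speaks only of subsets of [l], while [expect_le] compares everywhere. The minimum with 1
   agrees with the constant 1 on subsets of [l] and is below the right-hand side everywhere. *)
rewrite (eq_expect_in (G := fun E => Num.min 1 ((A E)%:R + H E))).
  by apply: expect_le => // E; rewrite ge_min lexx orbT.
move=> E El; apply/esym/min_idPl.
case: (boolP (A E)) => AE; first by rewrite lerDl.
by rewrite add0r HA.
Qed.
End Expect.

Section Gnp.
Import mathcomp.boot.fintype mathcomp.boot.finset.
Variables (R : realType) (n : nat) (p : R).

Definition gexpect (F : {set {set 'I_n}} -> R) : R :=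
  expect p (enum (vpairs 'I_n)) F.

Lemma gnp_probE (A : pred {set {set 'I_n}}) :
  gnp_prob p A = gexpect (fun E => (A E)%:R).
Proof.
rewrite /gexpect -sum_subset_expect ?enum_uniq // /gnp_prob big_mkcondr /=.
apply: eq_big => [E|E _].
  by apply/subsetP/subsetP => EV z /EV; rewrite mem_enum.
by rewrite big_enum /=; case: (A E); rewrite ?mulr1 ?mulr0.
Qed.

Lemma gexpect_exp (S : {set {set 'I_n}}) (t : R) : S \subset vpairs 'I_n ->
  gexpect (fun E => t ^+ #|E :&: S|) = (1 - p + p * t) ^+ #|S|.
Proof.
move=> SV; apply: expect_exp; first exact: enum_uniq.
by apply: (subset_trans SV); apply/subsetP => z; rewrite mem_enum.
Qed.
End Gnp.

(** * Domination and bondage *)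

Section Graph.
Import mathcomp.boot.fintype mathcomp.boot.finset.
Variable T : finType.
Implicit Types (E B : {set {set T}}) (D W : {set T}) (u v w : T).

Definition star v W : {set {set T}} := [set [set v; w]%SET | w in W]%SET.

(** The set [U] allows a vertex [v] outside [D] to be exempted: with [U] its complement, the event
    ignores all edges between [v] and [D]. *)
Definition dominates_out E D (U : {set T}) : bool :=
  [forall v, (v \notin D) && (v \in U) ==> (E :&: star v D != set0)%SET].

Lemma set2_inj v w w' : v != w -> [set v; w]%SET = [set v; w']%SET -> w = w'.
Proof.
move=> vw e; have : w \in [set v; w']%SET by rewrite -e !inE eqxx orbT.
by rewrite !inE eq_sym (negbTE vw) => /eqP.
Qed.

Lemma card_star v W : v \notin W -> #|star v W| = #|W|.
Proof.
move=> vW; rewrite card_in_imset // => w w' wW w'W; apply: set2_inj.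
by apply: contraNneq vW => ->.
Qed.

Lemma star_sub v W : v \notin W -> star v W \subset vpairs T.
Proof.
move=> vW; apply/subsetP => e /imsetP[w wW ->]; rewrite inE cards2.
rewrite (_ : v != w) //; by apply: contraNneq vW => ->.
Qed.

Lemma dominatingE E D : dominating E D = dominates_out E D setT.
Proof.
apply/forallP/forallP => H v; apply/implyP.
  rewrite inE andbT => vD; move: (H v); rewrite vD /= => /existsP[u /andP[uD uv]].
  apply/set0Pn; exists [set u; v]%SET; rewrite inE; apply/andP; split=> //.
  by apply/imsetP; exists u => //; rewrite setUC.
move=> vD; move: (H v); rewrite vD inE /= => /set0Pn[e].
rewrite inE => /andP[eE /imsetP[w wD ew]]; apply/existsP; exists w.
by rewrite wD /adj setUC -ew.
Qed.

Lemma dominating_full E : dominating E setT.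
Proof. by apply/forallP => v; rewrite inE. Qed.

Lemma domination_number_le E D : dominating E D -> (domination_number E <= #|D|)%N.
Proof.
by move=> ED; rewrite /domination_number; case: arg_minnP => [|D' _ ->//];
  exact: dominating_full.
Qed.

Lemma domination_number_ex E :
  exists2 D, dominating E D & #|D| = domination_number E.
Proof.
rewrite /domination_number; case: arg_minnP => [|D' D'E _].
  exact: dominating_full.
by exists D'.
Qed.

Lemma dominatingSr E D W : D \subset W -> dominating E D -> dominating E W.
Proof.
move=> /subsetP DW /forallP DE; apply/forallP => v; apply/implyP => vW.
have vD : v \notin D by apply: contra vW => /DW.
move: (DE v); rewrite vD => /existsP[u /andP[/DW uD uv]].
by apply/existsP; exists u; rewrite uD.
Qed.

Lemma dominatingSl E B D : B \subset E -> dominating B D -> dominating E D.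
Proof.
move=> /subsetP BE /forallP DE; apply/forallP => v; apply/implyP => vD.
move: (DE v); rewrite vD => /existsP[u /andP[uD uv]].
by apply/existsP; exists u; rewrite uD /=; apply: BE.
Qed.

(** Supersets of dominating sets dominate. Padding to size exactly [k] lets the first moment at size
    [r - 1] alone exclude all domination numbers below [r]. *)
Lemma domination_number_le_card E k D : (k <= #|T|)%N -> (#|D| <= k)%N ->
  dominating E D -> exists2 W, dominating E W & #|W| = k.
Proof.
move=> kT Dk ED.
have [W DW Wk] : exists2 W : {set T}, D \subset W & #|W| = k.
  elim: k kT Dk => [|k IH] kT Dk.
    by exists D; rewrite ?subxx //; apply/eqP; rewrite -leqn0.
  move: Dk; rewrite leq_eqVlt => /orP[/eqP <-|]; first by exists D; rewrite ?subxx.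
  rewrite ltnS => Dk; have [W DW Wk] := IH (ltnW kT) Dk.
  have : (0 < #|~: W|)%N by rewrite cardsCs setCK Wk subn_gt0.
  move=> /card_gt0P[z]; rewrite inE => zW.
  exists (z |: W)%SET; last by rewrite cardsU1 zW Wk.
  exact: (subset_trans DW (subsetUr _ _)).
by exists W => //; apply: dominatingSr ED.
Qed.

Lemma domination_number0 : domination_number (set0 : {set {set T}}) = #|T|.
Proof.
have [D ED <-] := domination_number_ex set0.
suff -> : D = setT by rewrite cardsT.
apply/setP => v; rewrite inE; apply: contraTT ED => vD.
apply/forallPn; exists v; rewrite vD /=; apply/existsPn => u.
by rewrite /adj inE andbF.
Qed.

Lemma domination_number_lt E u v : u != v -> adj E u v ->
  (domination_number E < #|T|)%N.
Proof.
move=> uv Euv; apply: leq_ltn_trans (domination_number_le (D := ~: [set v]%SET) _) _.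
  apply/forallP => w; apply/implyP; rewrite !inE negbK => /eqP ->.
  by apply/existsP; exists u; rewrite !inE uv.
by rewrite cardsC1 prednK //; apply/card_gt0P; exists u.
Qed.

(** The edge [uv] keeps [arg min] away from its default: with an edge the domination number is below
    [#|T|], without edges it equals [#|T|], so [B = E] is feasible. *)
Lemma bondage_number_le E B u v : u != v -> adj E u v -> B \subset E ->
  (domination_number E < domination_number (E :\: B))%N ->
  (bondage_number E <= #|B|)%N.
Proof.
move=> uv Euv BE EB; rewrite /bondage_number; case: arg_minnP.
  by rewrite subxx setDv domination_number0; apply: domination_number_lt Euv.
by move=> B' _; apply; rewrite BE.
Qed.

Lemma bondage_number_gt E m u v : u != v -> adj E u v ->
  (forall B, B \subset E -> (#|B| <= m)%N ->
     (domination_number (E :\: B) <= domination_number E)%N) ->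
  (m < bondage_number E)%N.
Proof.
move=> uv Euv H; rewrite /bondage_number; case: arg_minnP.
  by rewrite subxx setDv domination_number0; apply: domination_number_lt Euv.
move=> B /andP[BE lt] _; rewrite ltnNge; apply: contraL lt => Bm.
by rewrite -leqNgt; apply: H.
Qed.

Lemma adjC E u v : adj E u v = adj E v u.
Proof. by rewrite /adj setUC. Qed.

Lemma degE E v : E \subset vpairs T ->
  #|[set u | adj E v u]%SET| = #|E :&: star v (~: [set v])%SET|.
Proof.
move=> /subsetP EV.
rewrite -(card_in_imset (f := fun u => [set v; u]%SET)); last first.
  move=> u u'; rewrite !inE /adj => vu _; apply: set2_inj.
  by apply: contraTneq (EV _ vu) => ->; rewrite inE setUid cards1.
apply: eq_card => e; apply/imsetP/idP => [[u]|].
  rewrite inE /adj => vu ->; rewrite inE vu; apply/imsetP; exists u => //.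
  rewrite !inE; apply: contraTneq (EV _ vu) => ->.
  by rewrite inE setUid cards1.
rewrite inE => /andP[eE /imsetP[u _ eu]]; exists u => //.
by rewrite inE /adj -eu.
Qed.

(* Isolate both ends of an edge [uv]: a dominating set of the remaining graph
   contains [u] and [v], and [v] is redundant in it for [E]. *)
Lemma bondage_number_le_degree E u v : E \subset vpairs T -> u != v -> adj E u v ->
  (bondage_number E <= 2 * max_degree E)%N.
Proof.
move=> EV uv Euv.
pose B := ([set [set u; w] | w in [set w | adj E u w]] :|:
           [set [set v; w] | w in [set w | adj E v w]])%SET.
have BE : B \subset E.
  by apply/subsetP => e; rewrite inE => /orP[] /imsetP[w]; rewrite inE => ? ->.
apply: leq_trans (bondage_number_le uv Euv BE _) _; last first.
  apply: leq_trans (leq_card_setU _ _) _; rewrite mul2n -addnn; apply: leq_add.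
    apply: leq_trans (leq_imset_card _ _) _.
    exact: (leq_bigmax_cond (F := fun v => #|[set u | adj E v u]%SET|)).
  apply: leq_trans (leq_imset_card _ _) _.
  exact: (leq_bigmax_cond (F := fun v => #|[set u | adj E v u]%SET|)).
have isoB w x : w \in [set u; v]%SET -> adj (E :\: B) x w = false.
  rewrite /adj !inE => /orP[] /eqP ->; rewrite setUC; apply/negP => /andP[/negP nB xE];
  apply: nB; apply/orP; [left|right]; apply/imsetP; exists x => //; by rewrite inE.
have [D ED <-] := domination_number_ex (E :\: B).
have uvD w : w \in [set u; v]%SET -> w \in D.
  move=> wuv; apply: contraTT ED => wD; apply/forallPn; exists w.
  by rewrite wD /=; apply/existsPn => x; rewrite isoB // andbF.
have vD : v \in D by apply: uvD; rewrite !inE eqxx orbT.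
have uD : u \in D by apply: uvD; rewrite !inE eqxx.
rewrite (cardsD1 v D) vD add1n ltnS; apply: domination_number_le.
apply/forallP => w; apply/implyP; rewrite !inE negb_and negbK.
have [-> _|wv /= wD] := eqVneq w v.
  by apply/existsP; exists u; rewrite !inE uv uD.
move/forallP: ED => /(_ w); rewrite wD => /existsP[x /andP[xD xw]].
apply/existsP; exists x; rewrite !inE xD andbT.
have -> : x != v.
  apply: contraTneq xw => ->; rewrite adjC isoB //.
  by rewrite !inE eqxx orbT.
by move: xw; rewrite /adj inE => /andP[].
Qed.
End Graph.

(** * Robustness under edge deletion *)

Section Robust.
Import mathcomp.boot.fintype mathcomp.boot.finset.
Variables (R : realType) (T : finType).
Implicit Types (E B : {set {set T}}) (D W : {set T}) (u v w : T).

Definition domsets E r : {set {set T}} := [set D : {set T} | (#|D| == r) && dominating E D].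

Definition domsets_at E r w : R := #|[set D in domsets E r | w \in D]%SET|%:R.

(* The weight [M * t ^+ N] is at least 1 on the sets in which [v] has few
   neighbours [N], and these are the sets that [B] can cheaply destroy at [v]. *)
Definition fragile (r : nat) (t M : R) E v w : R :=
  \sum_(D : {set T} | [&& #|D| == r, w \in D, v \notin D &
                          dominates_out E D (~: [set v])%SET])
     M * t ^+ #|E :&: star v D|.

(** Membership of the pair in [B] is relaxed to both [v] and [w] lying in an edge of [B]; an edge
    then counts [#|e| ^ 2 = 4] times, the cases [v = w] included. *)
Lemma sum_pairs_edges B : B \subset vpairs T ->
  (\sum_v \sum_w ([set v; w]%SET \in B) <= 4 * #|B|)%N.
Proof.
move=> /subsetP BV.
apply: (@leq_trans (\sum_v \sum_w \sum_(e in B) (v \in e) * (w \in e))%N).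
  apply: leq_sum => v _; apply: leq_sum => w _; case: (boolP (_ \in B)) => vwB //.
  by rewrite (bigD1 [set v; w]%SET) ?vwB //= !inE !eqxx orbT leq_addr.
rewrite (eq_bigr (fun v => (\sum_(e in B) (v \in e) * #|e|)%N)) => [|v _]; last first.
  rewrite exchange_big /=; apply: eq_bigr => e _.
  by rewrite -big_distrr /= -big_mkcond /= sum1_card.
rewrite exchange_big /= -sum1_card big_distrr /=; apply: leq_sum => e eB.
have e2 : #|e| = 2 by move: (BV e eB); rewrite inE => /eqP.
by rewrite -big_distrl /= -big_mkcond /= sum1_card e2.
Qed.

Lemma killed_witness E B D : dominating E D -> ~~ dominating (E :\: B) D ->
  exists2 v, v \notin D &
    (E :&: star v D != set0) && (E :&: star v D \subset B).
Proof.
rewrite !dominatingE => /forallP ED /forallPn[v]; rewrite negb_imply => /andP[vD].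
rewrite inE andbT in vD; rewrite negbK => /eqP EB0; exists v => //.
move: (ED v); rewrite vD inE /= => -> /=.
apply/subsetP => e; rewrite inE => /andP[eE es]; apply: contraT => eB.
suff : e \in set0 by rewrite inE.
by rewrite -EB0 !inE eB eE.
Qed.

Lemma dominates_outS E D U : dominating E D -> dominates_out E D U.
Proof.
rewrite dominatingE => /forallP ED; apply/forallP => v; apply/implyP => /andP[vD _].
by move: (ED v); rewrite vD inE.
Qed.

(** A destroyed set pays its unit of weight at one witness [v], in equal shares [1 / N] over its [N]
    edges to [D], all of them in [B]; [N > 0] because [D] dominates in [E]. The hypothesis on
    [m%:R^-1] replaces [1 / N] by a constant plus a geometric term, whose moments are computable. *)
Lemma killed_weight E B D (kinv t M : R) : 0 <= kinv -> 0 <= t -> 0 <= M ->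
  (forall m : nat, (0 < m)%N -> m%:R^-1 <= kinv + M * t ^+ m) ->
  B \subset vpairs T -> dominating E D -> ~~ dominating (E :\: B) D ->
  1 <= \sum_v \sum_w ([set v; w]%SET \in B)%:R * ((w \in D) && (v \notin D))%:R
         * (kinv + M * t ^+ #|E :&: star v D|).
Proof.
move=> k0 t0 M0 kMt BV ED EBD.
have [v vD /andP[N0 NB]] := killed_witness ED EBD.
set N := #|E :&: star v D|; have N_gt0 : (0 < N)%N by rewrite card_gt0.
have ge0 v' w : 0 <= ([set v'; w]%SET \in B)%:R * ((w \in D) && (v' \notin D))%:R
         * (kinv + M * t ^+ #|E :&: star v' D|) :> R.
  by rewrite !mulr_ge0 ?ler0n // addr_ge0 ?mulr_ge0 ?exprn_ge0.
rewrite (bigD1 v) //= ler_wpDr //; first by do 2!(apply: sumr_ge0 => ? _).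
apply: (@le_trans _ _ (\sum_(w in D | [set v; w]%SET \in E) (N%:R^-1 : R))).
  rewrite sumr_const -[leRHS]mulr_natr; set m := #|_|.
  suff <- : N = m by rewrite mulVf // pnatr_eq0 -lt0n.
  rewrite /m /N.
  rewrite -(card_in_imset (f := fun u => [set v; u]%SET)); last first.
    move=> w w' /andP[wD _] _; apply: set2_inj.
    by apply: contraNneq vD => ->.
  apply: eq_card => e; rewrite inE; apply/andP/imsetP => [[eE /imsetP[w wD ew]]|].
    by exists w => //; rewrite unfold_in /= wD -ew.
  move=> [w /andP[wD wE] ->]; split=> //.
  by apply/imsetP; exists w.
rewrite big_mkcond /=; apply: ler_sum => w _; case: ifP => // /andP[wD wE].
rewrite (_ : [set v; w]%SET \in B).
  by rewrite wD vD !mul1r kMt.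
apply: (subsetP NB); rewrite inE wE; apply/imsetP; by exists w.
Qed.

Lemma sum_domsets_at E r (g : T -> R) :
  \sum_(D in domsets E r) \sum_(w in D) g w = \sum_w g w * domsets_at E r w.
Proof.
rewrite (exchange_big_dep xpredT) //=; apply: eq_bigr => w _.
rewrite /domsets_at -sum1_card natr_sum mulr_sumr.
by apply: eq_big => [D|D _]; rewrite ?inE // mulr1.
Qed.

Lemma sum_domsets_at1 E r : \sum_w domsets_at E r w = r%:R * #|domsets E r|%:R.
Proof.
transitivity (\sum_w 1 * domsets_at E r w); first by apply: eq_bigr => w _; rewrite mul1r.
rewrite -sum_domsets_at mulrC -sum1_card natr_sum mulr_suml.
apply: eq_bigr => D; rewrite inE => /andP[/eqP Dr _].
by rewrite sumr_const Dr mul1r.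
Qed.

(* Sets containing a vertex that lies in unusually many dominating sets are
   discarded. Each of the others that [B] destroys is destroyed at some [v]; its
   unit weight is split over the edges between [v] and the set, all in [B].
   The [kinv] part bounds sets with many such edges, [fragile] the rest. *)
Lemma robust_domset E B r (mu f kinv t M T0 : R) :
  0 <= kinv -> 0 <= t -> 0 <= M -> 0 < mu -> 0 < T0 -> (0 < r)%N ->
  (forall m : nat, (0 < m)%N -> m%:R^-1 <= kinv + M * t ^+ m) ->
  B \subset vpairs T ->
  #|T|%:R * mu = r%:R * f ->
  let Q := \sum_w (domsets_at E r w - mu) ^+ 2 in
  let QY := \sum_v \sum_w fragile r t M E v w ^+ 2 in
  2 * Q / mu * 2 + 4 * #|B|%:R * (2 * mu * kinv + T0) + QY / T0 < 7 / 8 * f ->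
  exists2 D : {set T}, #|D| = r & dominating (E :\: B) D.
Proof.
move=> k0 t0 M0 mu0 T00 r0 kMt BV muf Q QY H.
have [/exists_inP[D]|/exists_inPn none] :=
  boolP [exists D in domsets E r, dominating (E :\: B) D].
  by rewrite inE => /andP[/eqP Dr _] DB; exists D.
exfalso; move: H; apply/negP; rewrite -leNgt.
pose Xw := domsets_at E r; pose hv w := 2 * mu < Xw w.
have Q0 : 0 <= Q by apply: sumr_ge0 => w _; exact: sqr_ge0.
(* No separate second moment of the total count is taken: for each [w] the gap is the square
   [2 / mu * (Xw w - 3 / 4 * mu) ^ 2], and summing over [w] counts each set [r] times. *)
have low : 7 / 8 * f - 2 * Q / mu <= #|domsets E r|%:R.
  have rX : \sum_w Xw w = r%:R * #|domsets E r|%:R by exact: sum_domsets_at1.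
  have : \sum_(w : T) (7 / 8 * mu - 2 / mu * (Xw w - mu) ^+ 2) <= \sum_w Xw w.
    apply: ler_sum => w _; rewrite -subr_ge0.
    have -> : Xw w - (7 / 8 * mu - 2 / mu * (Xw w - mu) ^+ 2) =
       mu^-1 * (2 * (Xw w - mu + mu / 4) ^+ 2).
      by field; rewrite gt_eqF.
    by rewrite mulr_ge0 ?invr_ge0 ?(ltW mu0) // mulr_ge0 ?sqr_ge0.
  rewrite sumrB sumr_const -mulr_sumr -/Q rX -mulr_natr => H.
  have r1 : (1 : R) <= r%:R by rewrite ler1n.
  rewrite -(ler_pM2l (lt_le_trans ltr01 r1)).
  apply: le_trans H; rewrite mulrBr; apply: lerB; last first.
    rewrite (_ : 2 * Q / mu = 2 / mu * Q); last by ring.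
    by rewrite ler_peMl // mulr_ge0 // divr_ge0 // ltW.
  by rewrite mulrCA -muf; lra.
suff high : #|domsets E r|%:R <= 2 * Q / mu + 4 * #|B|%:R * (2 * mu * kinv + T0) + QY / T0.
  by lra.
have step1 : #|domsets E r|%:R <=
    \sum_(D in domsets E r) (\sum_(w in D) (hv w)%:R + 
      \sum_v \sum_w ([set v; w]%SET \in B)%:R * ((w \in D) && (v \notin D))%:R
         * ((~~ hv w)%:R * kinv + M * t ^+ #|E :&: star v D|)) :> R.
  rewrite -sum1_card natr_sum; apply: ler_sum => D Ddom.
  have ge0 v w : 0 <= ([set v; w]%SET \in B)%:R * ((w \in D) && (v \notin D))%:R
         * ((~~ hv w)%:R * kinv + M * t ^+ #|E :&: star v D|).
    by rewrite !mulr_ge0 ?ler0n // addr_ge0 ?mulr_ge0 ?exprn_ge0 ?ler0n.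
  have [/exists_inP[w wD hw]|/exists_inPn nhw] := boolP [exists w in D, hv w].
    rewrite (bigD1 w) //= hw -addrA lerDl addr_ge0 //; first exact: sumr_ge0.
    by do 2!(apply: sumr_ge0 => ? _).
  rewrite ler_wpDl //; first exact: sumr_ge0.
  move: Ddom (none _ Ddom); rewrite inE => /andP[Dr DE] DEB.
  apply: le_trans (killed_weight k0 t0 M0 kMt BV DE DEB) _.
  apply: ler_sum => v _; apply: ler_sum => w _.
  case: (boolP (w \in D)) => wD; last by rewrite /= mulr0 !mul0r.
  by rewrite (negbTE (nhw w wD)) mul1r.
apply: (le_trans step1); rewrite big_split /= -addrA; apply: lerD.
  (* If [Xw w > 2 * mu], then [Xw w - mu] exceeds [mu] and is at least half of [Xw w], so
     [2 / mu * (Xw w - mu) ^ 2] is at least [Xw w]. *)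
  rewrite sum_domsets_at (_ : 2 * Q / mu = 2 / mu * Q); last by ring.
  rewrite mulr_sumr; apply: ler_sum => w _; rewrite -/(Xw w).
  case: (boolP (hv w)) => /= [hw|_]; last by rewrite mul0r mulr_ge0 ?sqr_ge0 ?divr_ge0 // ltW.
  rewrite mul1r mulrAC ler_pdivlMr //; rewrite /hv in hw.
  rewrite -/(Xw w); nra.
rewrite exchange_big /=.
under eq_bigr do rewrite exchange_big /=.
have step2 v w : \sum_(D in domsets E r) ([set v; w]%SET \in B)%:R * ((w \in D) && (v \notin D))%:R
         * ((~~ hv w)%:R * kinv + M * t ^+ #|E :&: star v D|) <=
   ([set v; w]%SET \in B)%:R * (2 * mu * kinv + T0) + fragile r t M E v w ^+ 2 / T0.
  case: (boolP ([set v; w]%SET \in B)) => vwB /=; last first.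
    rewrite big1 => [|D _]; last by rewrite !mul0r.
    by rewrite mul0r add0r divr_ge0 ?sqr_ge0 ?ltW.
  rewrite mul1r.
  (* By [y <= T0 + y ^ 2 / T0], a pair in [B] pays [T0] outright and the excess goes to the sum of
     squares over all pairs, a quantity free of [B]. *)
  apply: (@le_trans _ _ (2 * mu * kinv + fragile r t M E v w)); last first.
    rewrite -addrA lerD2l -subr_ge0.
    set y := fragile _ _ _ _ _ _.
    have -> : T0 + y ^+ 2 / T0 - y = T0^-1 * ((T0 - y / 2) ^+ 2 + 3 / 4 * y ^+ 2).
      by field; rewrite gt_eqF.
    apply: mulr_ge0; first by rewrite invr_ge0 ltW.
    by apply: addr_ge0; rewrite ?sqr_ge0 //; apply: mulr_ge0; rewrite ?sqr_ge0 //; lra.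
  under eq_bigr do rewrite mul1r mulrDr.
  rewrite big_split /=; apply: lerD.
    apply: (@le_trans _ _ (\sum_(D in domsets E r) (w \in D)%:R * ((~~ hv w)%:R * kinv))).
      apply: ler_sum => D _; rewrite ler_wpM2r ?mulr_ge0 ?ler0n // ler_nat.
      by case: (w \in D) => //; case: (v \notin D).
    rewrite -mulr_suml -natr_sum -big_mkcondr /= sum1_card.
    rewrite (eq_card (B := mem [set D in domsets E r | w \in D]%SET)); last first.
      by move=> D; rewrite inE.
    rewrite -/(domsets_at E r w) -/(Xw w).
    case: (boolP (hv w)) => hw; first by rewrite mul0r mulr0 !mulr_ge0 // ltW.
    by rewrite mul1r ler_wpM2r // leNgt.
  rewrite [leRHS]big_mkcond /= [leLHS]big_mkcond /=; apply: ler_sum => D _.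
  rewrite inE; case: (boolP (#|D| == r)) => //= _.
  case: (boolP (dominating E D)) => DE.
    rewrite (dominates_outS _ DE) andbT.
    by case: ifP; rewrite ?mul1r ?mul0r.
  by case: ifP => // _; rewrite mulr_ge0 ?exprn_ge0.
apply: (@le_trans _ _ (\sum_v \sum_w
  (([set v; w]%SET \in B)%:R * (2 * mu * kinv + T0) + fragile r t M E v w ^+ 2 / T0))).
  by apply: ler_sum => v _; apply: ler_sum => w _; exact: step2.
under eq_bigr do rewrite big_split /= -!mulr_suml.
rewrite big_split /= -!mulr_suml lerD2r ler_wpM2r //.
  by rewrite addr_ge0 ?(ltW T00) // !mulr_ge0 // ltW.
under eq_bigr do rewrite -natr_sum.
by rewrite -natr_sum -natrM ler_nat sum_pairs_edges.
Qed.
End Robust.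

(** * Moments *)

Section Moments.
Import mathcomp.boot.fintype mathcomp.boot.finset.
Variables (R : realType) (n : nat) (p : R).
Hypotheses (p0 : 0 <= p) (p1 : p <= 1).
Let T := 'I_n.
Implicit Types (E B : {set {set T}}) (D W U : {set T}) (u v w : T).
Local Notation gE := (gexpect p).

Lemma eq_gexpect (F G : {set {set T}} -> R) : F =1 G -> gE F = gE G.
Proof. exact: eq_expect. Qed.

Lemma star_disjoint u v W : u \notin W -> v \notin W -> u != v ->
  [disjoint star u W & star v W]%B.
Proof.
move=> uW vW uv; rewrite -setI_eq0; apply/eqP/setP => e; rewrite !inE.
apply/negP => /andP[/imsetP[w wW ->] /imsetP[w' w'W ew]].
have : u \in [set v; w']%SET by rewrite -ew !inE eqxx.
rewrite !inE (negbTE uv) /= => /eqP uw'.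
by rewrite uw' w'W in uW.
Qed.

Lemma starS v D W : D \subset W -> star v D \subset star v W.
Proof. by move=> DW; apply: imsetS. Qed.

Lemma starU v D W : star v (D :|: W) = (star v D :|: star v W)%SET.
Proof. exact: imsetU. Qed.

Lemma gexpect_prod U W (F : T -> {set {set T}} -> R) :
  [disjoint U & W]%B ->
  (forall v, v \in U -> forall E, F v E = F v (E :&: star v W)%SET) ->
  gE (fun E => \prod_(v in U) F v E) = \prod_(v in U) gE (F v).
Proof.
move=> UW FW; rewrite -[RHS]big_enum /=.
under [LHS]eq_gexpect do rewrite -big_enum /=.
have : {subset enum U <= U} by move=> v; rewrite mem_enum.
elim: (enum U) (enum_uniq U) => [|v s IH] /=.
  by move=> _ _; rewrite big_nil; under eq_gexpect do rewrite big_nil; exact: expect_cst.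
move=> /andP[vs us] sU; rewrite big_cons -IH //; last first.
  by move=> z zs; apply: sU; rewrite inE zs orbT.
under eq_gexpect do rewrite big_cons.
have vU : v \in U by apply: sU; rewrite inE eqxx.
apply: (@expect_indep _ _ p _ (star v W)) => E; first exact: FW.
apply: eq_big_seq => u us'.
have uU : u \in U by apply: sU; rewrite inE us' orbT.
rewrite [LHS]FW // [RHS]FW //; congr (F u _).
rewrite setDE -setIA; congr (_ :&: _)%SET; apply/esym/setIidPr.
rewrite -disjoints_subset; apply: star_disjoint.
- by rewrite (disjointFr UW).
- by rewrite (disjointFr UW).
- by apply: contraNneq vs => <-.
Qed.

Definition isolated E v W : R := 0 ^+ #|E :&: star v W|.

Lemma isolatedE E v W : isolated E v W = (E :&: star v W == set0)%SET%:R.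
Proof. by rewrite /isolated expr0n cards_eq0. Qed.

Lemma isolatedI E v D W : D \subset W ->
  isolated (E :&: star v W)%SET v D = isolated E v D.
Proof.
move=> DW; rewrite /isolated -setIA.
by rewrite (setIidPr (starS v DW)).
Qed.

Lemma isolatedU E v D W : isolated E v (D :|: W) = isolated E v D * isolated E v W.
Proof. by rewrite !isolatedE starU setIUr setU_eq0 -natrM mulnb. Qed.

Lemma isolated_le1 E v D : isolated E v D <= 1.
Proof. by rewrite isolatedE; case: eqP. Qed.

Lemma gexpect_isolated v D : v \notin D ->
  gE (fun E => isolated E v D) = (1 - p) ^+ #|D|.
Proof.
by move=> vD; rewrite /isolated gexpect_exp ?star_sub // mulr0 addr0 card_star.
Qed.

Lemma dominates_out_prod E D U :
  (dominates_out E D U)%:R = \prod_(v in U :\: D) (1 - isolated E v D) :> R.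
Proof.
have [/forallP H|/forallPn[v]] := boolP (dominates_out E D U).
  rewrite big1 // => v; rewrite inE => vUD.
  by move: (H v); rewrite vUD isolatedE => /negbTE ->; rewrite subr0.
rewrite negb_imply => /andP[vUD]; rewrite negbK => H.
by rewrite (bigD1 v) ?inE //= isolatedE H subrr mul0r.
Qed.

Lemma gexpect_dominating D :
  gE (fun E => (dominating E D)%:R) = (1 - (1 - p) ^+ #|D|) ^+ (n - #|D|).
Proof.
under eq_gexpect do rewrite dominatingE dominates_out_prod.
rewrite (gexpect_prod (W := D)).
- rewrite (eq_bigr (fun=> 1 - (1 - p) ^+ #|D|)) => [|v].
    by rewrite prodr_const cardsD setTI cardsT card_ord.
  rewrite !inE andbT => vD.
  by rewrite /gexpect expectB expect_cst -/(gexpect p _) gexpect_isolated.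
- by rewrite disjoint_sym disjoints_subset setTD setCK.
- by move=> v _ E; rewrite isolatedI.
Qed.

(** Inclusion and exclusion; being isolated from both sets is being isolated from their union. *)
Lemma gexpect_two D D' v : v \notin D :|: D' -> #|D| = #|D'| ->
  gE (fun E => (1 - isolated E v D) * (1 - isolated E v D')) =
  1 - 2 * (1 - p) ^+ #|D| + (1 - p) ^+ #|D :|: D'|%SET.
Proof.
move=> vDD cDD'.
transitivity (gE (fun E => (1 + isolated E v (D :|: D')%SET) -
   (isolated E v D + isolated E v D'))).
  by apply: eq_expect => E; rewrite isolatedU; ring.
rewrite /gexpect expectB !expectD expect_cst -/(gexpect p _) -!/(gexpect p _).
have := vDD; rewrite inE negb_or => /andP[vD vD'].
by rewrite !gexpect_isolated // -cDD'; ring.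
Qed.

Lemma dominates_out_isolated E D U v : dominates_out E D U ->
  v \in U :\: D -> isolated E v D = 0.
Proof.
move=> /forallP H; rewrite inE => vUD.
by move: (H v); rewrite vUD isolatedE => /negbTE ->.
Qed.

Lemma dominates_two_le E D D' U :
  (dominates_out E D U && dominates_out E D' U)%:R <=
  \prod_(v in U :\: (D :|: D')) ((1 - isolated E v D) * (1 - isolated E v D')) :> R.
Proof.
case: (boolP (_ && _)) => [/andP[ED ED']|_]; last first.
  by apply: prodr_ge0 => v _; rewrite mulr_ge0 ?subr_ge0 ?isolated_le1.
rewrite big1 // => v; rewrite !inE negb_or -andbA => /and3P[vD vD' vU].
by rewrite !(dominates_out_isolated (U := U)) ?inE ?vD ?vD' //= subr0 mulr1.
Qed.

Definition pair_factor (r m : nat) : R := 1 - 2 * (1 - p) ^+ r + (1 - p) ^+ m.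

(** Only the vertices outside both sets are kept. The demands on vertices lying in exactly one of
    them are dropped, whence an inequality. *)
Lemma gexpect_dominating_two r D D' : #|D| = r -> #|D'| = r ->
  gE (fun E => (dominating E D && dominating E D')%:R) <=
  pair_factor r #|D :|: D'|%SET ^+ (n - #|D :|: D'|%SET).
Proof.
move=> Dr D'r.
apply: (@le_trans _ _ (gE (fun E => \prod_(v in setT :\: (D :|: D'))
   ((1 - isolated E v D) * (1 - isolated E v D'))))).
  by apply: expect_le => // E; rewrite !dominatingE; exact: dominates_two_le.
rewrite (gexpect_prod (W := D :|: D')).
- rewrite (eq_bigr (fun=> pair_factor r #|D :|: D'|%SET)) => [|v].
    by rewrite prodr_const cardsD setTI cardsT card_ord.
  by rewrite inE => /andP[vDD _]; rewrite gexpect_two ?Dr.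
- by rewrite disjoint_sym disjoints_subset setTD setCK.
- by move=> v _ E; rewrite !isolatedI ?subsetUl ?subsetUr.
Qed.

(** The exempted [v] contributes its weight and every other outside vertex one [pair_factor], so the
    exponent is one less. As [t <= 1], the two weights merge: the union receives at most as many
    edges from [v] as the two sets together. *)
Lemma gexpect_fragile_two r D D' v (t : R) : 0 <= t -> t <= 1 ->
  #|D| = r -> #|D'| = r -> v \notin D :|: D' ->
  gE (fun E => (dominates_out E D (~: [set v]) && dominates_out E D' (~: [set v]))%SET%:R
     * (t ^+ #|E :&: star v D| * t ^+ #|E :&: star v D'|)) <=
  pair_factor r #|D :|: D'|%SET ^+ (n - #|D :|: D'|%SET).-1 *
  (1 - p + p * t) ^+ #|D :|: D'|%SET.
Proof.
move=> t0 t1 Dr D'r vDD.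
pose U := (~: [set v] :\: (D :|: D'))%SET.
pose F u E := if u == v then t ^+ #|E :&: star v (D :|: D')|%SET
   else (1 - isolated E u D) * (1 - isolated E u D').
have vU : v \notin U by rewrite !inE eqxx andbF.
apply: (@le_trans _ _ (gE (fun E => \prod_(u in (v |: U)%SET) F u E))).
  apply: expect_le => // E; rewrite big_setU1 //= mulrC /F eqxx.
  apply: ler_pM; rewrite ?ler0n ?mulr_ge0 ?exprn_ge0 //.
    rewrite -exprD; apply: ler_wiXn2l => //.
    by rewrite starU setIUr leq_card_setU.
  apply: (le_trans (dominates_two_le E D D' _)).
  rewrite le_eqVlt; apply/orP; left; apply/eqP; apply: eq_bigr => u.
  by rewrite inE => /andP[_]; rewrite !inE => /negbTE ->.
rewrite (gexpect_prod (W := D :|: D')).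
- rewrite big_setU1 //= /F eqxx gexpect_exp ?star_sub // card_star // mulrC.
  rewrite (eq_bigr (fun=> pair_factor r #|D :|: D'|%SET)) => [|u]; last first.
    rewrite !inE => /andP[uDD /negbTE ->]; rewrite gexpect_two ?Dr // inE //.
  rewrite prodr_const le_eqVlt; apply/orP; left; apply/eqP; congr (_ ^+ _ * _).
  rewrite /U setDE setIC -setDE.
  have := cardsD1 v (~: (D :|: D'))%SET; rewrite inE vDD add1n.
  by rewrite [X in X = _]cardsCs setCK card_ord => ->.
- rewrite disjoint_sym disjoints_subset; apply/subsetP => u uDD.
  rewrite !inE negb_or; apply/andP; split.
    by apply: contraNneq vDD => <-.
  by move: uDD; rewrite inE => ->.
- move=> u _ E; rewrite /F; case: eqP => [->|_]; first by rewrite -setIA setIid.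
  by rewrite !isolatedI ?subsetUl ?subsetUr.
Qed.
End Moments.

(** * Second moments of the counts per vertex and of the fragile weights *)

Section SecondMoment.
Import mathcomp.boot.fintype mathcomp.boot.finset.
Variables (R : realType) (n : nat) (p : R).
Hypotheses (p0 : 0 <= p) (p1 : p <= 1).
Let T := 'I_n.
Implicit Types (E B : {set {set T}}) (D W U : {set T}) (u v w : T).
Local Notation gE := (gexpect p).

Lemma natr_and (a b : bool) : (a && b)%:R = a%:R * b%:R :> R.
Proof. by case: a; rewrite ?mul1r ?mul0r. Qed.

Lemma card_domsets_sum E r :
  #|domsets E r|%:R = \sum_(D : {set T} | #|D| == r) (dominating E D)%:R :> R.
Proof.
rewrite -sum1_card natr_sum big_mkcond [RHS]big_mkcond /=; apply: eq_bigr => D _.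
by rewrite inE; case: eqP => //= _; case: dominating.
Qed.

Lemma domsets_at_sum E r w : domsets_at R E r w =
  \sum_(D : {set T} | #|D| == r) (w \in D)%:R * (dominating E D)%:R.
Proof.
rewrite /domsets_at -sum1_card natr_sum big_mkcond [RHS]big_mkcond /=.
apply: eq_bigr => D _; rewrite !inE.
by case: eqP => //= _; case: dominating; case: (w \in D); rewrite ?mulr0 ?mulr1.
Qed.

Lemma card_rsets r : #|(fun D : {set T} => #|D| == r)| = 'C(n, r).
Proof.
transitivity #|[set D : {set T} | #|D| == r]%SET|; last by rewrite card_draws card_ord.
by apply: eq_card => D; rewrite inE.
Qed.

Lemma gexpect_card_domsets r :
  gE (fun E => #|domsets E r|%:R) = expected_dominating n r p.
Proof.
under eq_gexpect do rewrite card_domsets_sum.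
rewrite /gexpect expect_sum.
under eq_bigr => D /eqP Dr do rewrite -/(gexpect p _) gexpect_dominating Dr.
rewrite sumr_const -mulr_natl /expected_dominating; congr (_%:R * _).
exact: card_rsets.
Qed.

(** The factor [#|D :&: D'|] arises when the squared counts are summed over [w]: a pair of sets
    appears once per common vertex, and disjoint pairs drop out. *)
Definition pair_sum (r : nat) (g : nat -> nat -> R) : R :=
  \sum_(D : {set T} | #|D| == r) \sum_(D' : {set T} | #|D'| == r)
    #|D :&: D'|%SET%:R * g #|D :|: D'|%SET #|D' :\: D|.

Lemma card_setI_sum D D' : \sum_w (w \in D)%:R * (w \in D')%:R = #|D :&: D'|%SET%:R :> R.
Proof.
rewrite -sum1_card natr_sum [RHS]big_mkcond /=; apply: eq_bigr => w _.
by rewrite inE; case: (w \in D); rewrite ?mul0r ?mul1r //; case: (w \in D').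
Qed.

(** The mean of the summed counts is [r f = n mu], so the cross term and the constant of the
    expanded square combine to [- mu * (r f)]. *)
Lemma gexpect_variance r (mu : R) :
  n%:R * mu = r%:R * expected_dominating n r p ->
  gE (fun E => \sum_w (domsets_at R E r w - mu) ^+ 2) <=
  pair_sum r (fun m _ => pair_factor p r m ^+ (n - m)) -
    mu * (r%:R * expected_dominating n r p).
Proof.
move=> muf.
pose P D := #|D| == r.
have -> : gE (fun E => \sum_w (domsets_at R E r w - mu) ^+ 2) =
  gE (fun E => \sum_(D | P D) \sum_(D' | P D')
     #|D :&: D'|%SET%:R * (dominating E D && dominating E D')%:R +
     (- (2 * mu * r%:R) * #|domsets E r|%:R + n%:R * mu ^+ 2)).
  apply: eq_gexpect => E.
  transitivity (\sum_w (domsets_at R E r w ^+ 2 - 2 * mu * domsets_at R E r w + mu ^+ 2)).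
    by apply: eq_bigr => w _; ring.
  rewrite big_split sumrB /= -addrA; congr (_ + _).
    transitivity (\sum_w \sum_(D | P D) \sum_(D' | P D')
      (w \in D)%:R * (w \in D')%:R * (dominating E D && dominating E D')%:R : R).
      apply: eq_bigr => w _; rewrite expr2 domsets_at_sum mulr_suml.
      apply: eq_bigr => D _; rewrite mulr_sumr; apply: eq_bigr => D' _.
      by rewrite -mulnb natrM; ring.
    rewrite exchange_big /=; apply: eq_bigr => D _.
    rewrite exchange_big /=; apply: eq_bigr => D' _.
    by rewrite -mulr_suml card_setI_sum.
  rewrite -mulr_sumr sum_domsets_at1 sumr_const card_ord -[mu ^+ 2 *+ n]mulr_natl.
  by ring.
rewrite /gexpect !expectD expect_cst (expectZ p _ (- (2 * mu * r%:R))).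
rewrite -!/(gexpect p _) gexpect_card_domsets.
rewrite addrA [leLHS](_ : _ = gE (fun E => \sum_(D | P D) \sum_(D' | P D')
     #|D :&: D'|%SET%:R * (dominating E D && dominating E D')%:R) -
    mu * (r%:R * expected_dominating n r p)); last first.
  rewrite -addrA; congr (_ + _); rewrite expr2 [n%:R * _]mulrA muf; ring.
rewrite lerD2r /gexpect expect_sum; apply: ler_sum => D /eqP Dr.
rewrite expect_sum; apply: ler_sum => D' /eqP D'r.
rewrite expectZ; apply: ler_wpM2l; first exact: ler0n.
exact: gexpect_dominating_two.
Qed.

(** Squaring and summing over [w] again weights pairs by their intersection; all [v] obey the same
    bound, whence the factor [n]. The absolute value makes the bound nonnegative for pairs that
    contain [v], whose own contribution is zero. *)
Lemma gexpect_fragile r (t M : R) : 0 <= t -> t <= 1 ->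
  gE (fun E => \sum_v \sum_w fragile r t M E v w ^+ 2) <=
  n%:R * (M ^+ 2 * pair_sum r (fun m _ =>
     `|pair_factor p r m| ^+ (n - m).-1 * (1 - p + p * t) ^+ m)).
Proof.
move=> t0 t1.
have q0 : 0 <= 1 - p + p * t by rewrite addr_ge0 ?subr_ge0 ?mulr_ge0.
pose P D := #|D| == r.
rewrite /gexpect expect_sum -[n in n%:R]card_ord mulr_natl -sumr_const.
apply: ler_sum => v _.
pose H E D := dominates_out E D (~: [set v])%SET.
have -> : expect p (enum (vpairs T)) (fun E => \sum_w fragile r t M E v w ^+ 2) =
  gE (fun E => \sum_(D | P D) \sum_(D' | P D')
     (M ^+ 2 * #|D :&: D'|%SET%:R * ((v \notin D) && (v \notin D'))%:R) *
     ((H E D && H E D')%:R * (t ^+ #|E :&: star v D| * t ^+ #|E :&: star v D'|))).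
  apply: eq_gexpect => E.
  transitivity (\sum_w \sum_(D | P D) \sum_(D' | P D')
     (w \in D)%:R * (w \in D')%:R * (M ^+ 2 * ((v \notin D) && (v \notin D'))%:R *
     ((H E D && H E D')%:R * (t ^+ #|E :&: star v D| * t ^+ #|E :&: star v D'|)))).
    apply: eq_bigr => w _.
    have -> : fragile r t M E v w = \sum_(D | P D)
       (w \in D)%:R * ((v \notin D)%:R * (H E D)%:R * (M * t ^+ #|E :&: star v D|)).
      rewrite /fragile big_mkcond [RHS]big_mkcond /=; apply: eq_bigr => D _.
      rewrite /P -/(H E D); case: eqP => //= _.
      case: (w \in D); rewrite ?mul0r // mul1r.
      case: (v \notin D); rewrite ?mul0r // mul1r.
      by case: (H E D); rewrite ?mul0r // mul1r.
    rewrite expr2 mulr_suml; apply: eq_bigr => D _.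
    rewrite mulr_sumr; apply: eq_bigr => D' _.
    rewrite !natr_and; move: (H E D) (H E D') (t ^+ _) (t ^+ _) => b b' x x'.
    by ring.
  rewrite exchange_big /=; apply: eq_bigr => D _.
  rewrite exchange_big /=; apply: eq_bigr => D' _.
  rewrite -mulr_suml card_setI_sum mulrA; congr (_ * _).
  by rewrite mulrA [_ * M ^+ 2]mulrC.
rewrite /gexpect expect_sum /pair_sum mulr_sumr; apply: ler_sum => D /eqP Dr.
rewrite expect_sum mulr_sumr; apply: ler_sum => D' /eqP D'r.
rewrite expectZ -[leLHS]mulrA -[leLHS]mulrA; apply: ler_wpM2l; first exact: sqr_ge0.
apply: ler_wpM2l; first exact: ler0n.
case: (boolP (v \notin D)) => vD; last by rewrite /= mul0r !mulr_ge0 ?exprn_ge0.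
case: (boolP (v \notin D')) => vD'; last by rewrite /= mul0r !mulr_ge0 ?exprn_ge0.
rewrite mul1r; apply: le_trans (gexpect_fragile_two p0 p1 t0 t1 Dr D'r _) _.
  by rewrite inE negb_or vD.
by apply: ler_wpM2r; rewrite ?exprn_ge0 // -normrX ler_norm.
Qed.

End SecondMoment.

(** * Counting pairs of sets by their overlap *)

Section PairSum.
Import mathcomp.boot.fintype mathcomp.boot.finset.
Variables (R : realType) (n : nat).
Let T := 'I_n.
Implicit Types (D : {set T}) (w : T).

Lemma card_draws_mem r w : (0 < r)%N ->
  #|[set D : {set T} | (#|D| == r) && (w \in D)]%SET| = 'C(n.-1, r.-1).
Proof.
move=> r0.
have n0 : (0 < n)%N by apply: leq_ltn_trans (ltn_ord w).
have binE : 'C(n, r) = ('C(n.-1, r) + 'C(n.-1, r.-1))%N.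
  by case: (n) (r) n0 r0 => [|m] [|k] // _ _; rewrite binS.
have := cardsID [set D : {set T} | w \in D]%SET [set D : {set T} | #|D| == r]%SET.
rewrite card_draws card_ord binE.
have -> : #|[set D : {set T} | #|D| == r] :\: [set D : {set T} | w \in D]|%SET = 'C(n.-1, r).
  have cw : n.-1 = #|~: [set w]%SET| by rewrite cardsC1 card_ord.
  rewrite cw -cards_draws; apply: eq_card => D.
  by rewrite !inE subsetC sub1set inE.
by rewrite addnC => /addnI <-; apply: eq_card => D; rewrite !inE.
Qed.

(** Each [w] is common to ['C(n.-1, r.-1) ^ 2] pairs, and [n * 'C(n.-1, r.-1) = r * 'C(n, r)]. *)
Lemma pair_sum1 r : (0 < r)%N ->
  n%:R * pair_sum n r (fun _ _ => (1 : R)) = (r%:R * 'C(n, r)%:R) ^+ 2 :> R.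
Proof.
move=> r0.
have -> : pair_sum n r (fun _ _ => (1 : R)) = \sum_(w : T) ('C(n.-1, r.-1)%:R ^+ 2).
  transitivity (\sum_(D : {set T} | #|D| == r) \sum_(D' : {set T} | #|D'| == r) 
    \sum_w ((w \in D)%:R * (w \in D')%:R : R)).
    apply: eq_bigr => D _; apply: eq_bigr => D' _.
    by rewrite mulr1 card_setI_sum.
  under eq_bigr do rewrite exchange_big /=.
  rewrite exchange_big /=; apply: eq_bigr => w _.
  rewrite -(card_draws_mem w r0) -sum1_card natr_sum expr2 mulr_suml.
  rewrite big_mkcond [RHS]big_mkcond /=; apply: eq_bigr => D _.
  rewrite inE; case: eqP => //= _; case: (w \in D); last first.
    by rewrite big1 // => D' _; rewrite mul0r.
  rewrite mul1r big_mkcond [RHS]big_mkcond /=; apply: eq_bigr => D' _.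
  by rewrite inE mul1r; case: eqP => //= _; case: (w \in D').
rewrite sumr_const card_ord -(mulr_natl ('C(n.-1, r.-1)%:R ^+ 2)) mulrA -expr2.
rewrite -exprMn -!natrM.
congr (_%:R ^+ 2); case: (n) r0 => [|m]; case: (r) => [|k] // _.
  by rewrite bin0n muln0.
by rewrite /= mul_bin_diag.
Qed.

(** [D'] is recovered from [D :\: D'] and [D' :\: D], a [j]-subset of [D] and a [j]-subset of the
    vertices. *)
Lemma card_draws_setD r D j : #|D| = r ->
  (#|[set D' : {set T} | (#|D'| == r) && (#|D' :\: D| == j)]%SET| <= 'C(r, j) * 'C(n, j))%N.
Proof.
move=> Dr.
have -> : 'C(n, j) = #|[set D : {set T} | #|D| == j]%SET| by rewrite card_draws card_ord.
rewrite -{2}Dr -(cards_draws D j) -cardsX.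
rewrite -(card_in_imset (f := fun D' => (D :\: D', D' :\: D)%SET)).
  apply: subset_leq_card; apply/subsetP => x /imsetP[D']; rewrite inE.
  move=> /andP[/eqP D'r /eqP D'j] ->; rewrite !inE /= D'j eqxx andbT subsetDl /=.
  by rewrite -D'j (cardsD D') D'r -Dr setIC -cardsD.
move=> D1 D2 _ _ [e1 e2].
have H X : X = (D :\: (D :\: X) :|: X :\: D)%SET.
  by apply/setP => z; rewrite !inE; case: (z \in D); case: (z \in X).
by rewrite (H D1) (H D2) e1 e2.
Qed.

(* Pairs of [r]-sets with [j] elements outside each other: those with weight at
   most [A] are compared with the pair count, the others are counted by [j]. *)
Lemma pair_sum_le r (g : nat -> nat -> R) (h : nat -> R) (A K : R) : (0 < r)%N ->
  0 <= K -> (forall j, (j <= r)%N -> g (r + j)%N j <= A + h j) ->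
  (forall j, (j < r)%N -> 'C(r, j)%:R * 'C(n, j)%:R * h j <= 'C(n, r)%:R * K) ->
  (forall j, 0 <= h j) ->
  n%:R * pair_sum n r g <= (r%:R * 'C(n, r)%:R) ^+ 2 * (A + n%:R * K).
Proof.
move=> r0 K0 gAh hK h0.
have cI D D' : #|D| = r -> #|D'| = r -> (#|D :&: D'|%SET + #|D' :\: D| = r)%N.
  by move=> Dr D'r; rewrite setIC cardsID.
have cU D D' : #|D| = r -> #|D'| = r -> #|D :|: D'|%SET = (r + #|D' :\: D|)%N.
  move=> Dr D'r; have := cI D D' Dr D'r; rewrite cardsU Dr D'r; lia.
apply: (@le_trans _ _ (n%:R * (pair_sum n r (fun _ _ => A) + 
    \sum_(D : {set T} | #|D| == r) (r%:R * (r%:R * ('C(n, r)%:R * K)))))).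
  rewrite ler_wpM2l ?ler0n // /pair_sum -big_split /=; apply: ler_sum => D /eqP Dr.
  apply: (@le_trans _ _ (\sum_(D' : {set T} | #|D'| == r)
     (#|D :&: D'|%SET%:R * A + #|D :&: D'|%SET%:R * h #|D' :\: D|))).
    apply: ler_sum => D' /eqP D'r; rewrite -mulrDr ler_wpM2l ?ler0n // cU //.
    by rewrite gAh // -(cI D D') // leq_addl.
  rewrite big_split /= lerD2l.
  apply: (@le_trans _ _ (\sum_(D' : {set T} | #|D'| == r)
     \sum_(j < r) (#|D' :\: D| == j)%:R * (r%:R * h j))).
    apply: ler_sum => D' /eqP D'r.
    have [j0|j0] := eqVneq #|D :&: D'|%SET 0%N.
      by rewrite j0 mul0r sumr_ge0 // => j _; rewrite !mulr_ge0 ?ler0n.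
    have jr : (#|D' :\: D| < r)%N by rewrite -[ltnRHS](cI _ _ Dr D'r) -[ltnLHS]add0n ltn_add2r lt0n.
    rewrite (bigD1 (Ordinal jr)) //= eqxx mul1r ler_wpDr //.
      by apply: sumr_ge0 => j _; rewrite !mulr_ge0 ?ler0n.
    by rewrite ler_wpM2r // ler_nat -(cI D D') // leq_addr.
  rewrite exchange_big /=.
  have -> : r%:R * (r%:R * ('C(n, r)%:R * K)) = \sum_(j < r) (r%:R * ('C(n, r)%:R * K)).
    by rewrite sumr_const card_ord [LHS]mulr_natl.
  apply: ler_sum => j _; rewrite -mulr_suml mulrCA ler_wpM2l ?ler0n //.
  apply: le_trans (hK j (ltn_ord j)); rewrite ler_wpM2r // -natrM -natr_sum ler_nat.
  apply: leq_trans (card_draws_setD j Dr).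
  rewrite -sum1_card [leqLHS]big_mkcond [leqRHS]big_mkcond /=.
  by apply: leq_sum => D' _; rewrite inE; case: eqP => //= _; case: eqP.
have -> : pair_sum n r (fun _ _ => A) = A * pair_sum n r (fun _ _ => (1 : R)).
  rewrite /pair_sum mulr_sumr; apply: eq_bigr => D _; rewrite mulr_sumr.
  by apply: eq_bigr => D' _; ring.
have -> : \sum_(D : {set T} | #|D| == r) (r%:R * (r%:R * ('C(n, r)%:R * K))) =
    'C(n, r)%:R * (r%:R * (r%:R * ('C(n, r)%:R * K))).
  by rewrite sumr_const card_rsets [RHS]mulr_natl.
rewrite mulrDr (mulrCA n%:R A) pair_sum1 //.
by rewrite le_eqVlt; apply/orP; left; apply/eqP; ring.
Qed.
End PairSum.

(** * Overlapping pairs *)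

Section Overlap.
Variable R : realType.
Implicit Types (s q x y : R).

Lemma ler_exp2r (x y : R) n : 0 <= x -> x <= y -> x ^+ n <= y ^+ n.
Proof. by move=> x0 xy; apply: lerXn2r => //; rewrite nnegrE ?(le_trans x0). Qed.

Lemma onesub_ge_exp s : 0 <= s -> s <= 1 / 2 -> expR (- (2 * s)) <= 1 - s.
Proof.
move=> s0 s2; rewrite expRN -[leLHS]mul1r ler_pdivrMr ?expR_gt0 //.
apply: (@le_trans _ _ ((1 - s) * (1 + 2 * s))); first by nra.
by rewrite ler_wpM2l ?expR_ge1Dx //; lra.
Qed.

Lemma onesub_le_exp s : 1 - s <= expR (- s).
Proof. exact: expR_ge1Dx. Qed.

Lemma onesubX_ge_exp s n : 0 <= s -> s <= 1 / 2 -> expR (- (2 * s * n%:R)) <= (1 - s) ^+ n.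
Proof.
move=> s0 s2; rewrite -mulNr expRM_natr; apply: ler_exp2r; first exact: expR_ge0.
exact: onesub_ge_exp.
Qed.

Lemma onesubX_le_exp s n : s <= 1 -> (1 - s) ^+ n <= expR (- (s * n%:R)).
Proof.
move=> s1; rewrite -mulNr expRM_natr; apply: ler_exp2r; first by rewrite subr_ge0.
exact: onesub_le_exp.
Qed.

Lemma onesubX_shift s a b : 0 <= s -> s <= 1 / 2 ->
  (1 - s) ^+ a <= (1 - s) ^+ (a + b) * expR (2 * s * b%:R).
Proof.
move=> s0 s2; rewrite exprD -mulrA ler_peMr ?exprn_ge0 ?subr_ge0 //; first by lra.
by rewrite -ler_pdivrMr ?expR_gt0 // mul1r -expRN onesubX_ge_exp.
Qed.

Lemma bin_le_exp n j : ('C(n, j) <= n ^ j)%N.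
Proof.
elim: j => [|j IH]; first by rewrite bin0.
rewrite expnS; apply: leq_trans (_ : j.+1 * 'C(n, j.+1) <= _)%N; first by rewrite leq_pmull.
by rewrite mul_bin_left; apply: leq_mul => //; rewrite leq_subr.
Qed.

Lemma bin_le_2exp n j : ('C(n, j) <= 2 ^ n)%N.
Proof.
elim: n j => [|n IH] [|j]; rewrite ?bin0 ?expn_gt0 //.
by rewrite binS expnS mul2n -addnn leq_add.
Qed.

(** Below [r] the successive ratios [(n - k) / (k + 1)] of binomial coefficients are at least
    [y]. *)
Lemma bin_ratio n r y j : 0 <= y -> y * r%:R <= n%:R - r%:R -> (j <= r)%N ->
  'C(n, j)%:R * y ^+ (r - j) <= 'C(n, r)%:R.
Proof.
move=> y0 yr jr; rewrite -{1}(subKn jr).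
elim: (r - j)%N (leq_subr j r) => [|d IH] dr; first by rewrite subn0 expr0 mulr1.
rewrite exprSr mulrA; apply: le_trans (IH (ltnW dr)).
rewrite mulrAC ler_wpM2r ?exprn_ge0 //.
have e : (r - d = (r - d.+1).+1)%N by lia.
have := mul_bin_left n (r - d.+1); rewrite -e => /(congr1 (fun m => m%:R : R)).
rewrite !natrM => H.
have rn : (r - d <= n)%N.
  rewrite -(ler_nat R); have : r%:R <= n%:R :> R.
    by rewrite -subr_ge0; apply: le_trans yr; rewrite mulr_ge0.
  by apply: le_trans; rewrite ler_nat leq_subr.
have e2 : (n - (r - d.+1))%:R = n%:R - (r - d)%:R + 1 :> R.
  rewrite -natrB // natr1; congr (_%:R); lia.
have rd0 : 0 < (r - d)%:R :> R by rewrite ltr0n; lia.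
have rdr : (r - d)%:R <= r%:R :> R by rewrite ler_nat leq_subr.
rewrite -(ler_pM2l rd0) H e2 mulrCA [leLHS]mulrC; apply: ler_wpM2r => //.
rewrite mulrC; apply: (@le_trans _ _ (y * r%:R)); first by rewrite ler_wpM2l.
by lra.
Qed.

(** The sequence [1 - q ^ j] is concave and vanishes at 0. This makes the gain for nearly equal sets
    linear in [j]. *)
Lemma onesubX_concave q j J : 0 <= q -> q <= 1 -> (j <= J)%N ->
  j%:R * (1 - q ^+ J) <= J%:R * (1 - q ^+ j).
Proof.
move=> q0 q1; elim: J => [|J IH]; first by rewrite leqn0 => /eqP ->.
rewrite leq_eqVlt => /orP[/eqP -> //|]; rewrite ltnS => jJ.
have := IH jJ => {}IH.
have H : j%:R * q ^+ J * (1 - q) <= 1 - q ^+ j.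
  elim: j jJ {IH} => [|j IHj] jJ; first by rewrite !mul0r subrr.
  have := IHj (ltnW jJ) => {}IHj.
  have qJj : q ^+ J <= q ^+ j by apply: ler_wiXn2l => //; apply: ltnW.
  rewrite -natr1 exprS.
  have : q ^+ J * (1 - q) <= q ^+ j * (1 - q) by rewrite ler_wpM2r // subr_ge0.
  lra.
rewrite -[J.+1%:R]natr1 exprS; nra.
Qed.

(* With [s = q ^+ r], the probability that a vertex outside two [r]-sets has a
   neighbour in both, where [j] elements of each lie outside the other. *)
Definition overlap q s j : R := 1 - 2 * s + s * q ^+ j.

Variables (n r : nat) (q s : R).
Hypotheses (q0 : 0 <= q) (q1 : q <= 1) (s0 : 0 <= s) (s8 : s <= 1 / 8).
Hypotheses (r0 : (0 < r)%N) (rn : (4 * r.+1 <= n)%N) (rs : 8 * r%:R * s <= 1).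
Let G := (1 - s) ^+ (n - r).

Let qj0 j : 0 <= q ^+ j. Proof. exact: exprn_ge0. Qed.
Let qj1 j : q ^+ j <= 1. Proof. exact: exprn_ile1. Qed.

Let r_le_n : (r <= n)%N. Proof. by have := rn; lia. Qed.

Let h1s : 0 <= 1 - s. Proof. by have := s8; lra. Qed.

Lemma overlap_ge0 j : 0 <= overlap q s j.
Proof. by rewrite /overlap; have := mulr_ge0 s0 (qj0 j); have := s8; lra. Qed.

(** The factor is at most [(1 - s) ^ 2 * (1 + 2 s q ^ j)]: independence up to an excess that shrinks
    as [j] grows. The range of [m] covers the exponents with and without an exempted vertex; raising
    [m] to [n - r] adds at most [2 r] factors, whence [8 r s]. *)
Lemma overlap_exp_le j m : (m <= n - (r + j))%N -> (n - (r + j) <= m.+1)%N ->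
  (j <= r)%N ->
  overlap q s j ^+ m <= G ^+ 2 * expR (8 * r%:R * s + 2 * n%:R * (s * q ^+ j)).
Proof.
move=> mn nm jr.
have sq0 : 0 <= s * q ^+ j by rewrite mulr_ge0.
have step : overlap q s j ^+ m <= ((1 - s) ^+ 2) ^+ m * expR (2 * n%:R * (s * q ^+ j)).
  apply: (@le_trans _ _ (((1 - s) ^+ 2 * expR (2 * (s * q ^+ j))) ^+ m)).
    apply: ler_exp2r; first exact: overlap_ge0.
    apply: (@le_trans _ _ ((1 - s) ^+ 2 * (1 + 2 * (s * q ^+ j)))).
      by rewrite /overlap; have := s8; have := s0; nra.
    by rewrite ler_wpM2l ?sqr_ge0 // expR_ge1Dx.
  rewrite exprMn ler_wpM2l ?exprn_ge0 // -expRM_natr ler_expR.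
  have : (m%:R : R) <= n%:R by rewrite ler_nat; lia.
  have : 0 <= (m%:R : R) by [].
  nra.
apply: (le_trans step); rewrite expRD [leRHS]mulrA; apply: ler_wpM2r; first exact: expR_ge0.
rewrite exprAC -exprM.
have -> : (m * 2 = 2 * m)%N by rewrite mulnC.
have nrm : (n - r <= m + r.+1)%N by lia.
have -> : G ^+ 2 * expR (8 * r%:R * s) = (G * expR (4 * r%:R * s)) ^+ 2.
  by rewrite exprMn -expRM_natl; congr (_ * expR _); ring.
rewrite mulnC exprM; apply: ler_exp2r; first by rewrite exprn_ge0.
apply: le_trans (onesubX_shift _ (n - r - m) s0 _) _; first by have := s8; lra.
rewrite subnKC; last by lia.
rewrite ler_wpM2l //; first by rewrite exprn_ge0.
rewrite ler_expR.
have : ((n - r - m)%:R : R) <= (2 * r)%:R by rewrite ler_nat; lia.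
rewrite natrM; have := s0; nra.
Qed.

(** For small [j] the factor is at most [(1 - s) * (1 - s (1 - q ^ j))]. Only one power of [G] is
    available, and the second factor has to pay for the choices of [D']. *)
Lemma overlap_exp_le_small j m : (m <= n - (r + j))%N -> (n - (r + j) <= m.+1)%N ->
  (j <= r)%N ->
  overlap q s j ^+ m <= G * expR (4 * r%:R * s - n%:R / 2 * s * (1 - q ^+ j)).
Proof.
move=> mn nm jr.
have sq0 : 0 <= s * (1 - q ^+ j) by rewrite mulr_ge0 // subr_ge0.
have qj := qj0 j; have qj' := qj1 j.
apply: (@le_trans _ _ (((1 - s) * (1 - s * (1 - q ^+ j))) ^+ m)).
  by apply: ler_exp2r; [exact: overlap_ge0 | rewrite /overlap; have := s0; nra].
rewrite exprMn expRD mulrA; apply: ler_pM.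
- by rewrite exprn_ge0.
- by rewrite exprn_ge0 //; have := s8; have := s0; nra.
- apply: le_trans (onesubX_shift _ (n - r - m) s0 _) _; first by have := s8; lra.
  rewrite subnKC; last by lia.
  rewrite ler_wpM2l //; first by rewrite exprn_ge0.
  rewrite ler_expR.
  have : ((n - r - m)%:R : R) <= (2 * r)%:R by rewrite ler_nat; lia.
  by rewrite natrM; have := s0; nra.
- apply: le_trans (onesubX_le_exp _ _) _; first by have := s8; have := s0; nra.
  rewrite ler_expR lerN2.
  have : (n%:R : R) <= (2 * m)%:R by rewrite ler_nat; lia.
  rewrite natrM; nra.
Qed.

(* For [j <= j1] the factor [1 - q ^+ j] beats the number [(r n)^j] of
   choices; for [j1 <= j < j0] binomial ratios do. *)
Lemma overlap_count (x c eta : R) j0 j1 j m : 1 <= x -> n%:R = expR x ->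
  0 < c -> c * r%:R * x <= n%:R * s -> (0 < j1)%N -> 8 * j1%:R <= c * r%:R ->
  q ^+ j1 <= 1 / 2 -> 2 * n%:R * (s * q ^+ j1) <= r%:R ->
  expR (11 * x) <= 'C(n, r)%:R * G ->
  expR (x / 2) * r%:R <= n%:R - r%:R ->
  (j0 <= r)%N -> eta * r%:R <= (r - j0)%:R ->
  2 * r%:R + 1 + 10 * x <= eta * r%:R * (x / 2) ->
  (m <= n - (r + j))%N -> (n - (r + j) <= m.+1)%N -> (j < j0)%N ->
  'C(r, j)%:R * 'C(n, j)%:R * overlap q s j ^+ m <= 'C(n, r)%:R * (G ^+ 2 * expR (- (10 * x))).
Proof.
move=> x1 nx c0 cs j10 j1c qj12 nsq f11 xr j0r etar big mn nm jj0.
have jr : (j <= r)%N by apply: ltnW (leq_trans jj0 j0r).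
have G0 : 0 <= G by rewrite /G exprn_ge0.
have [jj1|jj1] := leqP j j1.
- apply: (@le_trans _ _ (expR (2 * x * j%:R) * (G * expR (4 * r%:R * s - n%:R / 2 * s * (1 - q ^+ j))))).
    apply: ler_pM; rewrite ?mulr_ge0 ?exprn_ge0 ?overlap_ge0 //; last exact: overlap_exp_le_small.
    rewrite expRM_natr (_ : 2 * x = x + x); last by ring.
    rewrite expRD -nx exprMn; apply: ler_pM => //; rewrite -natrX ler_nat.
      apply: leq_trans (bin_le_exp _ _) _.
      by case: (j) => // j'; rewrite leq_exp2r // r_le_n.
    exact: bin_le_exp.
  rewrite mulrCA -expRD.
  have conc : j%:R / (2 * j1%:R) <= 1 - q ^+ j.
    have j1p : 0 < j1%:R :> R by rewrite ltr0n.
    rewrite ler_pdivrMr; last by lra.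
    have := onesubX_concave q0 q1 jj1.
    have jp : 0 <= j%:R :> R by [].
    by have := qj12; nra.
  have H : 2 * x * j%:R <= n%:R / 2 * s * (1 - q ^+ j).
    have j1p : 0 < j1%:R :> R by rewrite ltr0n.
    have jp : 0 <= j%:R :> R by [].
    apply: (@le_trans _ _ (c * r%:R * x / 2 * (j%:R / (2 * j1%:R)))).
      rewrite -subr_ge0.
      have -> : c * r%:R * x / 2 * (j%:R / (2 * j1%:R)) - 2 * x * j%:R =
          x * j%:R * (c * r%:R - 8 * j1%:R) / (4 * j1%:R).
        by field; rewrite gt_eqF.
      apply: divr_ge0; last by lra.
      apply: mulr_ge0; last by lra.
      by apply: mulr_ge0 => //; lra.
    have A0 : 0 <= c * r%:R * x / 2.
      by rewrite divr_ge0 // mulr_ge0 ?mulr_ge0 // ?(ltW c0) // (le_trans ler01).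
    have B0 : 0 <= j%:R / (2 * j1%:R) :> R by rewrite divr_ge0 // mulr_ge0.
    by apply: ler_pM => //; have := cs; lra.
  apply: (@le_trans _ _ (G * expR x)).
    rewrite ler_wpM2l // ler_expR; have := rs; have := s0; lra.
  (* The missing second factor [G] comes from [f11]: since ['C(n, r) * G] is at least [n ^ 11], it
     absorbs the surplus [expR x] and leaves [n ^ 10]. *)
  rewrite [leRHS](_ : _ = G * ('C(n, r)%:R * G * expR (- (10 * x)))); last by ring.
  rewrite ler_wpM2l //.
  apply: (@le_trans _ _ (expR (11 * x) * expR (- (10 * x)))).
    by rewrite -expRD ler_expR; lra.
  by rewrite ler_wpM2r ?expR_ge0.
- apply: (@le_trans _ _ (2 ^+ r * 'C(n, j)%:R * (G ^+ 2 * expR (1 + r%:R)))).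
    apply: ler_pM; rewrite ?mulr_ge0 ?exprn_ge0 ?overlap_ge0 //.
      by rewrite ler_wpM2r // -natrX ler_nat bin_le_2exp.
    apply: le_trans (overlap_exp_le mn nm jr) _.
    rewrite ler_wpM2l ?exprn_ge0 // ler_expR; apply: lerD => //.
    apply: le_trans nsq; rewrite ler_wpM2l ?mulr_ge0 // ler_wpM2l //.
    by apply: ler_wiXn2l => //; apply: ltnW.
  have := @bin_ratio n r (expR (x / 2)) j (expR_ge0 _) xr jr.
  have e2 : (2 : R) ^+ r <= expR r%:R.
    rewrite -[X in expR X]mul1r expRM_natr; apply: ler_exp2r => //.
    by apply: le_trans (expR_ge1Dx 1).
  have key : expR r%:R * expR (1 + r%:R) <= expR (x / 2) ^+ (r - j) * expR (- (10 * x)).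
    rewrite -expRM_natr -!expRD ler_expR.
    have : (r - j0)%:R <= (r - j)%:R :> R by rewrite ler_nat leq_sub2l // ltnW.
    have : 0 <= x / 2 by lra.
    nra.
  move=> H.
  have C0 : 0 <= 'C(n, j)%:R :> R by [].
  have G2 : 0 <= G ^+ 2 by rewrite exprn_ge0.
  apply: (@le_trans _ _ ('C(n, j)%:R * G ^+ 2 * (expR r%:R * expR (1 + r%:R)))).
    rewrite [leLHS](_ : _ = 'C(n, j)%:R * G ^+ 2 * (2 ^+ r * expR (1 + r%:R))); last by ring.
    by rewrite ler_wpM2l ?mulr_ge0 // ler_wpM2r ?expR_ge0.
  apply: (@le_trans _ _ ('C(n, j)%:R * G ^+ 2 * (expR (x / 2) ^+ (r - j) * expR (- (10 * x))))).
    by rewrite ler_wpM2l ?mulr_ge0.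
  rewrite [leLHS](_ : _ = G ^+ 2 * expR (- (10 * x)) * ('C(n, j)%:R * expR (x / 2) ^+ (r - j))); last by ring.
  rewrite [leRHS]mulrC ler_wpM2l // mulr_ge0 ?expR_ge0 //.
Qed.
End Overlap.

(** * The finite probability bound *)

Lemma scale_ge0 (R : realType) (a f : R) (k : nat) : 0 <= a -> 0 <= k%:R * a / f ^+ 2.
Proof. by move=> a0; rewrite divr_ge0 ?sqr_ge0 // mulr_ge0. Qed.

Section FiniteMain.
Import mathcomp.boot.fintype mathcomp.boot.finset.
Variables (R : realType) (n r : nat) (p : R).
Hypotheses (p0 : 0 < p) (p1 : p <= 1) (r0 : (0 < r)%N).
Let T := 'I_n.
Let q := 1 - p.
Let s := q ^+ r.
Let f := expected_dominating n r p.
Let G := (1 - s) ^+ (n - r).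
Local Notation gE := (gexpect p).

Let q0 : 0 <= q. Proof. by rewrite subr_ge0. Qed.
Let q1 : q <= 1. Proof. by rewrite gerBl ltW. Qed.
Let s0 : 0 <= s. Proof. exact: exprn_ge0. Qed.
Let fE : f = 'C(n, r)%:R * G. Proof. by []. Qed.

Lemma pair_factorE j : pair_factor p r (r + j) = overlap q s j.
Proof. by rewrite /pair_factor /overlap /s exprD. Qed.

Variables (x c eta : R) (j0 j1 : nat).
Hypotheses (s8 : s <= 1 / 8) (rn : (4 * r.+1 <= n)%N) (rs : 8 * r%:R * s <= 1).
Hypotheses (x1 : 1 <= x) (nx : n%:R = expR x) (c0 : 0 < c)
  (cs : c * r%:R * x <= n%:R * s) (j10 : (0 < j1)%N) (j1c : 8 * j1%:R <= c * r%:R)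
  (qj12 : q ^+ j1 <= 1 / 2) (nsq : 2 * n%:R * (s * q ^+ j1) <= r%:R)
  (f11 : expR (11 * x) <= f) (xr : expR (x / 2) * r%:R <= n%:R - r%:R)
  (j0r : (j0 <= r)%N) (etar : eta * r%:R <= (r - j0)%:R)
  (big : 2 * r%:R + 1 + 10 * x <= eta * r%:R * (x / 2)).

(** Exponent of the excess over independence for pairs with at least [j0] vertices outside each
    other, taken at [j0], the worst case. *)
Definition overlap_cost (q s : R) (n r j0 : nat) : R :=
  8 * r%:R * s + 2 * n%:R * (s * q ^+ j0).
Let kappa := overlap_cost q s n r j0.

Let overlap_exp_far j m : (j0 <= j)%N -> (m <= n - (r + j))%N ->
  (n - (r + j) <= m.+1)%N -> (j <= r)%N -> overlap q s j ^+ m <= G ^+ 2 * expR kappa.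
Proof.
move=> j0j mn nm jr; apply: le_trans (overlap_exp_le q0 q1 s0 s8 r0 rn rs mn nm jr) _.
rewrite ler_wpM2l ?sqr_ge0 // ler_expR lerD2l ler_wpM2l ?mulr_ge0 // ler_wpM2l //.
exact: ler_wiXn2l.
Qed.

Let G2 : 0 <= G ^+ 2. Proof. exact: sqr_ge0. Qed.

Lemma pair_sum_variance :
  n%:R * pair_sum n r (fun m _ => pair_factor p r m ^+ (n - m)) <=
  (r%:R * f) ^+ 2 * (expR kappa + n%:R * expR (- (10 * x))).
Proof.
pose h j := if (j < j0)%N then overlap q s j ^+ (n - (r + j)) else 0.
have := @pair_sum_le R n r (fun m _ => pair_factor p r m ^+ (n - m)) h
  (G ^+ 2 * expR kappa) (G ^+ 2 * expR (- (10 * x))) r0.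
move=> /(_ (mulr_ge0 G2 (expR_ge0 _))) H; apply: le_trans (H _ _ _) _.
- move=> j jr; rewrite pair_factorE /h; case: ltnP => jj0.
    by rewrite lerDr mulr_ge0 ?expR_ge0.
  by rewrite addr0 overlap_exp_far.
- move=> j jr; rewrite /h; case: ltnP => jj0; last first.
    by rewrite mulr0 mulr_ge0 // mulr_ge0 // expR_ge0.
  exact: (overlap_count q0 q1 s0 s8 r0 rn rs x1 nx c0 cs j10 j1c qj12 nsq f11 xr
    j0r etar big).
- by move=> j; rewrite /h; case: ltnP => // _; rewrite exprn_ge0 // overlap_ge0.
- by rewrite fE le_eqVlt; apply/orP; left; apply/eqP; ring.
Qed.

Lemma pair_sum_fragile (t : R) : 0 <= t -> t <= 1 ->
  n%:R * pair_sum n r (fun m _ =>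
     `|pair_factor p r m| ^+ (n - m).-1 * (1 - p + p * t) ^+ m) <=
  (r%:R * f) ^+ 2 * (expR kappa * (q + p * t) ^+ (r + j0) + n%:R * expR (- (10 * x))).
Proof.
move=> t0 t1.
have qt0 : 0 <= q + p * t by rewrite addr_ge0 // mulr_ge0 // ltW.
have qt1 : q + p * t <= 1.
  by rewrite /q; have := ler_wpM2l (ltW p0) t1; lra.
pose h j := if (j < j0)%N then overlap q s j ^+ (n - (r + j)).-1 else 0.
have := @pair_sum_le R n r (fun m _ =>
     `|pair_factor p r m| ^+ (n - m).-1 * (1 - p + p * t) ^+ m) h
  (G ^+ 2 * expR kappa * (q + p * t) ^+ (r + j0)) (G ^+ 2 * expR (- (10 * x))) r0.
have ov j : `|pair_factor p r (r + j)| = overlap q s j.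
  by rewrite pair_factorE ger0_norm // overlap_ge0.
move=> /(_ (mulr_ge0 G2 (expR_ge0 _))) H; apply: le_trans (H _ _ _) _.
- move=> j jr; rewrite ov /h; case: ltnP => jj0.
    apply: (@le_trans _ _ (overlap q s j ^+ (n - (r + j)).-1)).
      by rewrite ler_piMr ?exprn_ge0 ?overlap_ge0 // exprn_ile1.
    by rewrite lerDr mulr_ge0 ?exprn_ge0 // mulr_ge0 // expR_ge0.
  rewrite addr0; apply: ler_pM; rewrite ?exprn_ge0 ?overlap_ge0 //.
    by apply: overlap_exp_far => //; rewrite ?leq_pred // leqSpred.
  by apply: ler_wiXn2l => //; rewrite leq_add2l.
- move=> j jr; rewrite /h; case: ltnP => jj0; last first.
    by rewrite mulr0 mulr_ge0 // mulr_ge0 // expR_ge0.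
  apply: (overlap_count q0 q1 s0 s8 r0 rn rs x1 nx c0 cs j10 j1c qj12 nsq f11 xr
    j0r etar big) => //; by rewrite ?leq_pred // leqSpred.
- by move=> j; rewrite /h; case: ltnP => // _; rewrite exprn_ge0 // overlap_ge0.
- by rewrite fE le_eqVlt; apply/orP; left; apply/eqP; ring.
Qed.

Definition robust (r : nat) (b : R) (E : {set {set T}}) : bool :=
  [forall B : {set {set T}}, (B \subset E) && (#|B|%:R <= b) ==>
     [exists D : {set T}, (#|D| == r) && dominating (E :\: B) D]].

Let f0 : 0 < f. Proof. by apply: lt_le_trans f11; exact: expR_gt0. Qed.
Let n0 : 0 < n%:R :> R. Proof. by rewrite nx expR_gt0. Qed.
Let mu := r%:R * f / n%:R.
Let mu0 : 0 < mu. Proof. by rewrite divr_gt0 // mulr_gt0 // ltr0n. Qed.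

(** Both conditions on sums concern [E] alone and yield robustness against all [B] at once, so no
    union bound over the sets [B] is taken. *)
Lemma robust_sufficient (b kinv t M : R) (E : {set {set T}}) : 0 < b ->
  0 <= kinv -> 0 <= t -> 0 <= M ->
  (forall m : nat, (0 < m)%N -> m%:R^-1 <= kinv + M * t ^+ m) ->
  64 * b * r%:R * kinv <= n%:R -> E \subset vpairs T ->
  (\sum_w (domsets_at R E r w - mu) ^+ 2) * (32 / (mu * f)) < 1 ->
  (\sum_v \sum_w fragile r t M E v w ^+ 2) * (256 * b / f ^+ 2) < 1 ->
  robust r b E.
Proof.
move=> b0 k0 t0 M0 kMt bk EV HQ HY; apply/forallP => B; apply/implyP => /andP[BE Bb].
set Q := \sum_w _ in HQ; set QY := \sum_v _ in HY.
(* With [T0 = f / (32 b)] the share [4 b T0] is [f / 8]. The variance, the fragile squares and the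
   [kinv] part take at most [f / 8] each, in total [f / 2 < 7 / 8 f]. *)
have T00 : 0 < f / (32 * b) by rewrite divr_gt0 // mulr_gt0.
have [||D Dr DB] := @robust_domset R T E B r mu f kinv t M (f / (32 * b)) k0 t0 M0 mu0 T00
  r0 kMt (subset_trans BE EV).
- by rewrite card_ord /mu mulrC divfK // gt_eqF.
- rewrite -/Q -/QY.
  have h1 : 2 * Q / mu * 2 <= f / 8.
    rewrite (_ : 2 * Q / mu * 2 = Q * (32 / (mu * f)) * (f / 8)).
      by rewrite ger_pMl ?(ltW HQ) // divr_gt0.
    by field; rewrite !gt_eqF.
  have h2 : QY / (f / (32 * b)) <= f / 8.
    rewrite (_ : QY / (f / (32 * b)) = QY * (256 * b / f ^+ 2) * (f / 8)).
      by rewrite ger_pMl ?(ltW HY) // divr_gt0.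
    by field; rewrite !gt_eqF.
  have h3 : 4 * #|B|%:R * (2 * mu * kinv + f / (32 * b)) <= f / 4.
    apply: (@le_trans _ _ (4 * b * (2 * mu * kinv + f / (32 * b)))).
      apply: ler_wpM2r; last by rewrite ler_wpM2l.
      apply: addr_ge0; last exact: ltW.
      by apply: mulr_ge0 => //; apply: mulr_ge0 => //; exact: ltW.
    rewrite (_ : 4 * b * _ = f / 8 * (64 * b * r%:R * kinv / n%:R) + f / 8); last first.
      by rewrite /mu; field; rewrite !gt_eqF.
    have : 64 * b * r%:R * kinv / n%:R <= 1 by rewrite ler_pdivrMr // mul1r.
    have := f0; nra.
  by have := f0; lra.
- by apply/existsP; exists D; rewrite Dr eqxx.
Qed.

Lemma expect_variance_le :
  gE (fun E : {set {set 'I_n}} => (\sum_w (domsets_at R E r w - mu) ^+ 2) * (32 / (mu * f))) <=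
  32 * r%:R * (expR kappa - 1 + n%:R * expR (- (10 * x))).
Proof.
under eq_gexpect do rewrite mulrC.
rewrite /gexpect expectZ -/(gexpect p _).
have mun : n%:R * mu = r%:R * f by rewrite /mu mulrC divfK // gt_eqF.
have := gexpect_variance (ltW p0) p1 mun.
have := pair_sum_variance.
set S := pair_sum _ _ _ => HS HE.
apply: (@le_trans _ _ (32 / (mu * f) * (S - mu * (r%:R * f)))).
  by rewrite ler_wpM2l // divr_ge0 // mulr_ge0 ?(ltW mu0) ?(ltW f0).
rewrite -(ler_pM2l n0) mulrCA mulrBr.
apply: (@le_trans _ _ (32 / (mu * f) * ((r%:R * f) ^+ 2 * (expR kappa + n%:R * expR (- (10 * x))) -
   n%:R * (mu * (r%:R * f))))).
  by rewrite ler_wpM2l ?lerD2r // divr_ge0 // mulr_ge0 ?(ltW mu0) ?(ltW f0).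
rewrite le_eqVlt; apply/orP; left; apply/eqP; rewrite /mu; field.
have rp : r%:R != 0 :> R by rewrite pnatr_eq0 -lt0n.
by rewrite ?gt_eqF ?rp // ltr0n.
Qed.

Lemma expect_fragile_le (b t M : R) : 0 <= t -> t <= 1 -> 0 < b ->
  gE (fun E : {set {set 'I_n}} => (\sum_v \sum_w fragile r t M E v w ^+ 2) * (256 * b / f ^+ 2)) <=
  256 * b * M ^+ 2 * r%:R ^+ 2 * (expR kappa * (q + p * t) ^+ (r + j0) + n%:R * expR (- (10 * x))).
Proof.
move=> t0 t1 b0.
under eq_gexpect do rewrite mulrC.
rewrite /gexpect expectZ -/(gexpect p _).
have cpos : 0 <= 256 * b / f ^+ 2 by apply: scale_ge0; exact: ltW.
apply: le_trans (ler_wpM2l cpos (@gexpect_fragile R n p (ltW p0) p1 r t M t0 t1)) _.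
rewrite (mulrCA n%:R); apply: (@le_trans _ _ (256 * b / f ^+ 2 * (M ^+ 2 * 
  ((r%:R * f) ^+ 2 * (expR kappa * (q + p * t) ^+ (r + j0) + n%:R * expR (- (10 * x))))))).
  by rewrite ler_wpM2l // ler_wpM2l ?sqr_ge0 // pair_sum_fragile.
rewrite le_eqVlt; apply/orP; left; apply/eqP; field.
by rewrite gt_eqF.
Qed.
End FiniteMain.

(** * Sufficient conditions on a fixed graph, and degree tails *)

Section Event.
Import mathcomp.boot.fintype mathcomp.boot.finset.
Variables (R : realType) (n r : nat) (p : R).
Let T := 'I_n.
Implicit Types (E B : {set {set T}}) (D : {set T}) (v : T).

Definition degree E v := #|E :&: star v (~: [set v])%SET|.

Lemma max_degree_le E m : E \subset vpairs T ->
  (forall v, (degree E v <= m)%N) -> (max_degree E <= m)%N.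
Proof. by move=> EV H; apply/bigmax_leqP => v _; rewrite degE //; exact: H. Qed.

Lemma degree_le_max E v : E \subset vpairs T -> (degree E v <= max_degree E)%N.
Proof.
move=> EV; rewrite /degree -degE //.
exact: (leq_bigmax_cond (F := fun v => #|[set u | adj E v u]%SET|)).
Qed.

(** A single vertex [v0] of large degree bounds the maximum degree from below, and it also supplies
    the edge without which the bondage number is undefined. *)
Lemma event_sufficient (b : R) E v0 : (0 < r <= n)%N -> 0 < p -> E \subset vpairs T ->
  robust r b E -> #|domsets E r.-1| = 0%N -> 0 < b ->
  (forall v, (degree E v)%:R <= 4 * (p * n%:R)) ->
  p * n%:R / 8 <= (degree E v0)%:R ->
  [/\ domination_number E = r, b <= (bondage_number E)%:R,
      (bondage_number E <= 2 * max_degree E)%N,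
      p * n%:R / 8 <= (max_degree E)%:R & (max_degree E)%:R <= 4 * (p * n%:R)].
Proof.
move=> /andP[r0 rn] p0 EV rob no b0 dle dge.
have pn0 : 0 < p * n%:R.
  by rewrite mulr_gt0 // ltr0n; apply: leq_ltn_trans (ltn_ord v0).
have [u Euv] : exists u, adj E v0 u.
  have : (0 < degree E v0)%N by rewrite -(ltr0n R); apply: lt_le_trans dge; rewrite divr_gt0.
  rewrite /degree -degE // => /card_gt0P[u]; rewrite inE => ?; by exists u.
have uv : v0 != u.
  by apply: contraTneq (subsetP EV _ Euv) => ->; rewrite inE setUid cards1.
have robB B : B \subset E -> #|B|%:R <= b -> (domination_number (E :\: B) <= r)%N.
  move=> BE Bb; have /forallP/(_ B) := rob; rewrite BE Bb => /existsP[D /andP[/eqP <- DB]].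
  exact: domination_number_le.
have gr : domination_number E = r.
  apply/eqP; rewrite eqn_leq; apply/andP; split.
    by rewrite -[E]setD0; apply: robB; rewrite ?sub0set // cards0 ltW.
  rewrite leqNgt; apply/negP => lt.
  have [D ED Dg] := domination_number_ex E.
  have [||W EW Wr] := domination_number_le_card (E := E) (k := r.-1) (D := D) _ _ ED.
  - by rewrite card_ord; apply: leq_trans rn; exact: leq_pred.
  - by rewrite Dg -ltnS prednK.
  - move/eqP: no; rewrite cards_eq0 => /eqP no.
    have : W \in domsets E r.-1 by rewrite inE Wr eqxx.
    by rewrite no inE.
split => //.
(* Deleting up to [truncn b] edges does no harm, so the bondage number is at least [truncn b + 1],
   which exceeds [b]. *)
- have trb : (Num.truncn b)%:R <= b by rewrite truncn_le ltW.
  apply: (@le_trans _ _ (Num.truncn b).+1%:R); first by rewrite ltW // truncnS_gt.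
  rewrite ler_nat; apply: (bondage_number_gt uv Euv) => B BE Bm.
  by rewrite gr; apply: robB => //; apply: le_trans trb; rewrite ler_nat.
- exact: bondage_number_le_degree Euv.
- by apply: (le_trans dge); rewrite ler_nat degree_le_max.
- apply: (@le_trans _ _ (Num.truncn (4 * (p * n%:R)))%:R); last first.
    by rewrite truncn_le mulr_ge0 // ltW.
  rewrite ler_nat; apply: max_degree_le => // v.
  by rewrite truncn_ge_nat ?dle // mulr_ge0 // ltW.
Qed.

Lemma card_starT v : #|star v (~: [set v])%SET| = n.-1.
Proof. by rewrite card_star ?cardsC1 ?card_ord // !inE eqxx. Qed.

Lemma gexpect_degree v (t : R) :
  gexpect p (fun E : {set {set T}} => t ^+ degree E v) = (1 - p + p * t) ^+ n.-1.
Proof.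
rewrite -(card_starT v) -gexpect_exp //.
by apply: star_sub; rewrite !inE eqxx.
Qed.

Lemma expR_half_le2 : expR (1 / 2 : R) <= 2.
Proof.
have := expR_ge1Dx (- (1 / 2) : R); rewrite expRN => H.
have e0 := expR_gt0 (1 / 2 : R).
have : expR (1 / 2) * (1 + - (1 / 2)) <= expR (1 / 2) * (expR (1 / 2))^-1 :> R.
  by rewrite ler_pM2l.
by rewrite divff ?gt_eqF //; lra.
Qed.

(** Chernoff bound with base [expR (1 / 2) <= 2], so that each factor is at most [1 + p <= expR p];
    a degree above [4 p n] makes its term at least [expR (2 p n)]. *)
Lemma gexpect_high_degree : 0 <= p ->
  gexpect p (fun E : {set {set T}} =>
    expR (- (2 * (p * n%:R))) * \sum_v expR (1 / 2) ^+ degree E v) <=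
  n%:R * expR (- (p * n%:R)).
Proof.
move=> p0; rewrite /gexpect expectZ expect_sum.
have H v : expect p (enum (vpairs T)) (fun E => expR (1 / 2) ^+ degree E v) <=
    expR (p * n%:R).
  rewrite -/(gexpect p _) gexpect_degree.
  apply: (@le_trans _ _ (expR p ^+ n.-1)).
    apply: ler_exp2r.
      have e1 : 1 <= expR (1 / 2) :> R by have := expR_ge1Dx (1 / 2 : R); lra.
      by have := ler_wpM2l p0 e1; lra.
    apply: le_trans (expR_ge1Dx p).
    by have := ler_wpM2l p0 expR_half_le2; lra.
  by rewrite -expRM_natr ler_expR ler_wpM2l // ler_nat leq_pred.
apply: (@le_trans _ _ (expR (- (2 * (p * n%:R))) * \sum_(v : T) expR (p * n%:R))).
  by rewrite ler_wpM2l ?expR_ge0 // ler_sum.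
rewrite sumr_const card_ord -(mulr_natl (expR _)) mulrCA -expRD.
by rewrite (_ : - _ + _ = - (p * n%:R)) //; ring.
Qed.

(** Since [expR (-1) <= 1 / 2], each of the [n - 1 >= n / 2] factors is at most [expR (- p / 2)],
    together at most [expR (- p n / 4)]. *)
Lemma gexpect_low_degree v : 0 <= p -> p <= 1 -> (2 <= n)%N ->
  gexpect p (fun E : {set {set T}} => expR (p * n%:R / 8) * expR (-1) ^+ degree E v) <=
  expR (- (p * n%:R / 8)).
Proof.
move=> p0 p1 n2; rewrite /gexpect expectZ -/(gexpect p _) gexpect_degree.
have e1 : expR (-1) <= 1 / 2 :> R.
  rewrite expRN -[leRHS]mul1r -div1r ler_pdivrMr ?expR_gt0 //.
  by have := expR_ge1Dx (1 : R); lra.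
have e0 := expR_gt0 (-1 : R).
apply: (@le_trans _ _ (expR (p * n%:R / 8) * expR (- (p / 2)) ^+ n.-1)).
  rewrite ler_wpM2l ?expR_ge0 //; apply: ler_exp2r.
    by rewrite addr_ge0 ?subr_ge0 // mulr_ge0 // ltW.
  apply: le_trans (expR_ge1Dx _); have := ler_wpM2l p0 e1; lra.
rewrite -expRM_natr -expRD ler_expR.
have : n%:R / 2 <= n.-1%:R :> R.
  rewrite ler_pdivrMr // -natrM ler_nat; case: n n2 => // m; lia.
by have := p0; nra.
Qed.
End Event.

(** * The five exceptional events and their total probability *)

Section FiniteProbability.
Import mathcomp.boot.fintype mathcomp.boot.finset.
Variables (R : realType) (n r : nat) (p : R).
Hypotheses (p0 : 0 < p) (p1 : p <= 1) (r0 : (0 < r)%N).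
Let T := 'I_n.
Let q := 1 - p.
Let s := q ^+ r.
Variables (x c eta : R) (j0 j1 : nat).
Hypotheses (s8 : s <= 1 / 8) (rn : (4 * r.+1 <= n)%N) (rs : 8 * r%:R * s <= 1).
Hypotheses (x1 : 1 <= x) (nx : n%:R = expR x) (c0 : 0 < c)
  (cs : c * r%:R * x <= n%:R * s) (j10 : (0 < j1)%N) (j1c : 8 * j1%:R <= c * r%:R)
  (qj12 : q ^+ j1 <= 1 / 2) (nsq : 2 * n%:R * (s * q ^+ j1) <= r%:R)
  (f11 : expR (11 * x) <= expected_dominating n r p)
  (xr : expR (x / 2) * r%:R <= n%:R - r%:R)
  (j0r : (j0 <= r)%N) (etar : eta * r%:R <= (r - j0)%:R)
  (big : 2 * r%:R + 1 + 10 * x <= eta * r%:R * (x / 2)).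
Variables (b kinv t M : R).
Hypotheses (b0 : 0 < b) (k0 : 0 <= kinv) (t0 : 0 <= t) (t1 : t <= 1) (M0 : 0 <= M)
  (kMt : forall m : nat, (0 < m)%N -> m%:R^-1 <= kinv + M * t ^+ m)
  (bk : 64 * b * r%:R * kinv <= n%:R).
Let kappa := overlap_cost q s n r j0.
Let z := n%:R * expR (- (10 * x)) : R.

(** Each of [H1] to [H5] is nonnegative and at least 1 when its property fails: a dominating set of
    size [r - 1], uneven counts per vertex, large fragile weights, a degree above [4 p n], a degree
    of [v0] below [p n / 8]. Markov's inequality for the sum is then a union bound. *)
Lemma gnp_finite (A : pred {set {set 'I_n}}) :
  (forall E, domination_number E = r -> b <= (bondage_number E)%:R ->
      (bondage_number E <= 2 * max_degree E)%N ->
      p * n%:R / 8 <= (max_degree E)%:R -> (max_degree E)%:R <= 4 * (p * n%:R) -> A E) ->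
  1 - (expected_dominating n r.-1 p + 32 * r%:R * (expR kappa - 1 + z) +
       256 * b * M ^+ 2 * r%:R ^+ 2 * (expR kappa * (q + p * t) ^+ (r + j0) + z) +
       n%:R * expR (- (p * n%:R)) + expR (- (p * n%:R / 8))) <= gnp_prob p A.
Proof.
move=> HA.
have n0 : (0 < n)%N by apply: leq_trans rn; rewrite muln_gt0.
pose v0 : T := Ordinal n0.
pose f := expected_dominating n r p.
pose mu := r%:R * f / n%:R.
have f0 : 0 < f by apply: lt_le_trans f11; exact: expR_gt0.
pose H1 (E : {set {set T}}) : R := #|domsets E r.-1|%:R.
pose H2 (E : {set {set T}}) : R := 
  (\sum_w (domsets_at R E r w - mu) ^+ 2) * (32 / (mu * f)).
pose H3 (E : {set {set T}}) : R :=
  (\sum_v \sum_w fragile r t M E v w ^+ 2) * (256 * b / f ^+ 2).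
pose H4 (E : {set {set T}}) : R :=
  expR (- (2 * (p * n%:R))) * \sum_v expR (1 / 2) ^+ degree E v.
pose H5 (E : {set {set T}}) : R := expR (p * n%:R / 8) * expR (-1) ^+ degree E v0.
have H1_0 E : 0 <= H1 E by [].
have H2_0 E : 0 <= H2 E.
  apply: mulr_ge0; first by apply: sumr_ge0 => w _; exact: sqr_ge0.
  have mf : 0 <= mu * f.
    by apply: mulr_ge0; last exact: ltW; apply: divr_ge0 => //; apply: mulr_ge0 => //; exact: ltW.
  exact: divr_ge0.
have H3_0 E : 0 <= H3 E.
  apply: mulr_ge0; first by apply: sumr_ge0 => v _; apply: sumr_ge0 => w _; exact: sqr_ge0.
  by apply: scale_ge0; exact: ltW.
have H4_0 E : 0 <= H4 E.
  apply: mulr_ge0; first exact: expR_ge0.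
  by apply: sumr_ge0 => v _; apply: exprn_ge0; exact: expR_ge0.
have H5_0 E : 0 <= H5 E.
  by apply: mulr_ge0; [exact: expR_ge0 | apply: exprn_ge0; exact: expR_ge0].
rewrite gnp_probE.
apply: le_trans (@expect_indic_ge R _ p (enum (vpairs T)) A
  (fun E => H1 E + H2 E + H3 E + H4 E + H5 E) (ltW p0) p1 _ _); first last.
- move=> E El; apply: contraNle => lt1.
  have EV : E \subset vpairs T.
    by apply/subsetP => e /(subsetP El); rewrite mem_enum.
  have := H1_0 E; have := H2_0 E; have := H3_0 E; have := H4_0 E; have := H5_0 E.
  move=> h5 h4 h3 h2 h1.
  have rob : robust r b E.
    apply: (@robust_sufficient R n r p r0 x nx f11 b kinv t M E b0 k0 t0 M0 kMt bk EV); rewrite -/f -/mu.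
      by rewrite -/(H2 E); lra.
    by rewrite -/(H3 E); lra.
  have no : #|domsets E r.-1| = 0%N.
    have : H1 E < 1 by lra.
    by rewrite /H1 ltrn1; case: #|_|.
  have dle v : (degree E v)%:R <= 4 * (p * n%:R).
    rewrite leNgt; apply/negP => lt.
    have : 1 <= H4 E.
      rewrite /H4 (bigD1 v) //= mulrDr ler_wpDr //.
        apply: mulr_ge0; first exact: expR_ge0.
        by apply: sumr_ge0 => w _; apply: exprn_ge0; exact: expR_ge0.
      by rewrite -expRM_natr -expRD -[leLHS]expR0 ler_expR; lra.
    by lra.
  have dge : p * n%:R / 8 <= (degree E v0)%:R.
    rewrite leNgt; apply/negP => lt.
    have : 1 <= H5 E.
      by rewrite /H5 -expRM_natr -expRD -[leLHS]expR0 ler_expR; lra.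
    by lra.
  have [|a1 a2 a3 a4 a5] := event_sufficient (v0 := v0) _ p0 EV rob no b0 dle dge.
  + by rewrite r0 /=; move: rn; clear; lia.
  + exact: HA.
- by move=> E; rewrite !addr_ge0.
rewrite lerD2l lerN2 !expectD -!/(gexpect p _).
apply: lerD; last first.
  apply: gexpect_low_degree (ltW p0) p1 _; move: rn r0; clear; lia.
apply: lerD; last exact: gexpect_high_degree (ltW p0).
apply: lerD; last first.
  exact: (@expect_fragile_le R n r p p0 p1 r0 x c eta j0 j1 s8 rn rs x1 nx c0 cs j10 j1c
    qj12 nsq f11 xr j0r etar big b t M t0 t1 b0).
apply: lerD; last first.
  exact: (@expect_variance_le R n r p p0 p1 r0 x c eta j0 j1 s8 rn rs x1 nx c0 cs j10 j1c
    qj12 nsq f11 xr j0r etar big).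
by rewrite -gexpect_card_domsets.
Qed.
End FiniteProbability.

(** * The threshold *)

Section Threshold.
Variable R : realType.
Implicit Types (e p x : R) (n k : nat).

Lemma near_ln (K : R) : \forall n \near \oo, K <= ln (n%:R : R).
Proof.
near=> n.
have nK : expR K <= n%:R.
  apply: le_trans (ltW (truncnS_gt _)) _.
  by rewrite ler_nat; near: n; exact: nbhs_infty_ge.
by rewrite -[leLHS]expRK ler_ln ?posrE ?expR_gt0 // (lt_le_trans (expR_gt0 _) nK).
Unshelve. all: by end_near. Qed.

(** From [expR y >= y ^ 2 / 2]. *)
Lemma expR_absorb (a K x : R) : 0 < a -> 0 <= K -> 2 * K / a ^+ 2 <= x ->
  K * x <= expR (a * x).
Proof.
move=> a0 K0 Kx.
have x0 : 0 <= x by apply: le_trans Kx; rewrite divr_ge0 ?sqr_ge0 // mulr_ge0.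
have ax0 : 0 <= a * x by rewrite mulr_ge0 // ltW.
apply: le_trans (expR_ge1Dxn 1 ax0).
have : 2 * K <= x * a ^+ 2 by rewrite -ler_pdivrMr ?exprn_gt0.
have -> : (2`!)%:R = 2 :> R by [].
move=> /(ler_wpM2r x0) H; rewrite exprMn.
rewrite (_ : a ^+ 2 * x ^+ 2 / 2 = x * a ^+ 2 * x / 2); last by field.
lra.
Qed.

Lemma near_absorb (a K : R) : 0 < a -> 0 <= K ->
  \forall n \near \oo, K * ln (n%:R : R) <= expR (a * ln n%:R).
Proof.
move=> a0 K0; near=> n; apply: expR_absorb => //; near: n; exact: near_ln.
Unshelve. all: by end_near. Qed.

Lemma expRN_le_inv (K y : R) : 0 < K -> K <= expR y -> expR (- y) <= K^-1.
Proof. by move=> K0 Ky; rewrite expRN lef_pV2 // posrE ?expR_gt0. Qed.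

Lemma near_natE : \forall n \near \oo, (n%:R : R) = expR (ln n%:R).
Proof.
near=> n; rewrite lnK // posrE ltr0n; near: n; exact: nbhs_infty_gt.
Unshelve. all: by end_near. Qed.

Lemma dom_thresholdP n p k : 1 / (p * n%:R) < expected_dominating n k p ->
  [/\ 1 / (p * n%:R) < expected_dominating n (dom_threshold n p) p,
      (dom_threshold n p <= k)%N &
      forall m, (m < dom_threshold n p)%N ->
        expected_dominating n m p <= 1 / (p * n%:R)].
Proof.
move=> H; rewrite /dom_threshold; case: pselect => [ex|]; last first.
  by case; exists k.
case: ex_minnP => m mE mmin; split => //; first exact: mmin.
move=> m' m'm; rewrite leNgt; apply/negP => /mmin.
by rewrite leqNgt m'm.
Qed.

Definition admissible e n p :=
  expR ((- (1 / 3) + e) * ln n%:R) <= p /\ p <= 1 - e.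

Lemma onesub_ge_expV p : p < 1 -> expR (- (p / (1 - p))) <= 1 - p.
Proof.
move=> p1; have q0 : 0 < 1 - p by rewrite subr_gt0.
rewrite expRN -[leRHS]invrK lef_pV2 ?posrE ?invr_gt0 ?expR_gt0 //.
apply: le_trans (expR_ge1Dx _); rewrite le_eqVlt; apply/orP; left; apply/eqP.
by field; rewrite gt_eqF.
Qed.

Lemma onesubX_ge_expp e p k : 0 < e -> 0 <= p -> p <= 1 - e ->
  expR (- (p * k%:R / e)) <= (1 - p) ^+ k.
Proof.
move=> e0 p0 pe; apply: (@le_trans _ _ (expR (- (p / (1 - p))) ^+ k)); last first.
  by apply: ler_exp2r; [exact: expR_ge0 | apply: onesub_ge_expV; lra].
rewrite -expRM_natr ler_expR mulNr lerN2 mulrAC ler_wpM2l ?mulr_ge0 //.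
by rewrite lef_pV2 ?posrE //; lra.
Qed.

Definition threshold_facts e n p (r : nat) :=
  let x := ln (n%:R : R) in let s := (1 - p) ^+ r in
  [/\ 1 / (p * n%:R) < expected_dominating n r p,
      forall k, (k < r)%N -> expected_dominating n k p <= 1 / (p * n%:R),
      (0 < r)%N, r%:R * p <= 3 * x &
      [/\ n%:R * s <= 4 * r%:R * x, e / 8 * r%:R * x <= n%:R * s, e / 2 * x <= r%:R * p
        & s <= expR (- (x / 2)) ] ].

(** At [k0] between [2 x / p] and [3 x / p] one has [n q ^ k0 <= 1 / n], so the expected number is
    at least [1 / 2] and [r <= k0]. The upper bound on [n s] compares [f(r) > 1 / (p n)] with
    ['C(n, r) <= n ^ r]. The lower bound uses size [r - 1], where the expectation is below 1
    although the binomial coefficient is at least [n ^ ((r - 1) / 2)]; returning to [r] costs a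
    factor [1 - p >= e]. *)
Lemma near_threshold e : 0 < e -> e <= 1 / 32 ->
  \forall n \near \oo, forall p, admissible e n p ->
    threshold_facts e n p (dom_threshold n p).
Proof.
move=> e0 e1; near=> n.
have nx : (n%:R : R) = expR (ln n%:R) by near: n; exact: near_natE.
have xbig : 32 <= ln (n%:R : R) by near: n; exact: near_ln.
have xe : 32 / e <= ln (n%:R : R) by near: n; exact: near_ln.
have xexp : 32 * ln (n%:R : R) <= expR (1 / 32 * ln n%:R).
  by near: n; apply: near_absorb; lra.
move=> p; rewrite /admissible /threshold_facts; set x := ln (n%:R : R) in nx xbig xe xexp *.
move=> [pl pu]; set r := dom_threshold n p.
have x0 : 0 <= x by apply: le_trans xbig.
have n0 : (0 : R) < n%:R by rewrite nx expR_gt0.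
have p0 : 0 < p by apply: lt_le_trans pl; exact: expR_gt0.
have p1 : p <= 1 by lra.
have pl3 : expR (- (1 / 3) * x) <= p.
  by apply: le_trans pl; rewrite ler_expR -/x; nra.
have ex_ge (a : R) : a * x <= expR (a * x) by have := expR_ge1Dx (a * x); lra.
have ix : 1 / p <= expR (1 / 3 * x).
  by rewrite ler_pdivrMr // -ler_pdivrMl ?expR_gt0 // mulr1 -expRN -mulNr.
have [k0 k0l k0u] : exists2 k0, 2 * x / p <= k0%:R & k0%:R <= 3 * x / p.
  exists (Num.truncn (2 * x / p)).+1; first by rewrite ltW // truncnS_gt.
  rewrite -(natr1 (Num.truncn _)); apply: (@le_trans _ _ (2 * x / p + 1)).
    by rewrite lerD2r truncn_le divr_ge0 ?mulr_ge0 // ltW.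
  rewrite -lerBrDl -mulrBl ler_pdivlMr // mul1r.
  by move: p1 xbig; clear; lra.
have k0n1 : 3 * x / p <= expR ((1 / 3 + 1 / 32) * x) / 8.
  apply: (@le_trans _ _ (3 * x * expR (1 / 3 * x))).
    by rewrite -[p^-1]mul1r ler_wpM2l // mulr_ge0 // x0.
  rewrite ler_pdivlMr // (_ : (1 / 3 + 1 / 32) * x = 1 / 32 * x + 1 / 3 * x); last by ring.
  rewrite expRD (_ : 3 * x * expR (1 / 3 * x) * 8 = 24 * x * expR (1 / 3 * x)); last by ring.
  apply: ler_wpM2r; first exact: expR_ge0.
  by clear -xexp xbig; lra.
have k0n : 3 * x / p <= expR (1 / 2 * x) / 8.
  apply: (le_trans k0n1); rewrite ler_wpM2r // ler_expR ler_wpM2r ?x0 //.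
  by clear; lra.
have half_n : expR (1 / 2 * x) * expR (1 / 2 * x) = n%:R.
  by rewrite -expRD nx; congr expR; lra.
have halfbig : 16 <= expR (1 / 2 * x).
  by apply: le_trans (ex_ge _) => //; lra.
have k0n' : (k0 <= n)%N.
  rewrite -(ler_nat R); apply: (le_trans k0u); apply: (le_trans k0n).
  by rewrite -half_n; nra.
have thr_le : 1 / (p * n%:R) <= expR (- (1 / 2 * x)).
  rewrite ler_pdivrMr ?mulr_gt0 // nx.
  apply: (@le_trans _ _ (expR (- (1 / 2 * x)) * (expR (- (1 / 3) * x) * expR x))).
    rewrite -!expRD -[leLHS]expR0 ler_expR; lra.
  by rewrite ler_wpM2l ?expR_ge0 // ler_wpM2r ?expR_ge0.
have thr1 : 1 / (p * n%:R) < 1 / 2.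
  apply: (le_lt_trans thr_le).
  by have := @expRN_le_inv 16 _ (ltr0n _ 16) halfbig; lra.
have sk0 : (1 - p) ^+ k0 <= expR (- (2 * x)).
  apply: le_trans (onesubX_le_exp _ p1) _; rewrite ler_expR lerN2.
  by rewrite (mulrC p) -ler_pdivrMr.
have f_k0 : 1 / (p * n%:R) < expected_dominating n k0 p.
  apply: (lt_le_trans thr1); rewrite /expected_dominating.
  have sk0' : (1 - p) ^+ k0 <= 1 / 2.
    apply: (le_trans sk0); have b2 : 32 <= expR (2 * x) by have := ex_ge 2; lra.
    by have := @expRN_le_inv 32 _ (ltr0n _ 32) b2; lra.
  have sk00 : 0 <= (1 - p) ^+ k0 by rewrite exprn_ge0 // subr_ge0.
  apply: (@le_trans _ _ (1 * (1 - (1 - p) ^+ k0) ^+ (n - k0))); last first.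
    apply: ler_wpM2r; first by rewrite exprn_ge0 //; lra.
    by rewrite ler1n bin_gt0.
  rewrite [leRHS]mul1r; apply: le_trans _ (onesubX_ge_exp _ sk00 sk0').
  apply: le_trans (expR_ge1Dx _).
  have nk : (n - k0)%:R <= (n%:R : R) by rewrite ler_nat leq_subr.
  have : (1 - p) ^+ k0 * (n - k0)%:R <= expR (- (2 * x)) * expR x.
    by rewrite -nx; apply: ler_pM.
  rewrite -expRD (_ : - (2 * x) + x = - x); last by ring.
  have b1 : 32 <= expR x by have := ex_ge 1; rewrite mul1r; lra.
  by have := @expRN_le_inv 32 _ (ltr0n _ 32) b1; lra.
have [fr rk0 fmin] := dom_thresholdP f_k0.
rewrite -/r in fr rk0 fmin.
have ru : r%:R <= 3 * x / p by apply: le_trans k0u; rewrite ler_nat.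
have rpu : r%:R * p <= 3 * x by rewrite -ler_pdivlMr.
have rn8 : r%:R <= expR (1 / 2 * x) / 8 by apply: (le_trans ru).
have r0 : (0 < r)%N.
  rewrite lt0n; apply/eqP => r0; move: fr; rewrite r0 /expected_dominating bin0 expr0 subrr.
  rewrite subn0 expr0n; have -> : (n == 0%N) = false.
    by apply/eqP => n00; move: n0; rewrite n00 ltxx.
  by rewrite mulr0 ltNge divr_ge0 // mulr_ge0 // ltW.
set s := (1 - p) ^+ r.
have s0 : 0 <= s by rewrite exprn_ge0 // subr_ge0.
have s1 : s <= 1 by rewrite exprn_ile1 ?subr_ge0 // gerBl ltW.
have rn : (r <= n)%N by apply: leq_trans k0n'.
have r1 : 1 <= r%:R :> R by rewrite ler1n.
have nr2 : n%:R / 2 <= (n - r)%:R :> R.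
  rewrite natrB //.
  have : r%:R <= n%:R / 2 :> R.
    by rewrite -half_n; apply: (le_trans rn8); move: halfbig; clear; nra.
  by clear; lra.
have ns_up : n%:R * s <= 4 * r%:R * x.
  have H1 : expR (- x) < expR (r%:R * x) * expR (- (s * (n - r)%:R)).
    apply: (@le_lt_trans _ _ (1 / (p * n%:R))).
      rewrite expRN -nx div1r lef_pV2 ?posrE ?mulr_gt0 // ger_pMl //.
    apply: (lt_le_trans fr); rewrite /expected_dominating; apply: ler_pM => //.
    + by rewrite exprn_ge0 // subr_ge0.
    + by rewrite expRM_natl -nx -natrX ler_nat bin_le_exp.
    + exact: onesubX_le_exp.
  move: H1; rewrite -expRD ltr_expR => H1.
  have : s * (n%:R / 2) <= s * (n - r)%:R by rewrite ler_wpM2l.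
  have : x <= r%:R * x by rewrite ler_peMl.
  by move: H1; clear; lra.
have s_half : s <= expR (- (x / 2)).
  have rx : r%:R * (32 * x) <= expR ((1 / 3 + 1 / 32) * x) / 8 * expR (1 / 32 * x).
    apply: ler_pM => //; first by clear -xbig; lra.
    exact: le_trans ru k0n1.
  rewrite -(ler_pM2l n0) {2}nx -expRD; apply: (le_trans ns_up).
  apply: (@le_trans _ _ (expR ((1 / 3 + 1 / 32) * x) * expR (1 / 32 * x))).
    have := mulr_ge0 (expR_ge0 ((1 / 3 + 1 / 32) * x)) (expR_ge0 (1 / 32 * x)).
    by move: rx; clear; lra.
  by rewrite -expRD ler_expR; clear -xbig; lra.
have q0 : 0 < 1 - p by clear -pu e0; lra.
(* For [r = 1], [s = 1 - p >= e] would contradict [s <= n ^ (- 1 / 2)]. This makes [r - 1] at least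
   [r / 2] in the lower bound. *)
have re2 : (2 <= r)%N.
  rewrite ltn_neqAle r0 andbT; apply/eqP => r1'; move: s_half; apply/negP; rewrite -ltNge.
  rewrite /s -r1' expr1; apply: (@lt_le_trans _ _ e); last by clear -pu; lra.
  have xe1 : 16 / e <= expR (x / 2).
    apply: le_trans _ (expR_ge1Dx _); move: xe.
    by rewrite !ler_pdivrMr //; clear -e0; nra.
  apply: le_lt_trans (expRN_le_inv _ xe1) _; first by rewrite divr_gt0.
  by rewrite invf_div ltr_pdivrMr //; clear -e0; lra.
have lower : e / 8 * r%:R * x <= n%:R * s.
  have [k rk] : exists k, r = k.+1 by exists r.-1; rewrite prednK.
  have k1 : (0 < k)%N by rewrite -ltnS -rk.
  have fk : expected_dominating n k p <= 1 / (p * n%:R) by apply: fmin; rewrite rk.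
  pose s' := (1 - p) ^+ k; have ss' : s = (1 - p) * s' by rewrite /s rk exprS.
  have s'0 : 0 <= s' by rewrite exprn_ge0 // ltW.
  have kr : k%:R <= r%:R :> R by rewrite ler_nat rk.
  have kr2 : r%:R <= 2 * k%:R :> R by rewrite -natrM ler_nat rk; clear -k1; lia.
  have s'2 : s' <= 1 / 2.
    have e16 : expR (- (x / 2)) <= e / 16.
      have xe1 : 16 / e <= expR (x / 2).
        apply: le_trans _ (expR_ge1Dx _); move: xe.
        by rewrite !ler_pdivrMr //; clear -e0; nra.
      by apply: le_trans (expRN_le_inv _ xe1) _; rewrite ?divr_gt0 // invf_div.
    have : e * s' <= e / 16.
      apply: le_trans e16; apply: le_trans s_half; rewrite ss' ler_wpM2r //.
      by clear -pu; lra.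
    by rewrite ler_pM2l //; clear; lra.
  have yk : expR (x / 2) * k%:R <= n%:R - k%:R.
    have : expR (1 / 2 * x) * k%:R <= expR (1 / 2 * x) * (expR (1 / 2 * x) / 8).
      rewrite ler_wpM2l ?expR_ge0 //; exact: le_trans kr rn8.
    rewrite mulrA half_n (_ : 1 / 2 * x = x / 2); last by ring.
    have : k%:R <= n%:R / 2 :> R.
      by apply: (le_trans kr); rewrite -half_n; apply: (le_trans rn8); move: halfbig; clear; nra.
    by move: n0; clear; lra.
  have := @bin_ratio R n k (expR (x / 2)) 0 (expR_ge0 _) yk (leq0n _).
  rewrite bin0 mul1r subn0 => HC.
  have HG := onesubX_ge_exp (n - k) s'0 s'2.
  have : expR (x / 2) ^+ k * expR (- (2 * s' * (n - k)%:R)) <= 1.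
    apply: (@le_trans _ _ (expected_dominating n k p)).
      by apply: ler_pM; rewrite ?expR_ge0 // exprn_ge0 // expR_ge0.
    by apply: (le_trans fk); move: thr1; clear; lra.
  rewrite -expRM_natr -expRD -[leRHS]expR0 ler_expR => H.
  have nk : s' * (n - k)%:R <= s' * n%:R by rewrite ler_wpM2l // ler_nat leq_subr.
  have H2 : x * r%:R <= 8 * (n%:R * s').
    have : x * r%:R <= x * (2 * k%:R) by rewrite ler_wpM2l.
    by move: H nk; clear; lra.
  have : e * (x * r%:R) <= (1 - p) * (8 * (n%:R * s')).
    by apply: ler_pM; rewrite ?mulr_ge0 ?(ltW e0) //; clear -pu; lra.
  by rewrite ss'; clear; lra.
have rp_lower : e / 2 * x <= r%:R * p.
  have := onesubX_ge_expp r e0 (ltW p0) pu.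
  move=> /le_trans/(_ s_half); rewrite ler_expR lerN2 ler_pdivlMr //.
  by clear; lra.
by split => //; split.
Unshelve. all: by end_near. Qed.
End Threshold.

(** * Size of the error terms *)

Section Asymptotic.
Variable R : realType.
Implicit Types (e p x : R) (n k r : nat).

Lemma near_exp_small (a eps : R) : 0 < a -> 0 < eps ->
  \forall n \near \oo, expR (- (a * ln (n%:R : R))) <= eps.
Proof.
move=> a0 eps0; near=> n.
have /expRN_le_inv : eps^-1 <= expR (a * ln n%:R).
  apply: le_trans _ (expR_ge1Dx _); rewrite -lerBlDl.
  have : (eps^-1 - 1) / a <= ln (n%:R : R) by near: n; exact: near_ln.
  by rewrite ler_pdivrMr // mulrC.
by rewrite invrK; apply; rewrite invr_gt0.
Unshelve. all: by end_near. Qed.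

Lemma expR_sub1_le (y : R) : 0 <= y -> y <= 1 / 2 -> expR y - 1 <= 2 * y.
Proof.
move=> y0 y2; have := expR_ge1Dx (- y); rewrite expRN => H.
have ey := expR_gt0 y.
have H2 : expR y * (1 - y) <= 1 by rewrite -[leRHS](divff (lt0r_neq0 ey)) ler_pM2l.
by clear H; nra.
Qed.

(* The second term is at least 1 for [m < k], the first covers [m >= k]. *)
Lemma cheap_weight (lam k : R) (m : nat) : 0 < k -> 0 < lam -> (0 < m)%N ->
  m%:R^-1 <= 1 / k + expR (lam * k) * expR (- lam) ^+ m.
Proof.
move=> k0 lam0 m0; have m1 : 1 <= m%:R :> R by rewrite ler1n.
have [km|mk] := leP k m%:R.
  apply: ler_wpDr; first by rewrite mulr_ge0 ?exprn_ge0 ?expR_ge0.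
  by rewrite div1r lef_pV2 ?posrE //; apply: lt_le_trans m1.
apply: ler_wpDl; first by rewrite divr_ge0 // ltW.
rewrite -expRM_natr -expRD; apply: (@le_trans _ _ 1).
  by rewrite invf_le1 // (lt_le_trans _ m1).
rewrite -[leLHS]expR0 ler_expR; nra.
Qed.

Section ErrorTerms.
Variables (e p x : R) (n r : nat).
Hypotheses (e0 : 0 < e) (e1 : e <= 1 / 32) (x1 : 1 <= x) (nx : n%:R = expR x).
Hypotheses (p0 : 0 < p) (pu : p <= 1 - e) (pl : expR ((- (1 / 3) + e) * x) <= p).
Let q := 1 - p.
Let s := q ^+ r.
Hypotheses (r0 : (0 < r)%N) (rp : r%:R * p <= 3 * x) (ns : n%:R * s <= 4 * r%:R * x)
  (ns' : e / 8 * r%:R * x <= n%:R * s) (rp' : e / 2 * x <= r%:R * p)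
  (s_half : s <= expR (- (x / 2))).
(* [X = n ^ (e / 100)] absorbs constants and powers of [x = ln n]. *)
Let w := e / 100.
Let X := expR (w * x).
Variable K : R.
Hypotheses (KX : K * x <= X) (K1 : 32 <= K) (Ke : 1 / e <= K).
Let a := - ln q.

Let q0 : 0 < q. Proof. by rewrite /q; move: pu e0; lra. Qed.
Let qE j : q ^+ j = expR (- (a * j%:R)).
Proof. by rewrite -mulNr opprK expRM_natr lnK // posrE. Qed.
Let p1 : p <= 1. Proof. by move: pu e0; lra. Qed.
Let a0 : 0 <= a. Proof. by rewrite /a oppr_ge0 ln_le0 // gerBl ltW. Qed.
Let x0 : 0 <= x. Proof. by apply: le_trans x1. Qed.
Let X32x : 32 * x <= X.
Proof. by apply: le_trans KX; rewrite ler_wpM2r. Qed.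
Let xX : x <= X. Proof. by move: X32x x0; lra. Qed.
Let X32 : 32 <= X. Proof. by move: X32x x1; lra. Qed.
Let X1 : 1 <= X. Proof. by move: X32; lra. Qed.
Let eX : 1 / e <= X.
Proof. by apply: (le_trans Ke); apply: le_trans KX; rewrite ler_peMr // (le_trans _ K1). Qed.
Let r1 : 1 <= r%:R :> R. Proof. by rewrite ler1n. Qed.
Let s0 : 0 <= s. Proof. by rewrite exprn_ge0 // ltW. Qed.
Let n0 : 0 < n%:R :> R. Proof. by rewrite nx expR_gt0. Qed.
Let X0 : 0 < X. Proof. exact: expR_gt0. Qed.

Let pV : p^-1 <= expR ((1 / 3 - e) * x).
Proof.
rewrite -[leRHS]invrK -expRN lef_pV2 ?posrE ?expR_gt0 //.
by rewrite -mulNr; apply: le_trans pl; rewrite ler_expR ler_wpM2r //; lra.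
Qed.

Let rX : r%:R <= expR ((w + (1 / 3 - e)) * x).
Proof.
have : r%:R <= 3 * x / p by rewrite ler_pdivlMr.
move=> /le_trans; apply; rewrite [X in expR X]mulrDl expRD; apply: ler_pM => //.
- by rewrite mulr_ge0.
- by rewrite invr_ge0 ltW.
- by move: X32x x0; rewrite /X; lra.
Qed.

Let sX : s <= expR ((2 * w + (1 / 3 - e) - 1) * x).
Proof.
rewrite -(ler_pM2l n0) {2}nx -expRD; apply: (le_trans ns).
rewrite (_ : x + _ = w * x + (w + (1 / 3 - e)) * x); last by ring.
rewrite expRD mulrAC; apply: ler_pM => //; first by rewrite mulr_ge0.
by move: X32x x0; rewrite /X; lra.
Qed.

Let r_half : r%:R <= expR (x / 2) / 16.
Proof.
rewrite ler_pdivlMr // mulrC.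
apply: (@le_trans _ _ (X * expR ((w + (1 / 3 - e)) * x))).
  by apply: ler_pM => //; move: X32; lra.
rewrite /X -expRD ler_expR (_ : x / 2 = 1 / 2 * x); last by ring.
by rewrite -mulrDl ler_wpM2r // /w; move: e0 e1; lra.
Qed.

Let half_big : 32 <= expR (x / 2).
Proof.
apply: (le_trans X32); rewrite ler_expR (_ : x / 2 = 1 / 2 * x); last by ring.
by rewrite ler_wpM2r // /w; move: e0 e1; lra.
Qed.

Let half_n : expR (x / 2) * expR (x / 2) = n%:R.
Proof. by rewrite nx -expRD; congr expR; lra. Qed.

Lemma param_rs : 8 * r%:R * s <= 1.
Proof.
have : r%:R * s <= expR (x / 2) / 16 * expR (- (x / 2)) by apply: ler_pM.
rewrite mulrAC -expRD subrr expR0; move: s0 r1; lra.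
Qed.

Lemma param_s8 : s <= 1 / 8.
Proof.
apply: (le_trans s_half); have := expRN_le_inv (ltr0n _ 32) half_big.
by lra.
Qed.

Lemma param_rn : (4 * r.+1 <= n)%N.
Proof.
rewrite -(ler_nat R) natrM -natr1 -half_n.
move: r_half half_big r1; nra.
Qed.

Lemma param_xr : expR (x / 2) * r%:R <= n%:R - r%:R.
Proof. by rewrite -half_n; move: r_half half_big r1; nra. Qed.

Let r_big : e / 2 * x <= r%:R.
Proof. by apply: (le_trans rp'); rewrite ler_piMr. Qed.

Hypothesis xe : 600 / e ^+ 2 <= x.

Let xe2 : 600 <= x * e ^+ 2. Proof. by rewrite -ler_pdivrMr // exprn_gt0. Qed.

Let re : 300 <= r%:R * e.
Proof. by move: (ler_wpM2r (ltW e0) r_big) xe2; rewrite expr2; lra. Qed.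

Let xe1 : 600 <= x * e.
Proof. by move: xe2 e0 e1 x0; rewrite expr2; nra. Qed.

(** Beyond this radius two sets share at most about [e r] vertices, and [q ^ near_radius] is [s] up
    to about [n ^ e]. Within it they share at least [e r] vertices, enough for the binomial
    ratios. *)
Definition near_radius : nat := Num.truncn ((1 - e) * r%:R).

Lemma near_radius_le : (near_radius <= r)%N.
Proof.
rewrite -(ler_nat R); apply: (@le_trans _ _ ((1 - e) * r%:R)).
  by rewrite /near_radius truncn_le mulr_ge0 //; move: e1; lra.
by rewrite ler_piMl //; move: e0; lra.
Qed.

Lemma near_radius_gap : e * r%:R <= (r - near_radius)%:R.
Proof.
rewrite natrB ?near_radius_le //.
have : near_radius%:R <= (1 - e) * r%:R.
  by rewrite /near_radius truncn_le mulr_ge0 //; move: e1; lra.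
by lra.
Qed.

Lemma param_big : 2 * r%:R + 1 + 10 * x <= e * r%:R * (x / 2).
Proof.
have h1 : 600 * r%:R <= x * e * r%:R by rewrite ler_wpM2r.
have h2 : 300 * x <= r%:R * e * x by rewrite ler_wpM2r.
by move: h1 h2 x1 r1; lra.
Qed.

(** The largest radius permitted by [8 j1 <= c r] with [c = e / 8], the constant in the lower bound
    on [n s]. It is still of order [r], so [q ^ tiny_radius] is a negative power of [n]. *)
Definition tiny_radius : nat := Num.truncn (e / 8 * r%:R / 8).

Let er : 4 <= e / 8 * r%:R / 8. Proof. by move: re; lra. Qed.

Lemma tiny_radius_gt0 : (0 < tiny_radius)%N.
Proof. by rewrite /tiny_radius truncn_gt0; move: er; lra. Qed.

Lemma tiny_radius_le : 8 * tiny_radius%:R <= e / 8 * r%:R.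
Proof.
have : tiny_radius%:R <= e / 8 * r%:R / 8.
  by rewrite /tiny_radius truncn_le; move: er; lra.
by lra.
Qed.

Let ar_half : x / 2 <= a * r%:R.
Proof. by have := s_half; rewrite /s qE ler_expR lerN2. Qed.

Let ar_le : a * r%:R <= x.
Proof.
have : expR (- x) <= s.
  rewrite expRN -nx -[leLHS]mul1r ler_pdivrMr // mulrC; apply: le_trans ns'.
  by move: re x1 e0 r1; nra.
by rewrite /s qE ler_expR lerN2.
Qed.

Hypothesis xtiny : 8 * x <= expR (e / 256 * x).

Let q_tiny : 8 * x * q ^+ tiny_radius <= 1.
Proof.
have : e / 256 * x <= a * tiny_radius%:R.
  have t1 : e / 8 * r%:R / 16 <= tiny_radius%:R.
    have : e / 8 * r%:R / 8 < tiny_radius%:R + 1 by rewrite natr1; exact: truncnS_gt.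
    by move: er; lra.
  have := ler_wpM2l a0 t1; move: ar_half e0; nra.
move=> H; rewrite qE.
apply: (@le_trans _ _ (expR (e / 256 * x) * expR (- (e / 256 * x)))).
  by apply: ler_pM; rewrite ?mulr_ge0 ?expR_ge0 // ler_expR lerN2.
by rewrite -expRD subrr expR0.
Qed.

Lemma param_qtiny : q ^+ tiny_radius <= 1 / 2.
Proof.
have : 0 <= q ^+ tiny_radius by rewrite exprn_ge0 // ltW.
by move: q_tiny x1; nra.
Qed.

Lemma param_nsq : 2 * n%:R * (s * q ^+ tiny_radius) <= r%:R.
Proof.
have : 0 <= q ^+ tiny_radius by rewrite exprn_ge0 // ltW.
move=> /ler_wpM2r/(_ _ _ ns); move: (ler_wpM2l (ler0n R r) q_tiny); lra.
Qed.

(** The shortfall of [e r] costs at most [n ^ e], because [s >= 1 / n]; rounding costs one factor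
    [1 / q <= 1 / e]. *)
Let q_near : q ^+ near_radius <= s * expR (e * x) * X.
Proof.
have j0 : (1 - e) * r%:R - 1 <= near_radius%:R.
  have : (1 - e) * r%:R < near_radius%:R + 1 by rewrite natr1; exact: truncnS_gt.
  by lra.
have aX : expR a <= X.
  apply: le_trans eX; rewrite /a expRN lnK ?posrE // -[leLHS]div1r.
  by rewrite !div1r lef_pV2 ?posrE //; move: pu; rewrite /q; lra.
have h := ler_wpM2l a0 j0; have h2 := ler_wpM2l (ltW e0) ar_le.
apply: (@le_trans _ _ (expR (- (a * r%:R)) * expR (e * x) * expR a)).
  by rewrite qE -!expRD ler_expR; move: h h2; lra.
by rewrite /s qE ler_wpM2l // mulr_ge0 ?expR_ge0.
Qed.

(** Here the exponent [1 / 3] enters. Up to powers of [X], [r] is at most [n ^ (1 / 3 - e)] and [s]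
    at most that divided by [n]; the three factors [n ^ (1 / 3)] cancel [n], and [n ^ (- 3 e)]
    remains. *)
Let r2s : r%:R ^+ 2 * s <= expR ((4 * w - 3 * e) * x).
Proof.
rewrite expr2 -mulrA; apply: (@le_trans _ _ (expR ((w + (1 / 3 - e)) * x) *
  (expR ((w + (1 / 3 - e)) * x) * expR ((2 * w + (1 / 3 - e) - 1) * x)))).
  by apply: ler_pM => //; [exact: mulr_ge0 | apply: ler_pM].
by rewrite -!expRD ler_expR -!mulrDl ler_wpM2r //; lra.
Qed.

Let kappa := overlap_cost q s n r near_radius.

Let kappa0 : 0 <= kappa.
Proof. by rewrite /kappa /overlap_cost addr_ge0 ?mulr_ge0 // exprn_ge0 // ltW. Qed.

Let expe1 : 1 <= expR (e * x).
Proof. by apply: le_trans (expR_ge1Dx _); rewrite lerDl mulr_ge0 // ltW. Qed.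

(** Both parts of [kappa] are [r s] up to factors [x], [X] and [n ^ e]; the further [r] is the one
    in the variance bound. *)
Let rkappa : r%:R * kappa <= expR ((7 * w - 2 * e) * x).
Proof.
have qn0 : 0 <= q ^+ near_radius by rewrite exprn_ge0 // ltW.
have Y1 : 1 <= expR (e * x) * X by rewrite -[leLHS]mulr1 ler_pM.
set Y := expR (e * x) * X in Y1.
have k1 : kappa <= 16 * (r%:R * s) * (x * Y).
  have h1 : n%:R * s * q ^+ near_radius <= 4 * r%:R * x * (s * Y).
    by apply: ler_pM => //; [exact: mulr_ge0 | rewrite /Y mulrA].
  have rs0 : 0 <= r%:R * s by rewrite mulr_ge0.
  have xY : 1 <= x * Y by rewrite -[leLHS]mulr1 ler_pM.
  have h2 := ler_wpM2l rs0 xY.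
  by rewrite /kappa /overlap_cost; move: h1 h2; lra.
apply: (le_trans (ler_wpM2l (ler0n R r) k1)).
apply: (@le_trans _ _ (X * (r%:R ^+ 2 * s) * (X * Y))).
  rewrite [leLHS](_ : _ = 16 * (r%:R ^+ 2 * s) * (x * Y)); last by ring.
  have Y0 : 0 <= Y by apply: le_trans Y1.
  have rs0 : 0 <= r%:R ^+ 2 * s by rewrite mulr_ge0 ?sqr_ge0.
  apply: ler_pM.
  - exact: mulr_ge0.
  - exact: mulr_ge0.
  - by apply: ler_wpM2r => //; move: X32; lra.
  - exact: ler_wpM2r.
apply: (@le_trans _ _ (X * expR ((4 * w - 3 * e) * x) * (X * Y))).
  apply: ler_wpM2r.
    by apply: mulr_ge0; [exact: ltW X0 | exact: le_trans ler01 Y1].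
  by apply: ler_wpM2l; [exact: ltW X0 | exact: r2s].
by rewrite /Y /X -!expRD ler_expR -!mulrDl ler_wpM2r //; lra.
Qed.

Let small : expR (- (e * x)) <= 1 / 32.
Proof.
have : 32 <= expR (e * x).
  by apply: (le_trans X32); rewrite ler_expR ler_wpM2r // /w; move: e0; lra.
by move=> /(expRN_le_inv (ltr0n _ 32)); lra.
Qed.

Let rkappa' : r%:R * kappa <= expR (- (e * x)) / X.
Proof.
apply: (le_trans rkappa); rewrite -expRN -expRD ler_expR.
by rewrite -!mulNr -mulrDl ler_wpM2r // /w; move: e0; lra.
Qed.

Let kappa_half : kappa <= 1 / 2.
Proof.
have h1 : kappa <= r%:R * kappa by rewrite ler_peMl.
have : expR (- (e * x)) / X <= expR (- (e * x)).
  by rewrite ler_pdivrMr // ler_peMr // expR_ge0.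
by move: h1 rkappa' small; lra.
Qed.

Let z := n%:R * expR (- (10 * x)).

Let zE : z = expR (- (9 * x)).
Proof. by rewrite /z nx -expRD; congr expR; ring. Qed.

Let r_exp : r%:R <= expR x.
Proof. by rewrite -nx ler_nat; move: param_rn; clear; lia. Qed.

Hypothesis KX3 : 600 * x <= X.

Lemma variance_term : 32 * r%:R * (expR kappa - 1 + z) <= 2 * expR (- (e * x)).
Proof.
have h := expR_sub1_le kappa0 kappa_half.
have z1 : 64 * (r%:R * z) <= expR (- (e * x)).
  apply: (@le_trans _ _ (X * (expR x * expR (- (9 * x))))).
    rewrite zE; apply: ler_pM; rewrite ?mulr_ge0 ?expR_ge0 //.
      by move: KX3 x1; lra.
    by rewrite ler_wpM2r ?expR_ge0.
  rewrite /X -!expRD ler_expR /w; move: e0 e1 x0; nra.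
have k1 : 64 * (r%:R * kappa) <= expR (- (e * x)).
  rewrite -[leRHS](divfK (lt0r_neq0 X0)) [leLHS]mulrC.
  apply: ler_pM; [exact: mulr_ge0 | by [] | exact: rkappa' | by move: KX3 x1; lra].
by have := ler_wpM2l (ler0n R r) h; move: z1 k1 (expR_ge0 (- (e * x))); lra.
Qed.

Variables (t delta : R).
Hypotheses (t0 : 0 < t) (t1 : t <= 1) (te : 60 * t <= e ^+ 2)
  (d0 : 0 < delta) (d1 : delta <= 1).

(** From [q + p t <= q * expR (p t / e)] the weight is [q ^ (r + near_radius)] up to
    [expR (2 r p t / e)], at most [n ^ (e / 10)] by [60 t <= e ^ 2]. One factor [s] is spent against
    [p n], as [p n s <= 4 (r p) x <= X ^ 2]; the other leaves [r ^ 2 s]. *)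
Lemma fragile_term :
  256 * (delta * (p * n%:R)) * expR (e / 10 * x) ^+ 2 * r%:R ^+ 2 *
     (expR kappa * (q + p * t) ^+ (r + near_radius) + z) <= 2 * expR (- (e * x)).
Proof.
have qpt : (q + p * t) ^+ (r + near_radius) <= s * (s * expR (e * x) * X) * expR (e / 10 * x).
  apply: (@le_trans _ _ ((q * expR (p * t / e)) ^+ (r + near_radius))).
    apply: ler_exp2r; first by rewrite addr_ge0 ?mulr_ge0 // ltW.
    apply: (@le_trans _ _ (q * (1 + p * t / e))); last first.
      by rewrite ler_wpM2l ?expR_ge1Dx // ltW.
    rewrite mulrDr mulr1 lerD2l mulrCA ler_peMr ?mulr_ge0 ?(ltW p0) ?(ltW t0) //.
      by rewrite ler_pdivlMr // mul1r /q; move: pu; lra.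
  rewrite exprMn exprD -expRM_natr; apply: ler_pM.
  - by rewrite mulr_ge0 ?exprn_ge0 // ltW.
  - exact: expR_ge0.
  - exact: ler_wpM2l.
  - rewrite ler_expR.
    have rj : (r + near_radius)%:R <= 2 * r%:R :> R.
      by rewrite -natrM ler_nat mul2n -addnn leq_add2l near_radius_le.
    have c0 : 0 <= p * t / e by rewrite divr_ge0 ?mulr_ge0 // ltW.
    apply: (le_trans (ler_wpM2l c0 rj)).
    rewrite (_ : _ * (2 * r%:R) = 2 * t / e * (r%:R * p)); last by field; rewrite gt_eqF.
    have c1 : 0 <= 2 * t / e by rewrite divr_ge0 ?mulr_ge0 // ltW.
    apply: (le_trans (ler_wpM2l c1 rp)).
    rewrite mulrAC ler_pdivrMr //; move: (ler_wpM2r x0 te); rewrite expr2.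
    rewrite (_ : 2 * t * (3 * x) = 60 * t * x / 10); last by field.
    rewrite (_ : e / 10 * x * e = e * e * x / 10); last by field.
    by move=> te2; rewrite ler_wpM2r // invr_ge0.
have ek : expR kappa <= 2 by have := expR_sub1_le kappa0 kappa_half; move: kappa_half; lra.
set M2 := expR (e / 10 * x) ^+ 2.
have M20 : 0 <= M2 by exact: sqr_ge0.
have M2E : M2 = expR (e / 5 * x) by rewrite /M2 -expRM_natl; congr expR; field.
move: M2 M20 M2E => M2 M20 M2E.
have pn0 : 0 <= p * n%:R by rewrite mulr_ge0 // ltW.
have [C C0 CE] : exists2 C : R, 0 <= C & C = 256 by exists 256; rewrite ?ler0n.
rewrite -CE.
have first_part : C * (delta * (p * n%:R)) * M2 * r%:R ^+ 2 *
   (expR kappa * (q + p * t) ^+ (r + near_radius)) <= expR (- (e * x)).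
  set W := expR (e * x) * X * expR (e / 10 * x).
  have W0 : 0 <= W by rewrite !mulr_ge0 ?expR_ge0.
  apply: (@le_trans _ _ (2 * C * (p * n%:R) * M2 * r%:R ^+ 2 * (s * s * W))).
    rewrite [leRHS](_ : _ = C * (p * n%:R) * M2 * r%:R ^+ 2 * (2 * (s * s * W))); last by ring.
    have dpn : delta * (p * n%:R) <= p * n%:R by rewrite ler_piMl.
    have dpn0 : 0 <= delta * (p * n%:R) by apply: mulr_ge0 => //; exact: ltW.
    have qpt0 : 0 <= (q + p * t) ^+ (r + near_radius).
      by apply: exprn_ge0; apply: addr_ge0; [exact: ltW | apply: mulr_ge0; exact: ltW].
    apply: ler_pM.
    - by apply: mulr_ge0; [apply: mulr_ge0 => //; exact: mulr_ge0 | exact: sqr_ge0].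
    - by apply: mulr_ge0 => //; exact: expR_ge0.
    - apply: ler_wpM2r; first exact: sqr_ge0.
      by apply: ler_wpM2r => //; exact: ler_wpM2l.
    - apply: ler_pM; [exact: expR_ge0 | exact: qpt0 | exact: ek |].
      by apply: (le_trans qpt); rewrite /W le_eqVlt; apply/orP; left; apply/eqP; ring.
  have nsr : p * (n%:R * s) * r%:R <= X ^+ 2 * r%:R.
    rewrite ler_wpM2r // expr2.
    apply: (@le_trans _ _ (p * (4 * r%:R * x))); first by rewrite ler_wpM2l // ltW.
    rewrite (_ : _ * _ = (4 * (r%:R * p)) * x); last by ring.
    by apply: ler_pM; rewrite ?mulr_ge0 ?(ltW p0) //; move: rp X32x x0; lra.
  apply: (@le_trans _ _ (2 * C * M2 * W * (X ^+ 2 * r%:R * (r%:R * s)))).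
    rewrite [leLHS](_ : _ = 2 * C * M2 * W * (p * (n%:R * s) * r%:R * (r%:R * s))); last by ring.
    apply: ler_wpM2l; first by do 3!(apply: mulr_ge0 => //).
    by apply: ler_wpM2r => //; exact: mulr_ge0.
  rewrite [leLHS](_ : _ = 2 * C * (M2 * W * X ^+ 2) * (r%:R ^+ 2 * s)); last by ring.
  apply: (@le_trans _ _ (X * (M2 * W * X ^+ 2) * expR ((4 * w - 3 * e) * x))).
    have MW0 : 0 <= M2 * W * X ^+ 2.
      by apply: mulr_ge0; [exact: mulr_ge0 | exact: sqr_ge0].
    apply: ler_pM; [|by apply: mulr_ge0 => //; exact: sqr_ge0| |exact: r2s].
      by apply: mulr_ge0 => //; exact: mulr_ge0.
    by apply: ler_wpM2r => //; rewrite CE; move: KX3 x1; lra.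
  rewrite M2E /W expr2 /X -!expRD ler_expR /w.
  (* In units of [e x]: [1 / 5] from [M2], [11 / 10] from [W], [- 3] from [r2s], and eight powers of
     [X] at [1 / 100] each. *)
  rewrite [leLHS](_ : _ = - (162 / 100) * (e * x)); last by field.
  by have := mulr_ge0 (ltW e0) x0; lra.
have second_part : C * (delta * (p * n%:R)) * M2 * r%:R ^+ 2 * z <= expR (- (e * x)).
  apply: (@le_trans _ _ (X * expR x * expR (e / 5 * x) * (expR x * expR x) * expR (- (9 * x)))).
    have dpn0 : 0 <= delta * (p * n%:R) by apply: mulr_ge0 => //; exact: ltW.
    have Cd0 : 0 <= C * (delta * (p * n%:R)) by exact: mulr_ge0.
    have dpn : delta * (p * n%:R) <= expR x.
      by rewrite -nx mulrA ler_piMl // mulr_ile1 // ltW.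
    rewrite zE M2E expr2; apply: ler_wpM2r; first exact: expR_ge0.
    apply: ler_pM.
    - by apply: mulr_ge0 => //; exact: expR_ge0.
    - exact: mulr_ge0.
    - apply: ler_wpM2r; first exact: expR_ge0.
      by apply: ler_pM => //; rewrite CE; move: KX3 x1; lra.
    - exact: ler_pM.
  rewrite /X -!expRD ler_expR /w.
  rewrite [leLHS](_ : _ = 21 / 100 * (e * x) - 6 * x); last by field.
  by have := ler_wpM2r x0 e1; move: x0; lra.
by rewrite [leLHS]mulrDr mulr_natl mulr2n lerD.
Qed.
End ErrorTerms.
End Asymptotic.

Section NearGnp.
Variable R : realType.

(** [delta] depends on [e] alone. First [t = e ^ 2 / 60] keeps the fragile weights small; [tau]
    makes the prefactor [M = expR (lam * tau * x)] equal to [n ^ (e / 10)]; then [192 delta <= tau]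
    makes [delta p n] deletions affordable for sets with more than [tau x] edges to [v], since
    [r p <= 3 x]. *)
Lemma near_gnp (e : R) : 0 < e -> e <= 1 / 32 ->
  exists2 delta : R, 0 < delta & forall eps : R, 0 < eps ->
    \forall n \near \oo, forall p, admissible e n p ->
      let r := dom_threshold n p in
      expR (11 * ln n%:R) <= expected_dominating n r p ->
      forall A : pred {set {set 'I_n}},
      (forall E, domination_number E = r ->
         delta * (p * n%:R) <= (bondage_number E)%:R ->
         (bondage_number E <= 2 * max_degree E)%N ->
         p * n%:R / 8 <= (max_degree E)%:R ->
         (max_degree E)%:R <= 4 * (p * n%:R) -> A E) ->
      1 - eps <= gnp_prob p A.
Proof.
move=> e0 e1.
have [t [lam [t0 te t1 lam0 tE]]] : exists t lam : R,
    [/\ 0 < t, 60 * t <= e ^+ 2, t < 1, 0 < lam & expR (- lam) = t].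
  have t0 : 0 < e ^+ 2 / 60 by rewrite divr_gt0 ?exprn_gt0.
  have t1 : e ^+ 2 / 60 < 1.
    have : e ^+ 2 <= 1 by rewrite exprn_ile1 //; [exact: ltW | move: e1; lra].
    by lra.
  exists (e ^+ 2 / 60), (- ln (e ^+ 2 / 60)); split => //.
  - by rewrite mulrC divfK.
  - by rewrite oppr_gt0 ln_lt0 // t0 t1.
  - by rewrite opprK lnK.
have [tau tau0 tauE] : exists2 tau : R, 0 < tau & lam * tau = e / 10.
  exists (e / 10 / lam); first by rewrite !divr_gt0.
  by rewrite mulrC divfK // gt_eqF.
have [delta [d0 d1 dtau]] : exists delta : R, [/\ 0 < delta, delta <= 1 & 192 * delta <= tau].
  exists (Num.min 1 (tau / 192)); split.
  - by rewrite lt_min ltr01 divr_gt0.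
  - by rewrite ge_min lexx.
  - have : Num.min 1 (tau / 192) <= tau / 192 by rewrite ge_min lexx orbT.
    by lra.
exists delta => // eps eps0.
have [K [K600 Ke]] : exists K : R, 600 <= K /\ 1 / e <= K.
  have eV0 : 0 <= 1 / e by rewrite divr_ge0 // ltW.
  by exists (600 + 1 / e); split; lra.
have K0 : 0 <= K by apply: le_trans K600; rewrite ler0n.
have K1 : 32 <= K by apply: le_trans K600; rewrite ler_nat.
have e100 : 0 < e / 100 by exact: divr_gt0 e0 (ltr0n _ 100).
have e256 : 0 < e / 256 by exact: divr_gt0 e0 (ltr0n _ 256).
have c8 : (0 : R) <= 8 by rewrite ler0n.
have c16 : (0 : R) <= 16 by rewrite ler0n.
have h2 : (0 : R) < 1 / 2 by rewrite divr_gt0.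
(* The five error terms are at most 1, 2, 2, 1 and 1 times [n ^ (- e)]. *)
have eps7 : 0 < eps / 7 by rewrite divr_gt0.
near=> n.
have nx : (n%:R : R) = expR (ln n%:R) by near: n; exact: near_natE.
have x1 : 1 <= ln (n%:R : R) by near: n; exact: near_ln.
have xe : 600 / e ^+ 2 <= ln (n%:R : R) by near: n; exact: near_ln.
have KX : K * ln (n%:R : R) <= expR (e / 100 * ln n%:R).
  by near: n; exact: near_absorb e100 K0.
have xtiny : 8 * ln (n%:R : R) <= expR (e / 256 * ln n%:R).
  by near: n; exact: near_absorb e256 c8.
have x16 : 16 * ln (n%:R : R) <= expR (1 / 2 * ln n%:R).
  by near: n; exact: near_absorb h2 c16.
have small : expR (- (e * ln (n%:R : R))) <= eps / 7.
  by near: n; exact: near_exp_small e0 eps7.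
have thr : forall p, admissible e n p -> threshold_facts e n p (dom_threshold n p).
  by near: n; exact: near_threshold e0 e1.
move=> p pe; have := thr p pe; move: pe; set r := dom_threshold n p; rewrite /admissible /threshold_facts.
set x := ln (n%:R : R) in nx x1 xe KX xtiny x16 small *.
move=> [pl pu] [fr fmin r0 rp [ns ns' rp' s_half]] f11 A HA.
have x0 : 0 <= x by apply: le_trans x1.
have p0 : 0 < p by apply: lt_le_trans pl; exact: expR_gt0.
have p1 : p <= 1 by have := e0; move: pu; clear; lra.
have n0 : (0 : R) < n%:R by rewrite nx expR_gt0.
have KX3 : 600 * x <= expR (e / 100 * x).
  by apply: le_trans KX; rewrite ler_wpM2r.
have pn0 : 0 < p * n%:R by rewrite mulr_gt0.
have b0 : 0 < delta * (p * n%:R) by rewrite mulr_gt0.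
have k0 : 0 < tau * x by rewrite mulr_gt0 // (lt_le_trans _ x1).
have lamk : lam * (tau * x) = e / 10 * x.
  by rewrite mulrA tauE.
have kMt m : (0 < m)%N -> m%:R^-1 <= 1 / (tau * x) + expR (e / 10 * x) * t ^+ m.
  by move=> m0; have := cheap_weight k0 lam0 m0; rewrite tE lamk.
have bk : 64 * (delta * (p * n%:R)) * r%:R * (1 / (tau * x)) <= n%:R.
  rewrite mul1r ler_pdivrMr //.
  rewrite [leLHS](_ : _ = 64 * delta * n%:R * (r%:R * p)); last by ring.
  apply: (@le_trans _ _ (64 * delta * n%:R * (3 * x))).
    by apply: ler_wpM2l => //; apply: mulr_ge0 => //; apply: mulr_ge0 => //; exact: ltW.
  rewrite [leLHS](_ : _ = 192 * delta * (n%:R * x)); last by ring.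
  rewrite [leRHS](_ : _ = tau * (n%:R * x)); last by ring.
  by apply: ler_wpM2r => //; apply: mulr_ge0.
have ex2 : e * x <= x / 32 by move: (ler_wpM2r x0 e1); clear; lra.
have pn_big : expR (1 / 2 * x) <= p * n%:R.
  rewrite nx; apply: (@le_trans _ _ (expR ((- (1 / 3) + e) * x) * expR x)).
    rewrite -expRD ler_expR; have : 0 <= e * x by rewrite mulr_ge0 // ltW.
    by move: x0; clear; lra.
  by rewrite ler_wpM2r ?expR_ge0.
have c0 : 0 < e / 8 by rewrite divr_gt0.
have z0 := expR_ge0 (- (e * x)).
apply: le_trans (@gnp_finite R n r p p0 p1 r0 x (e / 8) e (near_radius e r) (tiny_radius e r)
  (@param_s8 R e p x r e0 e1 x1 s_half K KX K1)
  (@param_rn R e p x n r e0 e1 x1 nx p0 pl r0 rp K KX K1)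
  (@param_rs R e p x r e0 e1 x1 p0 pu pl r0 rp s_half K KX K1)
  x1 nx c0 ns'
  (@tiny_radius_gt0 R e p x r e0 pu rp' xe)
  (@tiny_radius_le R e p x r e0 pu rp' xe)
  (@param_qtiny R e p x r e0 x1 p0 pu rp' s_half xe xtiny)
  (@param_nsq R e p x n r e0 x1 p0 pu ns rp' s_half xe xtiny)
  f11
  (@param_xr R e p x n r e0 e1 x1 nx p0 pl r0 rp K KX K1)
  (@near_radius_le R e r e0 e1)
  (@near_radius_gap R e r e0 e1)
  (@param_big R e p x r e0 e1 x1 pu r0 rp' xe)
  (delta * (p * n%:R)) (1 / (tau * x)) t (expR (e / 10 * x)) b0 (ltW (divr_gt0 ltr01 k0))
  (ltW t0) (ltW t1) (expR_ge0 _) kMt bk A HA).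
rewrite lerD2l lerN2.
have v := @variance_term R e p x n r e0 e1 x1 nx p0 pu pl r0 rp ns ns' rp' K KX K1 Ke xe KX3.
have fg := @fragile_term R e p x n r e0 e1 x1 nx p0 pu pl r0 rp ns ns' rp' K KX K1 Ke xe KX3
  t delta t0 te d0 d1.
have t1' : expected_dominating n r.-1 p <= expR (- (e * x)).
  apply: (@le_trans _ _ (1 / (p * n%:R))); first by apply: fmin; rewrite prednK.
  rewrite div1r -[leRHS]invrK -expRN opprK lef_pV2 ?posrE ?invr_gt0 ?expR_gt0 //.
  by apply: le_trans pn_big; rewrite ler_expR; move: ex2 x0; clear; lra.
have t4 : n%:R * expR (- (p * n%:R)) <= expR (- (e * x)).
  rewrite {1}nx -expRD ler_expR; move: (le_trans x16 pn_big) ex2 x0; clear; lra.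
have t5 : expR (- (p * n%:R / 8)) <= expR (- (e * x)).
  rewrite ler_expR; move: (le_trans x16 pn_big) ex2 x0; clear; lra.
apply: (@le_trans _ _ (expR (- (e * x)) + 2 * expR (- (e * x)) + 2 * expR (- (e * x)) +
  expR (- (e * x)) + expR (- (e * x)))).
  by do 4!(apply: lerD => //).
by have := small; clear; lra.
Unshelve. all: by end_near. Qed.
End NearGnp.

(** * Density of the good orders *)

Section Steps.
Variable R : realType.
Implicit Types (p q s : R) (m k : nat).

(** A mean value bound with [q ^ k] in place of [q ^ (k - 1)], allowed by [q <= 1]; this avoids a
    predecessor. *)
Lemma exprB_ge q q' k : 0 <= q -> q <= q' -> q <= 1 ->
  k%:R * q ^+ k * (q' - q) <= q' ^+ k - q ^+ k.
Proof.
move=> q0 qq q1; elim: k => [|k IH]; first by rewrite !mul0r subrr.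
have qk : 0 <= q ^+ k by rewrite exprn_ge0.
have d0 : 0 <= q' - q by rewrite subr_ge0.
rewrite -[k.+1%:R]natr1 !exprS.
have h1 := ler_wpM2l q0 IH.
have h2 : q * (q' ^+ k - q ^+ k) <= q' * (q' ^+ k - q ^+ k).
  by apply: ler_wpM2r => //; rewrite subr_ge0; apply: ler_exp2r.
have h3 : q * (q ^+ k * (q' - q)) <= q ^+ k * (q' - q).
  by rewrite ler_piMl // mulr_ge0.
move: h1 h2 h3; clear; lra.
Qed.

Lemma exprB_le q q' k : 0 <= q -> q <= q' ->
  q' * (q' ^+ k - q ^+ k) <= k%:R * q' ^+ k * (q' - q).
Proof.
move=> q0 qq; elim: k => [|k IH]; first by rewrite !mul0r subrr mulr0.
have q'0 : 0 <= q' by apply: le_trans qq.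
have d0 : 0 <= q' - q by rewrite subr_ge0.
rewrite -[k.+1%:R]natr1 !exprS.
have h1 := ler_wpM2l q'0 IH.
have h2 : q' * ((q' - q) * q ^+ k) <= q' * ((q' - q) * q' ^+ k).
  by rewrite ler_wpM2l // ler_wpM2l // ler_exp2r.
move: h1 h2; clear; lra.
Qed.

Lemma expected_dominating_ge0 n k p : 0 <= p -> p <= 1 -> 0 <= expected_dominating n k p.
Proof.
move=> p0 p1; apply: mulr_ge0 => //; apply: exprn_ge0; rewrite subr_ge0.
by apply: exprn_ile1; rewrite ?subr_ge0 // gerBl.
Qed.

Section OneStep.
Variables (p p' : R) (m k : nat).
Hypotheses (p'0 : 0 <= p') (pp : p' <= p) (p1 : p <= 1) (km : (k <= m)%N).
Let s := (1 - p) ^+ k.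
Let s' := (1 - p') ^+ k.
Hypothesis s'2 : s' <= 1 / 2.

Let s0 : 0 <= s. Proof. by rewrite exprn_ge0 // subr_ge0. Qed.
Let ss : s <= s'. Proof. by apply: ler_exp2r; rewrite ?subr_ge0 ?lerB. Qed.
Let s1 : 0 < 1 - s. Proof. by move: ss s'2; lra. Qed.
(** The relative loss in [1 - s] as [p] decreases to [p']; it lies between [s' - s] and twice
    that. *)
Let y := (s' - s) / (1 - s).
Let yE : 1 - s' = (1 - s) * (1 - y).
Proof. by rewrite /y; field; rewrite gt_eqF. Qed.
Let y0 : 0 <= y. Proof. by apply: divr_ge0; [rewrite subr_ge0 | exact: ltW]. Qed.
Let y2 : y <= 2 * (s' - s).
Proof. by rewrite /y ler_pdivrMr //; move: ss s'2 s0; nra. Qed.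
Let yh : y <= 1 / 2.
Proof. by rewrite /y ler_pdivrMr //; move: ss s'2 s0; nra. Qed.
Let y1 : s' - s <= y.
Proof. by rewrite /y ler_pdivlMr //; move: ss s'2 s0; nra. Qed.

Lemma binS_ratio : (m.+1 - k)%:R * ('C(m.+1, k))%:R = m.+1%:R * ('C(m, k))%:R :> R.
Proof. by rewrite -!natrM; congr (_%:R); rewrite -mul_bin_down. Qed.

Lemma expected_dominating_step :
  expected_dominating m.+1 k p' =
    expected_dominating m k p * (m.+1%:R / (m.+1 - k)%:R) * ((1 - s') * (1 - y) ^+ (m - k)).
Proof.
rewrite /expected_dominating -/s -/s' subSn // exprS {2}yE exprMn.
have mk0 : ((m - k).+1)%:R != 0 :> R by rewrite pnatr_eq0.
have -> : 'C(m.+1, k)%:R = 'C(m, k)%:R * (m.+1%:R / ((m - k).+1)%:R) :> R.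
  by apply: (mulfI mk0); rewrite -(subSn km) binS_ratio mulrCA [X in _ = _ * X]mulrCA divff ?subSn // mulr1 mulrC.
by ring.
Qed.

Lemma expected_dominating_drop_ge :
  expected_dominating m.+1 k p' <= expected_dominating m k p *
    expR (k%:R / (m.+1 - k)%:R - s' - (m - k)%:R * (s' - s)).
Proof.
rewrite expected_dominating_step -mulrA; apply: ler_wpM2l.
  by apply: expected_dominating_ge0 => //; apply: le_trans pp.
rewrite -addrA expRD; apply: ler_pM.
- by rewrite divr_ge0.
- by rewrite mulr_ge0 ?exprn_ge0 //; move: s'2 yh; lra.
- apply: le_trans _ (expR_ge1Dx _).
  have mk : 0 < (m.+1 - k)%:R :> R by rewrite ltr0n subSn.
  rewrite ler_pdivrMr // mulrDl mul1r divfK ?gt_eqF // -natrD ler_nat subnK //.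
  exact: leqW.
- rewrite expRD; apply: ler_pM.
  + by move: s'2; lra.
  + by rewrite exprn_ge0 //; move: yh; lra.
  + exact: onesub_le_exp.
  + apply: le_trans (onesubX_le_exp _ _) _; first by move: yh; lra.
    by rewrite ler_expR lerN2 mulrC ler_wpM2r.
Qed.

Lemma expected_dominating_drop_le :
  expected_dominating m k p * expR (- (2 * s' + 4 * (m - k)%:R * (s' - s))) <=
  expected_dominating m.+1 k p'.
Proof.
rewrite expected_dominating_step -[leRHS]mulrA; apply: ler_wpM2l.
  by apply: expected_dominating_ge0 => //; apply: le_trans pp.
rewrite -[leLHS]mul1r; apply: ler_pM; [by [] | exact: expR_ge0 | |].
  have mk : 0 < (m.+1 - k)%:R :> R by rewrite ltr0n subSn.
  by rewrite ler_pdivlMr // mul1r ler_nat leq_subr.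
rewrite opprD expRD; apply: ler_pM; rewrite ?expR_ge0 //.
  by apply: onesub_ge_exp => //; apply: le_trans ss.
apply: le_trans _ (onesubX_ge_exp _ y0 yh); rewrite ler_expR lerN2.
have := ler_wpM2r (ler0n R (m - k)) y2; lra.
Qed.
End OneStep.

Lemma bin_mono m k : (2 * k.+1 <= m)%N -> ('C(m, k) <= 'C(m, k.+1))%N.
Proof.
move=> km; rewrite -(leq_pmul2l (ltn0Sn k)) mul_bin_left leq_mul2r; apply/orP; right.
by lia.
Qed.

(** The binomial coefficients increase up to the middle, and one more vertex turns [s] into
    [s (1 - p)]. Each of the at least [m / 2] remaining vertices gains a factor [expR (s p / 2)]. *)
Lemma expected_dominating_nextk p m k : 0 <= p -> p <= 1 -> (2 * k.+1 <= m)%N ->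
  (1 - p) ^+ k <= 1 / 2 ->
  expected_dominating m k p * expR (m%:R * p * (1 - p) ^+ k / 4) <=
  expected_dominating m k.+1 p.
Proof.
move=> p0 p1 km s2; rewrite /expected_dominating exprS; set s := (1 - p) ^+ k.
have s0 : 0 <= s by rewrite exprn_ge0 // subr_ge0.
have s1 : 0 < 1 - s by move: s2; rewrite -/s; lra.
have sp0 : 0 <= s * p by rewrite mulr_ge0.
have sp1 : s * p <= 1 by apply: mulr_ile1 => //; move: s2; rewrite -/s; lra.
have -> : (m - k = (m - k.+1).+1)%N by rewrite -subSn // ; lia.
rewrite -[leLHS]mulrA; apply: ler_pM => //.
- by rewrite mulr_ge0 ?exprn_ge0 ?expR_ge0 // ltW.
- by rewrite ler_nat bin_mono.
apply: (@le_trans _ _ ((1 - s) ^+ (m - k.+1) * expR (s * p / 2) ^+ (m - k.+1))).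
  apply: ler_pM; rewrite ?exprn_ge0 ?expR_ge0 //; rewrite ?(ltW s1) //.
    by rewrite exprS ler_piMl ?exprn_ge0 // ?(ltW s1) // gerBl.
  rewrite -expRM_natr ler_expR.
  have : m%:R / 2 <= (m - k.+1)%:R :> R.
    by rewrite ler_pdivrMr // -natrM ler_nat; lia.
  by move=> /(ler_wpM2l sp0); lra.
rewrite -exprMn; apply: ler_exp2r; first by rewrite mulr_ge0 ?expR_ge0 // ltW.
have h : expR (s * p / 2) <= 1 + s * p.
  by have := @expR_sub1_le R (s * p / 2) _ _; move: sp0 sp1; lra.
have := ler_wpM2l (ltW s1) h; have : 0 <= s * (s * p) by rewrite mulr_ge0.
lra.
Qed.

(** Allows the threshold to be identified as [r + 1] by testing sizes [r] and [r + 1] only. *)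
Lemma expected_dominating_mono p m k r : 0 <= p -> p <= 1 -> (2 * r <= m)%N ->
  (k <= r)%N -> expected_dominating m k p <= expected_dominating m r p.
Proof.
move=> p0 p1; elim: r => [|r IH] rm; first by rewrite leqn0 => /eqP ->.
rewrite leq_eqVlt => /orP[/eqP -> //|]; rewrite ltnS => kr.
apply: le_trans (IH _ kr) _; first by lia.
have s1 j : 0 <= 1 - (1 - p) ^+ j.
  by rewrite subr_ge0 exprn_ile1 ?subr_ge0 // gerBl.
apply: ler_pM => //; first by rewrite exprn_ge0.
  by rewrite ler_nat bin_mono.
apply: (@le_trans _ _ ((1 - (1 - p) ^+ r) ^+ (m - r.+1))).
  apply: ler_wiXn2l => //; last by rewrite leq_sub2l.
  by rewrite gerBl exprn_ge0 // subr_ge0.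
apply: ler_exp2r => //; rewrite lerD2l lerN2.
by apply: ler_wiXn2l; rewrite ?subr_ge0 ?gerBl.
Qed.
End Steps.

(** * Density one from short bad runs before long good ones *)

Section Density.
Variable R : realType.
Variable I : set nat.

Let bad a N := (\sum_(a <= i < N) (i \notin I))%N.

Let bad_le a N : (bad a N <= N - a)%N.
Proof.
rewrite /bad -[leqRHS]muln1 -sum_nat_const_nat; apply: leq_sum => i _.
by case: (i \notin I).
Qed.

Let bad_cat a b N : (a <= b)%N -> (b <= N)%N -> bad a N = (bad a b + bad b N)%N.
Proof. by move=> ab bN; rewrite /bad (big_cat_nat ab bN). Qed.

Let bad_good a N : (forall m, (a <= m < N)%N -> m \in I) -> bad a N = 0%N.
Proof.
move=> H; rewrite /bad big_nat_cond big1 // => i /andP[aiN _].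
by rewrite H.
Qed.

(* A possibly bad run [a, n1) is short compared with the good run that follows. *)
Definition covered (eps : R) (a : nat) := exists n1 n2 : nat,
  [/\ (a < n1)%N, (n1 < n2)%N, (n2 <= 2 * a)%N,
      (n1 - a)%:R <= eps * (n2 - n1)%:R
    & forall m, (n1 <= m < n2)%N -> m \in I].

(** Induction in jumps over the covering runs, each bad part being at most [eps] times its good
    part. Only the last jump can overshoot [N]; by [n2 <= 2 * a] it costs at most [2 * eps * N],
    once. *)
Let bad_bound (eps : R) N0 : 0 <= eps ->
  (forall a, (N0 <= a)%N -> a \notin I -> covered eps a) ->
  forall N a, (N0 <= a)%N -> (a <= N)%N ->
    (bad a N)%:R <= eps * (N%:R - a%:R) + 2 * eps * N%:R.
Proof.
move=> eps0 cov N a; have [d] := ubnP (N - a)%N; elim: d a => // d IH a dN N0a aN.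
have nn (i : nat) : 0 <= eps * i%:R by rewrite mulr_ge0.
have [->|aN'] := eqVneq a N.
  by rewrite /bad big_geq // subrr mulr0 add0r -mulrA mulr_ge0 // nn.
have {aN'} aN' : (a < N)%N by rewrite ltn_neqAle aN' aN.
have [aI|aI] := boolP (a \in I).
  rewrite /bad big_ltn // aI add0n; apply: le_trans (IH a.+1 _ _ aN') _.
  - by move: dN; clear -aN'; lia.
  - exact: leqW.
  - by rewrite lerD2r ler_wpM2l // lerD2l lerN2 ler_nat.
have [n1 [n2 [an1 n12 n2a le good]]] := cov a N0a aI.
have le2 : (n1 - a)%:R <= eps * n2%:R.
  by apply: (le_trans le); rewrite ler_wpM2l // ler_nat leq_subr.
have [n2N|Nn2] := leqP n2 N.
- rewrite (bad_cat (b := n1)) ?(ltnW an1) //; last by move: n12 n2N; clear; lia.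
  rewrite (bad_cat (a := n1) (b := n2)) ?(ltnW n12) // (bad_good good) add0n natrD.
  have h1 : (bad a n1)%:R <= eps * (n2%:R - n1%:R).
    rewrite -natrB ?(ltnW n12) //; apply: le_trans le; rewrite ler_nat; exact: bad_le.
  have h2 := IH n2 _ _ n2N.
  have {}h2 : (bad n2 N)%:R <= eps * (N%:R - n2%:R) + 2 * eps * N%:R.
    by apply: h2; [move: dN an1 n12 n2N; clear; lia | move: N0a an1 n12; clear; lia].
  have : eps * a%:R <= eps * n1%:R by rewrite ler_wpM2l // ler_nat ltnW.
  by move: h1 h2; clear; lra.
have h : (bad a N <= n1 - a)%N.
  have [n1N|Nn1] := leqP n1 N; last first.
    by apply: leq_trans (bad_le _ _) _; rewrite leq_sub2r // ltnW.
  rewrite (bad_cat (b := n1)) ?(ltnW an1) // (bad_good (a := n1)) ?addn0 ?bad_le //.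
  by move=> m /andP[h1 h2]; apply: good; rewrite h1 (leq_trans h2) // ltnW.
apply: (@le_trans _ _ (eps * n2%:R)).
  by apply: le_trans le2; rewrite ler_nat.
have h1 : eps * n2%:R <= eps * (2 * a)%:R by rewrite ler_wpM2l // ler_nat.
have h2 : eps * a%:R <= eps * N%:R by rewrite ler_wpM2l // ler_nat.
by move: h1 h2; rewrite natrM; clear; lra.
Qed.

Lemma density_one_covered :
  (forall eps : R, 0 < eps -> \forall a \near \oo, a \notin I -> covered eps a) ->
  density_one R I.
Proof.
move=> cov; apply/cvgrPdist_le => eps eps0.
(* The bound [3 * (eps / 20) * (n + 1)] is at most [3 / 10 * eps * n], and the initial segment takes
   at most [eps / 2 * n]. *)
have [N0 _ HN0] := cov (eps / 20) (divr_gt0 eps0 (ltr0n _ 20)).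
have eps20 : 0 <= eps / 20 by rewrite divr_ge0 ?ler0n // ltW.
near=> n.
have n1 : (0 < n)%N by near: n; exact: nbhs_infty_gt.
have nN : (N0.+1 <= n)%N by near: n; exact: nbhs_infty_ge.
have nbig : N0.+1%:R / (eps / 2) <= n%:R :> R.
  by near: n; exact: nbhs_infty_ger.
have n0 : (0 : R) < n%:R by rewrite ltr0n.
have total : (\sum_(1 <= i < n.+1) (i \in I) + bad 1 n.+1 = n)%N.
  rewrite /bad -big_split /= (eq_bigr (fun=> 1%N)) => [|i _].
    by rewrite sum_nat_const_nat muln1 subn1.
  by case: (i \in I).
have goodE : (\sum_(1 <= i < n.+1) (i \in I))%N%:R = n%:R - (bad 1 n.+1)%:R :> R.
  by have := congr1 (fun m => m%:R : R) total; rewrite natrD => <-; rewrite addrK.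
rewrite goodE mulrBl divff ?gt_eqF // opprB addrC subrK ger0_norm; last first.
  by rewrite divr_ge0.
rewrite ler_pdivrMr //.
have -> : bad 1 n.+1 = (bad 1 N0.+1 + bad N0.+1 n.+1)%N.
  by apply: bad_cat => //; apply: leqW.
have h1 : (bad 1 N0.+1)%:R <= N0.+1%:R :> R.
  by rewrite ler_nat; apply: leq_trans (bad_le _ _) (leq_subr _ _).
have h2 := @bad_bound (eps / 20) N0 eps20 (fun a ha => HN0 a ha) n.+1 N0.+1 (leqnSn _) (leqW nN).
have h3 : N0.+1%:R <= n%:R * (eps / 2) by rewrite -ler_pdivrMr // divr_gt0.
have h4 : eps / 20 * N0.+1%:R >= 0 by rewrite mulr_ge0.
have h5 : eps / 20 * n.+1%:R <= eps / 20 * (2 * n)%:R.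
  by rewrite ler_wpM2l // ler_nat; move: n1; clear; lia.
have h6 : 0 <= eps * n%:R by rewrite mulr_ge0 // ltW.
rewrite natrD; rewrite natrM in h5; move: h1 h2 h3 h4 h5 h6.
set u := N0.+1%:R; set v := n.+1%:R; set b1 := (bad 1 _)%:R; set b2 := (bad _ _)%:R.
clear; lra.
Unshelve. all: by end_near. Qed.
End Density.

(** * Decay of the expected numbers within a window *)

Section Window.
Variables (R : realType) (p h : nat -> R) (e c C H : R) (n : nat).
Hypotheses (e0 : 0 < e) (c0 : 0 < c) (C0 : 0 < C) (n0 : (0 < n)%N).
Hypotheses (hH : forall m, 0 <= h m <= H) (hd : forall m m', (m <= m')%N -> h m' <= h m).
Hypothesis pm : forall m, (n <= m)%N -> 0 < p m <= 1 - e.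
Hypothesis ratio : forall m, (n <= m)%N ->
  c * (h m / m%:R) <= 1 - p m.+1 / p m /\ 1 - p m.+1 / p m <= C * (h m / m%:R).

Let p0 m : (n <= m)%N -> 0 < p m. Proof. by move=> /pm/andP[]. Qed.
Let p0' m : (n <= m)%N -> 0 <= p m. Proof. by move=> /p0/ltW. Qed.
Let pe m : (n <= m)%N -> p m <= 1 - e. Proof. by move=> /pm/andP[]. Qed.
Let p1 m : (n <= m)%N -> p m <= 1.
Proof. by move=> /pe; move: e0; lra. Qed.
Let hm0 m : 0 <= h m / m%:R. Proof. by rewrite divr_ge0 //; case/andP: (hH m). Qed.
Let ch0 m : 0 <= c * (h m / m%:R). Proof. by apply: mulr_ge0 => //; exact: ltW. Qed.
Let Ch0 m : 0 <= C * (h m / m%:R). Proof. by apply: mulr_ge0 => //; exact: ltW. Qed.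
Let nR : 0 < n%:R :> R. Proof. by rewrite ltr0n. Qed.

Let drop_p m : (n <= m)%N ->
  c * (h m / m%:R) * p m <= p m - p m.+1 <= C * (h m / m%:R) * p m.
Proof.
move=> nm; have pm0 := p0 nm; have [h1 h2] := ratio nm.
have e2 : p m - p m.+1 = (1 - p m.+1 / p m) * p m by field; rewrite gt_eqF.
by rewrite e2 !ler_pM2r // h1 h2.
Qed.

Lemma probability_step m : (n <= m)%N -> p m.+1 <= p m.
Proof.
move=> nm; have /andP[h1 _] := drop_p nm.
rewrite -subr_ge0; apply: le_trans h1.
by apply: mulr_ge0; [exact: ch0 | exact: p0'].
Qed.

Let p_mono m m' : (n <= m)%N -> (m <= m')%N -> p m' <= p m.
Proof.
move=> nm mm; rewrite -(subnKC mm); elim: (m' - m)%N => [|d IH]; first by rewrite addn0.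
by rewrite addnS; apply: le_trans (probability_step _) IH; apply: leq_trans nm (leq_addr _ _).
Qed.

Let H0 : 0 <= H. Proof. by case/andP: (hH 0%N) => h1 h2; apply: le_trans h2. Qed.

Let p_low j : p n - p (n + j)%N <= p n * (j%:R * (C * H / n%:R)).
Proof.
elim: j => [|j IH]; first by rewrite addn0 subrr mul0r mulr0.
have nj : (n <= n + j)%N := leq_addr _ _.
have /andP[_ h2] := drop_p nj.
have h3 : C * (h (n + j)%N / (n + j)%:R) * p (n + j)%N <= C * (H / n%:R) * p n.
  apply: ler_pM; rewrite ?Ch0 ?p0' ?p_mono //.
  rewrite ler_wpM2l ?(ltW C0) //; apply: ler_pM => //.
  - by case/andP: (hH (n + j)%N).
  - by case/andP: (hH (n + j)%N).
  - by rewrite lef_pV2 ?posrE ?ltr0n ?addn_gt0 ?n0 // ler_nat.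
have {h2 h3} := le_trans h2 h3; rewrite addnS -(natr1 j) mulrA.
rewrite (_ : p n * _ = p n * (j%:R * (C * H / n%:R)) + C * H / n%:R * p n); last by ring.
by move: IH; lra.
Qed.

Variables (W : nat) (r : nat) (A : R).
Hypotheses (Wsmall : W%:R * (C * H / n%:R) <= 1 / 2).
Hypothesis r0 : (0 < r)%N.
Hypothesis (WA : r%:R * (p n * (W%:R * (C * H / n%:R)) / e) <= ln A) (A0 : 0 < A).
Hypotheses (rn : (4 * r.+1 <= n)%N).
Let s0 := (1 - p n) ^+ r.
Hypotheses (As0 : A * s0 <= 1 / 2) (s0r : 4 * r%:R <= n%:R * s0).

Let CHn : 0 <= C * H / n%:R. Proof. by apply: divr_ge0 => //; apply: mulr_ge0 => //; exact: ltW. Qed.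
Let q0 m : (n <= m)%N -> 0 <= 1 - p m. Proof. by move=> /p1; rewrite subr_ge0. Qed.
Let s00 : 0 <= s0. Proof. by rewrite exprn_ge0 // q0. Qed.

Lemma half_probability m : (n <= m <= n + W)%N -> p n / 2 <= p m.
Proof.
move=> /andP[nm mW]; have := p_low (m - n); rewrite subnKC // => h1.
have h2 : p n * ((m - n)%:R * (C * H / n%:R)) <= p n * (1 / 2).
  rewrite ler_wpM2l ?p0' //; apply: le_trans Wsmall; rewrite ler_wpM2r // ler_nat.
  by rewrite leq_subLR.
by move: h1 h2; lra.
Qed.

(** As [1 - p n >= e], the factor by which [1 - p] grows over the window is at most the exponential
    of the decrease of [p] divided by [e]; [WA] says that its [r]-th power is at most [A]. *)
Let q_up m : (n <= m <= n + W)%N -> (1 - p m) ^+ r <= A * s0.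
Proof.
move=> /andP[nm mW]; pose th := W%:R * (C * H / n%:R).
have th0 : 0 <= th by rewrite mulr_ge0.
have h1 : p n - p m <= p n * th.
  have := p_low (m - n); rewrite subnKC // => /le_trans; apply.
  by rewrite ler_wpM2l ?p0' // ler_wpM2r // ler_nat leq_subLR.
have h2 : 1 - p m <= (1 - p n) * expR (p n * th / e).
  apply: (@le_trans _ _ ((1 - p n) * (1 + p n * th / e))); last first.
    by rewrite ler_wpM2l ?q0 // expR_ge1Dx.
  have : e * (p n * th / e) <= (1 - p n) * (p n * th / e).
    rewrite ler_wpM2r //; first by apply: divr_ge0; [apply: mulr_ge0 => //; exact: p0' | exact: ltW].
    by have := pe (leqnn n); lra.
  rewrite mulrCA divff ?gt_eqF // mulr1; move: h1; lra.
apply: le_trans (ler_exp2r r (q0 nm) h2) _; rewrite exprMn mulrC ler_wpM2r //.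
by rewrite -expRM_natl -[leRHS]lnK ?posrE // ler_expR.
Qed.

Let s_low m : (n <= m)%N -> s0 <= (1 - p m) ^+ r.
Proof.
move=> nm; apply: ler_exp2r; first exact: q0.
by rewrite lerD2l lerN2 p_mono.
Qed.

(* Up to constant factors, [ln f(m, r, p_m)] drops by this much from [m] to [m + 1];
   the term with [h m] is due to the change of [p]. *)
Definition drop_rate (m : nat) : R := s0 * (1 + r%:R * p n * h m).

Lemma drop_rate_mono m m' : (m <= m')%N -> drop_rate m' <= drop_rate m.
Proof.
move=> mm; rewrite ler_wpM2l // lerD2l ler_wpM2l ?hd //.
by rewrite mulr_ge0 ?p0'.
Qed.

Lemma drop_rate_ge m : s0 <= drop_rate m.
Proof.
rewrite ler_peMr // lerDl; apply: mulr_ge0; last by case/andP: (hH m).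
by apply: mulr_ge0 => //; exact: p0'.
Qed.

Let c1 := Num.min 1 c / 4.
Let C1 := A * (2 + 8 * C / e).

(** The growth of the binomial coefficient is at most [s0 / 2] in the exponent, by [4 r <= n s0],
    and is outweighed by the factor [1 - s'] of the new vertex. The change of [p] acts on about [m]
    vertices, so the [m] in [h m / m] cancels. *)
Lemma threshold_drop_ge m : (n <= m)%N -> (m < n + W)%N ->
  expected_dominating m.+1 r (p m.+1) <=
  expected_dominating m r (p m) * expR (- (c1 * drop_rate m)).
Proof.
move=> nm mW.
have nm1 : (n <= m.+1)%N by apply: leqW.
have m1W : (n <= m.+1 <= n + W)%N by rewrite nm1.
have mW' : (n <= m <= n + W)%N by rewrite nm ltnW.
have s'2 : (1 - p m.+1) ^+ r <= 1 / 2 by apply: le_trans (q_up m1W) As0.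
have rm : (r <= m)%N by move: rn nm; clear; lia.
apply: le_trans (expected_dominating_drop_ge (p0' nm1) (probability_step nm) (p1 nm) rm s'2) _.
rewrite ler_wpM2l ?expected_dominating_ge0 ?p0' ?p1 // ler_expR.
set s := (1 - p m) ^+ r; set s' := (1 - p m.+1) ^+ r.
have ss0 : s0 <= s by apply: s_low.
have s's0 : s0 <= s' by apply: s_low.
have h1 : r%:R / (m.+1 - r)%:R <= s0 / 2.
  have mr : 0 < (m.+1 - r)%:R :> R by rewrite ltr0n; move: rm; clear; lia.
  rewrite ler_pdivrMr //.
  have : n%:R / 2 <= (m.+1 - r)%:R :> R.
    by rewrite ler_pdivrMr // -natrM ler_nat; move: rn nm; clear; lia.
  by move=> /(ler_wpM2l s00); move: s0r; lra.
have h2 : r%:R * s * (p m - p m.+1) <= s' - s.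
  have := exprB_ge r (q0 nm) (lerB (lexx 1) (probability_step nm)) _.
  rewrite (_ : 1 - p m.+1 - (1 - p m) = p m - p m.+1); last by ring.
  by apply; rewrite gerBl p0'.
have /andP[h3 _] := drop_p nm.
have mr2 : m%:R / 2 <= (m - r)%:R :> R.
  by rewrite ler_pdivrMr // -natrM ler_nat; move: rn nm; clear; lia.
have m0 : 0 < m%:R :> R by rewrite ltr0n; apply: leq_trans nm.
have hm : 0 <= h m by case/andP: (hH m).
have cc1 : c1 <= c / 4 by rewrite ler_wpM2r ?invr_ge0 // ge_min lexx orbT.
have c11 : c1 <= 1 / 4 by rewrite ler_wpM2r ?invr_ge0 // ge_min lexx.
have c10 : 0 <= c1 by rewrite divr_ge0 // le_min ler01 ltW.
have h4 : r%:R * s0 * (c * (h m / m%:R) * (p n / 2)) <= s' - s.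
  apply: le_trans h2; apply: ler_pM.
  - by rewrite mulr_ge0.
  - by apply: mulr_ge0; [exact: ch0 | apply: divr_ge0 => //; exact: p0'].
  - by rewrite ler_wpM2l.
  - by apply: le_trans h3; rewrite ler_wpM2l ?half_probability ?ch0.
have d0 : 0 <= r%:R * s0 * (c * (h m / m%:R) * (p n / 2)).
  apply: mulr_ge0; first exact: mulr_ge0.
  by apply: mulr_ge0; [exact: ch0 | apply: divr_ge0 => //; exact: p0'].
have h5 : m%:R / 2 * (r%:R * s0 * (c * (h m / m%:R) * (p n / 2))) <= (m - r)%:R * (s' - s).
  by apply: ler_pM => //; rewrite divr_ge0.
have e5 : m%:R / 2 * (r%:R * s0 * (c * (h m / m%:R) * (p n / 2))) =
    c / 4 * (r%:R * s0 * h m * p n) by field; rewrite gt_eqF.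
rewrite e5 in h5.
have rshp : 0 <= r%:R * s0 * h m * p n.
  by apply: mulr_ge0; [apply: mulr_ge0 => //; exact: mulr_ge0 | exact: p0'].
have h6 := ler_wpM2r rshp cc1.
have h7 := ler_wpM2r s00 c11.
have -> : c1 * drop_rate m = c1 * s0 + c1 * (r%:R * s0 * h m * p n).
  by rewrite /drop_rate; ring.
by move: h1 h5 h6 h7 s's0 s00; set u := _ * (s' - s); lra.
Qed.

(** Size [r + 1] is included because its loss after the crossing must be measured by the rate that
    controlled size [r] before it. *)
Lemma threshold_drop_le k m : (n <= m)%N -> (m < n + W)%N -> (r <= k <= r.+1)%N ->
  expected_dominating m k (p m) * expR (- (C1 * drop_rate m)) <=
  expected_dominating m.+1 k (p m.+1).
Proof.
move=> nm mW /andP[rk kr].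
have nm1 : (n <= m.+1)%N by apply: leqW.
have m1W : (n <= m.+1 <= n + W)%N by rewrite nm1.
set s' := (1 - p m.+1) ^+ k; set s := (1 - p m) ^+ k.
have s's0 : s' <= A * s0.
  apply: le_trans (q_up m1W); apply: ler_wiXn2l => //; first exact: q0.
  by rewrite gerBl p0'.
have s'2 : s' <= 1 / 2 by apply: le_trans As0.
have km : (k <= m)%N by move: rn nm kr; clear; lia.
apply: le_trans _ (expected_dominating_drop_le (p0' nm1) (probability_step nm) (p1 nm) km s'2).
rewrite ler_wpM2l ?expected_dominating_ge0 ?p0' ?p1 // ler_expR lerN2 -/s -/s'.
have q'e : e <= 1 - p m.+1 by have := pe nm1; lra.
have m0 : 0 < m%:R :> R by rewrite ltr0n; apply: leq_trans nm.
have hm : 0 <= h m by case/andP: (hH m).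
have h1 : (1 - p m.+1) * (s' - s) <= k%:R * s' * (p m - p m.+1).
  have := exprB_le k (q0 nm) (lerB (lexx 1) (probability_step nm)).
  by rewrite (_ : 1 - p m.+1 - (1 - p m) = p m - p m.+1); last by ring.
have /andP[_ h3] := drop_p nm.
have ss : 0 <= s' - s.
  rewrite subr_ge0; apply: ler_exp2r; first exact: q0.
  by rewrite lerD2l lerN2 probability_step.
have s'0 : 0 <= s' by rewrite exprn_ge0 // q0.
have k2 : k%:R <= 2 * r%:R :> R.
  by rewrite -natrM ler_nat; move: kr r0; clear; lia.
have h4 : e * (s' - s) <= 2 * r%:R * (A * s0) * (C * (h m / m%:R) * p n).
  apply: (@le_trans _ _ ((1 - p m.+1) * (s' - s))); first by rewrite ler_wpM2r.
  apply: (le_trans h1); apply: ler_pM.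
  - by rewrite mulr_ge0.
  - by rewrite subr_ge0 probability_step.
  - exact: ler_pM.
  - by apply: (le_trans h3); rewrite ler_wpM2l ?p_mono ?Ch0.
have mk : (m - k)%:R <= m%:R :> R by rewrite ler_nat leq_subr.
have h5 : (m - k)%:R * (s' - s) <= 2 * C / e * (A * (r%:R * s0 * h m * p n)).
  rewrite -(ler_pM2l e0) mulrCA.
  apply: (@le_trans _ _ (m%:R * (2 * r%:R * (A * s0) * (C * (h m / m%:R) * p n)))).
    by apply: ler_pM => //; rewrite mulr_ge0 // ltW.
  rewrite le_eqVlt; apply/orP; left; apply/eqP; field.
  by rewrite !gt_eqF.
have -> : C1 * drop_rate m = A * s0 * 2 + 8 * C / e * (A * s0) + (2 * (A * (r%:R * s0 * h m * p n))
    + 4 * (2 * C / e * (A * (r%:R * s0 * h m * p n)))).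
  by rewrite /C1 /drop_rate; field; rewrite gt_eqF.
have t1 : 0 <= A * (r%:R * s0 * h m * p n).
  apply: mulr_ge0; first exact: ltW.
  by apply: mulr_ge0; [apply: mulr_ge0 => //; exact: mulr_ge0 | exact: p0'].
have t2 : 0 <= 8 * C / e * (A * s0).
  by apply: mulr_ge0; [apply: divr_ge0; [apply: mulr_ge0 => //|]; exact: ltW |
     apply: mulr_ge0 => //; exact: ltW].
rewrite -mulrA; move: h5 s's0 t1 t2.
set u1 := _ * (s' - s); set u2 := 2 * C / e * _; set u3 := A * (_ * p n); set u4 := 8 * C / e * _.
by lra.
Qed.

(** The gap between consecutive sizes: at the threshold [n * p n * s0] is at least of order [x ^ 2],
    beyond all losses of order [x]. *)
Lemma near_next m : (n <= m <= n + W)%N ->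
  expected_dominating m r (p m) * expR (n%:R * p n * s0 / 8) <=
  expected_dominating m r.+1 (p m).
Proof.
move=> mnW; have /andP[nm mW] := mnW.
have s2 : (1 - p m) ^+ r <= 1 / 2 by apply: le_trans (q_up mnW) As0.
have rm : (2 * r.+1 <= m)%N by move: rn nm; clear; lia.
apply: le_trans _ (expected_dominating_nextk (p0' nm) (p1 nm) rm s2).
rewrite ler_wpM2l ?expected_dominating_ge0 ?p0' ?p1 // ler_expR.
have h1 : n%:R * (p n / 2) * s0 <= m%:R * p m * (1 - p m) ^+ r.
  apply: ler_pM => //; first by rewrite mulr_ge0 ?divr_ge0 ?p0'.
    by apply: ler_pM; rewrite ?divr_ge0 ?p0' ?ler_nat ?half_probability.
  exact: s_low.
by move: h1; lra.
Qed.
End Window.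

(** * Short atypical runs followed by long typical ones *)

Section Covering.
Variable R : realType.

Lemma iter_exp_le (u : nat -> R) a j :
  (forall i, (i < j)%N -> u i.+1 <= u i * expR (- a)) -> u j <= u 0%N * expR (- (a * j%:R)).
Proof.
elim: j => [|j IH] H; first by rewrite mulr0 oppr0 expR0 mulr1.
apply: le_trans (H j (ltnSn j)) _.
have := IH (fun i ij => H i (leqW ij)) => /(ler_wpM2r (expR_ge0 (- a))) /le_trans; apply.
rewrite -mulrA -expRD -(natr1 j) mulrDr mulr1 opprD.
exact: lexx.
Qed.

Lemma iter_exp_ge (u : nat -> R) a j :
  (forall i, (i < j)%N -> u i * expR (- a) <= u i.+1) -> u 0%N * expR (- (a * j%:R)) <= u j.
Proof.
elim: j => [|j IH] H; first by rewrite mulr0 oppr0 expR0 mulr1.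
apply: le_trans (H j (ltnSn j)).
have := IH (fun i ij => H i (leqW ij)) => /(ler_wpM2r (expR_ge0 (- a))); apply: le_trans.
rewrite -mulrA -expRD -(natr1 j) mulrDr mulr1 opprD.
exact: lexx.
Qed.

(* The margin [n ^ 11] makes the pairs of almost equal sets negligible in the
   second moments. *)
Definition typical (p : nat -> R) : set nat :=
  [set n | expR (11 * ln (n%:R : R)) <= expected_dominating n (dom_threshold n (p n)) (p n)].

Lemma dom_threshold_eq m (p : R) k : 1 / (p * m%:R) < expected_dominating m k p ->
  (forall j, (j < k)%N -> expected_dominating m j p <= 1 / (p * m%:R)) ->
  dom_threshold m p = k.
Proof.
move=> fk small; have [fr rk _] := dom_thresholdP fk.
apply/eqP; rewrite eqn_leq rk /= leqNgt; apply/negP => /small.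
by rewrite leNgt fr.
Qed.

(** Let [Ls] be the rate just before [g r] crosses the threshold value at [n1]. Earlier rates are at
    least [Ls], so [Ls * (n1 - n)] is [O(x)]; later ones are at most [Ls], so over a run about
    [1 / eps] times as long [g r.+1] loses only [O(x)] of its lead [gam]. Monotonicity of [L] thus
    serves on both sides. *)
Lemma run_then_typical (g : nat -> nat -> R) (pp L : nat -> R) (n r W : nat)
    (x c1 C1 eps om s0 gam : R) :
  n%:R = expR x -> 1 <= x -> 0 < c1 -> 0 <= C1 -> 0 < eps -> 0 < s0 ->
  (forall m m', (m <= m')%N -> L m' <= L m) -> (forall m, s0 <= L m) -> L n <= 1 ->
  (forall k m, (n <= m)%N -> 0 <= g k m) ->
  (forall m, (n <= m)%N -> (m < n + W)%N -> g r m.+1 <= g r m * expR (- (c1 * L m))) ->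
  (forall k m, (n <= m)%N -> (m < n + W)%N -> (r <= k <= r.+1)%N ->
     g k m * expR (- (C1 * L m)) <= g k m.+1) ->
  (forall m, (n <= m <= n + W)%N -> g r m * expR gam <= g r.+1 m) ->
  (forall m, (n <= m)%N -> 0 < pp m <= 1) -> (forall m, (n <= m)%N -> pp m.+1 <= pp m) ->
  1 <= c1 * (n%:R * s0) ->
  1 / (pp n * n%:R) < g r n -> g r n <= expR (11 * x) ->
  13 * x / (c1 * s0) + 1 <= om ->
  (forall j : nat, j%:R <= om * (2 + 1 / eps) -> (j <= W)%N) -> (W <= n)%N ->
  24 * x + C1 + C1 * ((1 / eps + 1) * (13 / c1 + 1) * x) <= gam ->
  exists n1 n2, [/\ (n < n1)%N, (n1 < n2)%N, (n2 <= n + W)%N,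
     (n1 - n)%:R <= eps * (n2 - n1)%:R &
     forall m, (n1 <= m < n2)%N ->
       g r m <= 1 / (pp m * m%:R) /\ expR (22 * x) <= g r.+1 m].
Proof.
move=> nx x1 c10 C10 eps0 s00 Lmono Lge Ln1 gpos dge dle nxt pp01 ppS c1ns fr fbad Jom omW Wn gamL.
have x0 : 0 <= x by apply: le_trans x1.
have nR : (0 : R) < n%:R by rewrite nx expR_gt0.
have cs0 : 0 < c1 * s0 by rewrite mulr_gt0.
have L0 m : 0 <= L m by apply: le_trans (Lge m); exact: ltW.
have ieps : 0 <= 1 / eps by rewrite divr_ge0 // ltW.
(* As [m <= 2 n <= n ^ 2], the threshold value is at least [n ^ (-2)]. Falling to it from [n ^ 11]
   is a drop by [13 x], the constant in all lengths below. *)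
have thr_ge m : (n <= m <= n + W)%N -> expR (- (2 * x)) <= 1 / (pp m * m%:R).
  move=> /andP[nm mW]; have /andP[ppm0 ppm1] := pp01 m nm.
  have mR : (0 : R) < m%:R by apply: lt_le_trans nR _; rewrite ler_nat.
  rewrite expRN div1r lef_pV2 ?posrE ?mulr_gt0 ?expR_gt0 //.
  apply: (@le_trans _ _ m%:R); first by rewrite ler_piMl // ltW.
  apply: (@le_trans _ _ (2 * n)%:R).
    by rewrite ler_nat; apply: (leq_trans mW); rewrite mul2n -addnn leq_add2l.
  rewrite (_ : 2 * x = x + x); last by ring.
  rewrite natrM expRD -nx ler_wpM2r //; rewrite nx.
  by apply: le_trans (expR_ge1Dx _); move: x1; clear; lra.
pose J0 := (Num.truncn (13 * x / (c1 * s0))).+1.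
have tr0 : 0 <= 13 * x / (c1 * s0) by rewrite divr_ge0 ?mulr_ge0 // ltW.
have J0om : J0%:R <= om.
  rewrite /J0 -(natr1 (Num.truncn _)); apply: le_trans Jom; rewrite lerD2r.
  by rewrite truncn_le.
have om0 : 0 <= om by apply: le_trans J0om.
have J0W : (J0 <= W)%N.
  apply: omW; apply: (le_trans J0om); rewrite ler_peMr //.
  by move: ieps; clear; lra.
have it j a : (j <= W)%N -> (forall i, (i < j)%N -> a <= L (n + i)%N) ->
    g r (n + j)%N <= expR (11 * x) * expR (- (c1 * a * j%:R)).
  move=> jW aL; have := @iter_exp_le (fun i => g r (n + i)%N) (c1 * a) j.
  rewrite addn0 => H; apply: le_trans (H _) _; last by rewrite ler_wpM2r ?expR_ge0.
  move=> i ij; rewrite addnS; apply: le_trans (dge _ _ _) _.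
  - exact: leq_addr.
  - by rewrite ltn_add2l; apply: leq_trans jW.
  - apply: ler_wpM2l; first by apply: gpos; exact: leq_addr.
    by rewrite ler_expR lerN2 ler_wpM2l ?(ltW c10) ?aL.
have exJ : exists j, g r (n + j)%N <= 1 / (pp (n + j)%N * (n + j)%:R).
  exists J0; apply: le_trans (thr_ge _ _); last by rewrite leq_addr leq_add2l.
  apply: le_trans (it J0 s0 J0W (fun i _ => Lge _)) _; rewrite -expRD ler_expR.
  have : 13 * x <= J0%:R * (c1 * s0).
    rewrite -ler_pdivrMr //; apply: ltW; exact: truncnS_gt.
  by clear; lra.
case: (ex_minnP exJ) => l1 l1P l1min.
have l1J : (l1 <= J0)%N.
  apply: l1min; apply: le_trans (thr_ge _ _); last by rewrite leq_addr leq_add2l.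
  apply: le_trans (it J0 s0 J0W (fun i _ => Lge _)) _; rewrite -expRD ler_expR.
  have : 13 * x <= J0%:R * (c1 * s0).
    rewrite -ler_pdivrMr //; apply: ltW; exact: truncnS_gt.
  by clear; lra.
have l10 : (0 < l1)%N.
  rewrite lt0n; apply/eqP => l10; move: l1P; rewrite l10 addn0.
  by rewrite leNgt fr.
have l1W : (l1 <= W)%N := leq_trans l1J J0W.
have l1R : 1 <= l1%:R :> R by rewrite ler1n.
pose Ls := L (n + l1.-1)%N.
have Ls1 : Ls <= 1 by apply: le_trans Ln1; apply: Lmono; exact: leq_addr.
have l1pW : (l1.-1 <= W)%N by apply: leq_trans (leq_pred _) l1W.
have gpred : expR (- (2 * x)) < g r (n + l1.-1)%N.
  apply: (@le_lt_trans _ _ (1 / (pp (n + l1.-1)%N * (n + l1.-1)%:R))).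
    by apply: thr_ge; rewrite leq_addr leq_add2l.
  by rewrite ltNge; apply/negP => /l1min; rewrite leqNgt prednK // leqnn.
have bound1 : c1 * Ls * l1.-1%:R <= 13 * x.
  have H : g r (n + l1.-1)%N <= expR (11 * x) * expR (- (c1 * Ls * l1.-1%:R)).
    apply: it => // i il; apply: Lmono; rewrite leq_add2l; exact: ltnW.
  have := lt_le_trans gpred H; rewrite -expRD ltr_expR; clear; lra.
have bound2 : Ls * l1%:R <= (13 / c1 + 1) * x.
  have e1 : l1%:R = l1.-1%:R + 1 :> R by rewrite natr1 prednK.
  have : Ls * l1.-1%:R <= 13 * x / c1.
    by rewrite ler_pdivlMr // mulrC mulrA.
  rewrite e1; move: Ls1 x1; clear; lra.
pose l2 := (Num.truncn (l1%:R / eps)).+1.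
have l2R : l2%:R <= l1%:R * (1 / eps + 1).
  rewrite /l2 -(natr1 (Num.truncn _)).
  have : (Num.truncn (l1%:R / eps))%:R <= l1%:R / eps.
    by rewrite truncn_le divr_ge0 // ltW.
  by rewrite -[eps^-1]div1r; move: l1R; clear; lra.
have l2gt : l1%:R <= eps * l2%:R.
  by rewrite mulrC -ler_pdivrMr //; apply: ltW; exact: truncnS_gt.
have l12W : (l1 + l2 <= W)%N.
  apply: omW; rewrite natrD.
  have : l1%:R * (2 + 1 / eps) <= om * (2 + 1 / eps).
    rewrite ler_wpM2r //; first by move: ieps; clear; lra.
    by apply: le_trans J0om; rewrite ler_nat.
  by move: l2R; clear; lra.
pose n1 := (n + l1)%N.
have n1W : (n <= n1 <= n + W)%N by rewrite leq_addr leq_add2l.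
have n1E : n1 = (n + l1.-1).+1 by rewrite -addnS prednK.
have g1 : expR (- (2 * x) - C1) <= g r n1.
  rewrite expRD n1E; apply: le_trans (dle r _ _ _ _); first last.
  - by rewrite leqnn leqnSn.
  - by rewrite -addnS prednK // leq_add2l.
  - exact: leq_addr.
  apply: ler_pM; rewrite ?expR_ge0 // ?(ltW gpred) // ler_expR lerN2.
  by rewrite ler_piMr.
exists n1, (n1 + l2)%N; split.
- by rewrite /n1 -[ltnLHS]addn0 ltn_add2l.
- by rewrite -[ltnLHS]addn0 ltn_add2l.
- by rewrite /n1 -addnA leq_add2l.
- by rewrite /n1 !addKn.
move=> m /andP[n1m mn2].
have [j jl2 ->] : exists2 j, (j < l2)%N & m = (n1 + j)%N.
  by exists (m - n1)%N; rewrite ?subnKC // ltn_subLR.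
have n1j i : (i < l2)%N -> (n <= n1 + i)%N /\ (n1 + i < n + W)%N.
  move=> il; split; first by rewrite /n1 -addnA leq_addr.
  rewrite /n1 -addnA ltn_add2l; apply: leq_trans l12W.
  by rewrite ltn_add2l.
have il2 i : (i < j)%N -> (i < l2)%N by move=> ij; apply: ltn_trans jl2.
split.
  (* Once below the threshold value [g r] stays below: the factor [1 + 1 / m] from [m] is outweighed
     by [expR (- (c1 * s0))], since [c1 n s0 >= 1], and [p] only decreases. *)
  pose u i := g r (n1 + i)%N * (pp (n1 + i)%N * (n1 + i)%:R).
  have uS i : (i < j)%N -> u i.+1 <= u i * expR (- 0).
    move=> /il2/n1j[h1 h2]; rewrite oppr0 expR0 mulr1 /u addnS.
    set M := (n1 + i)%N in h1 h2 *.
    have MR : (0 : R) < M%:R by apply: lt_le_trans nR _; rewrite ler_nat.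
    have /andP[pM0 _] := pp01 M h1; have /andP[pM0' _] := pp01 M.+1 (leqW h1).
    apply: (@le_trans _ _ (g r M * expR (- (c1 * s0)) * (pp M * M.+1%:R))).
      apply: ler_pM.
      - exact: gpos (leqW h1).
      - by rewrite mulr_ge0 // ltW.
      - apply: (le_trans (dge M h1 h2)); rewrite ler_wpM2l ?gpos // ler_expR lerN2.
        by rewrite ler_wpM2l // ltW.
      - by rewrite ler_wpM2r // ppS.
    rewrite -mulrA ler_wpM2l ?gpos // mulrCA ler_wpM2l ?(ltW pM0) //.
    rewrite expRN mulrC ler_pdivrMr ?expR_gt0 // -(natr1 M).
    have : M%:R * (1 + c1 * s0) <= M%:R * expR (c1 * s0) by rewrite ler_wpM2l ?expR_ge1Dx // ltW.
    have : n%:R * (c1 * s0) <= M%:R * (c1 * s0) by rewrite ler_wpM2r ?(ltW cs0) // ler_nat.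
    by move: c1ns; clear; lra.
  have /n1j[nj _] := jl2.
  have mR : (0 : R) < (n1 + j)%:R by apply: lt_le_trans nR _; rewrite ler_nat.
  have /andP[pj0 _] := pp01 _ nj.
  rewrite ler_pdivlMr ?mulr_gt0 //.
  apply: le_trans (@iter_exp_le u 0 j uS) _; rewrite mul0r oppr0 expR0 mulr1 /u addn0.
  have n1n : (n <= n1)%N by exact: leq_addr.
  have n1R : (0 : R) < n1%:R by apply: lt_le_trans nR _; rewrite ler_nat.
  have /andP[p1 _] := pp01 _ n1n.
  by rewrite -ler_pdivlMr ?mulr_gt0.
have := @iter_exp_ge (fun i => g r.+1 (n1 + i)%N) (C1 * Ls) j; rewrite addn0 => H.
apply: le_trans (H _) => [|i ij]; last first.
  have [h1 h2] := n1j i (il2 i ij); rewrite addnS; apply: le_trans (dle r.+1 _ h1 h2 _).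
    apply: ler_wpM2l; first exact: gpos.
    rewrite ler_expR lerN2 ler_wpM2l //; apply: Lmono.
    by rewrite /n1 -addnA leq_add2l; apply: leq_trans (leq_pred _) (leq_addr _ _).
  by rewrite leqnSn leqnn.
apply: (@le_trans _ _ (expR (- (2 * x) - C1) * expR gam * expR (- (C1 * Ls * j%:R)))).
  have jb : Ls * j%:R <= (1 / eps + 1) * (13 / c1 + 1) * x.
    apply: (@le_trans _ _ (Ls * (l1%:R * (1 / eps + 1)))).
      by rewrite ler_wpM2l ?L0 //; apply: le_trans l2R; rewrite ler_nat ltnW.
    rewrite mulrA mulrC -[leRHS]mulrA ler_wpM2l //.
    by move: ieps; clear; lra.
  have := ler_wpM2l C10 jb; rewrite -!expRD ler_expR; move: gamL.
  by rewrite -[C1 * Ls * _]mulrA; clear; lra.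
rewrite ler_wpM2r ?expR_ge0 //; apply: le_trans (nxt n1 n1W).
by rewrite ler_wpM2r ?expR_ge0.
Qed.

(* [K1 n / x] bounds the length of a run of atypical [n]; the run that follows
   it, on which the threshold is [r + 1], is longer by a factor [1 / eps]. *)
Lemma near_covered (p h : nat -> R) (e c C : R) : 0 < e -> e <= 1 / 32 -> 0 < c -> 0 < C ->
  (forall m m', (m <= m')%N -> h m' <= h m) -> (forall m, 0 <= h m) ->
  (\forall n \near \oo, admissible e n (p n)) ->
  (\forall n \near \oo, c * (h n / n%:R) <= 1 - p n.+1 / p n /\
     1 - p n.+1 / p n <= C * (h n / n%:R)) ->
  forall eps : R, 0 < eps ->
  \forall a \near \oo, a \notin typical p -> covered (typical p) eps a.
Proof.
move=> e0 e1 c0 C0 hd h0 adm ratio eps eps0.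
pose H := h 0%N.
have hH m : 0 <= h m <= H by rewrite h0 hd.
have H0 : 0 <= H by exact: h0.
have [Nadm _ Hadm] := adm; have [Nrat _ Hrat] := ratio.
have [c1 c1E c10] : exists2 c1 : R, c1 = Num.min 1 c / 4 & 0 < c1.
  by exists (Num.min 1 c / 4) => //; rewrite divr_gt0 // lt_min ltr01.
(* [208 = 13 * 16]: a drop by [13 x] at rate [c1 s0], where [n s0 >= e ^ 2 x ^ 2 / 16]. The added 1
   pays for rounding up. *)
have [K1 K1E K10] : exists2 K1 : R, K1 = 208 / (c1 * e ^+ 2) + 1 & 0 < K1.
  exists (208 / (c1 * e ^+ 2) + 1) => //; apply: ltr_wpDl => //.
  by apply: divr_ge0; [rewrite ler0n | apply: mulr_ge0; [exact: ltW | exact: sqr_ge0]].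
have [K KE K0] : exists2 K : R, K = K1 * (2 + 1 / eps) & 0 < K.
  exists (K1 * (2 + 1 / eps)) => //; rewrite mulr_gt0 // ltr_wpDr // divr_ge0 // ltW //.
(* The product of [r p <= 3 x] and the relative change [K C H / x] of [p] over the window, divided
   by [e]. *)
have [A AE A0] : exists2 A : R, ln A = 3 * K * C * H / e & 0 < A.
  by exists (expR (3 * K * C * H / e)); rewrite ?expRK ?expR_gt0.
have [C1 C1E C10] : exists2 C1 : R, C1 = A * (2 + 8 * C / e) & 0 <= C1.
  exists (A * (2 + 8 * C / e)) => //; apply: mulr_ge0; first exact: ltW.
  by apply: addr_ge0 => //; apply: divr_ge0; [apply: mulr_ge0 => // |]; exact: ltW.
have [D DE D0] : exists2 D : R, D = (1 / eps + 1) * (13 / c1 + 1) & 0 <= D.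
  exists ((1 / eps + 1) * (13 / c1 + 1)) => //.
  by apply: mulr_ge0; apply: addr_ge0 => //; apply: divr_ge0 => //; exact: ltW.
have A2 : 0 < 1 / (2 * A) by rewrite divr_gt0 // mulr_gt0.
have half0 : (0 : R) < 1 / 2 by rewrite divr_gt0.
have H30 : 0 <= 1 + 3 * H by rewrite addr_ge0 // mulr_ge0.
have e100 : 0 < e / 100 by exact: divr_gt0 e0 (ltr0n _ 100).
have c32 : (0 : R) <= 32 by rewrite ler0n.
near=> n.
have thr : forall p0, admissible e n p0 -> threshold_facts e n p0 (dom_threshold n p0).
  by near: n; exact: near_threshold e0 e1.
have nadm : (Nadm <= n)%N by near: n; exact: nbhs_infty_ge.
have nrat : (Nrat <= n)%N by near: n; exact: nbhs_infty_ge.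
have nx : (n%:R : R) = expR (ln n%:R) by near: n; exact: near_natE.
have x1 : 1 <= ln (n%:R : R) by near: n; exact: near_ln.
have xK : K <= ln (n%:R : R) by near: n; exact: near_ln.
have xKCH : 2 * (K * C * H) <= ln (n%:R : R) by near: n; exact: near_ln.
have x32 : 32 / e <= ln (n%:R : R) by near: n; exact: near_ln.
have x16 : 16 / (c1 * e ^+ 2) <= ln (n%:R : R) by near: n; exact: near_ln.
(* The lead [n * p n * s0 / 8] is at least [e ^ 2 x ^ 2 / 128]. *)
have xbig : 128 * (26 + C1 + C1 * D) / e ^+ 2 <= ln (n%:R : R) by near: n; exact: near_ln.
have small : expR (- (1 / 2 * ln (n%:R : R))) <= 1 / (2 * A).
  by near: n; exact: near_exp_small half0 A2.
have xH : (1 + 3 * H) * ln (n%:R : R) <= expR (1 / 2 * ln n%:R).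
  by near: n; exact: near_absorb half0 H30.
have x32e : 32 * ln (n%:R : R) <= expR (e / 100 * ln n%:R).
  by near: n; exact: near_absorb e100 c32.
have admn := Hadm n nadm.
have := thr (p n) admn; move: admn.
rewrite /admissible /threshold_facts; set r := dom_threshold n (p n).
set x := ln (n%:R : R) in nx x1 xK xKCH x32 x16 xbig small xH x32e *.
move=> [pl pu] [fr fmin r0 rp [ns ns' rp' s_half]] nI.
have x0 : 0 <= x by apply: le_trans x1.
have x0' : 0 < x by apply: lt_le_trans x1.
have nR : (0 : R) < n%:R by rewrite nx expR_gt0.
have n0 : (0 < n)%N by rewrite -(ltr0n R).
have pn0 : 0 < p n by apply: lt_le_trans pl; exact: expR_gt0.
set s0 := (1 - p n) ^+ r in ns ns' s_half.
have pm m : (n <= m)%N -> 0 < p m <= 1 - e.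
  move=> nm; have [pl' pu'] := Hadm m (leq_trans nadm nm).
  by rewrite pu' andbT; apply: lt_le_trans pl'; exact: expR_gt0.
have rat m : (n <= m)%N -> c * (h m / m%:R) <= 1 - p m.+1 / p m /\
     1 - p m.+1 / p m <= C * (h m / m%:R).
  by move=> nm; exact: Hrat m (leq_trans nrat nm).
have rn := @param_rn R e (p n) x n r e0 e1 x1 nx pn0 pl r0 rp 32 x32e (lexx _).
have r1 : 1 <= r%:R :> R by rewrite ler1n.
have p1 : p n <= 1 by move: pu; have := e0; lra.
have r_ge : e / 2 * x <= r%:R by apply: (le_trans rp'); rewrite ler_piMr.
have ns_ge : e ^+ 2 * x ^+ 2 / 16 <= n%:R * s0.
  apply: le_trans ns'; rewrite (_ : e ^+ 2 * x ^+ 2 / 16 = e / 8 * (e / 2 * x) * x); last by field.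
  by rewrite ler_wpM2r // ler_wpM2l // divr_ge0 // ltW.
have e20 : 0 < e ^+ 2 by rewrite exprn_gt0.
have c1ns : 1 <= c1 * (n%:R * s0).
  have h1 : 16 <= x * (c1 * e ^+ 2) by rewrite -ler_pdivrMr // mulr_gt0.
  have h2 : c1 * (e ^+ 2 * x ^+ 2 / 16) <= c1 * (n%:R * s0) by rewrite ler_wpM2l // ltW.
  have h3 : x * (c1 * e ^+ 2) * 1 <= x * (c1 * e ^+ 2) * x.
    by rewrite ler_wpM2l // mulr_ge0 // mulr_ge0 // ltW.
  rewrite expr2 in h2; lra.
have s00 : 0 < s0.
  have : 0 < c1 * (n%:R * s0) by apply: lt_le_trans c1ns.
  by rewrite pmulr_rgt0 // pmulr_rgt0.
pose om := K1 * n%:R / x.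
pose W := Num.truncn (K * n%:R / x).
have W0 : 0 <= K * n%:R / x by rewrite divr_ge0 ?mulr_ge0 // ltW.
have Wle : W%:R <= K * n%:R / x by rewrite truncn_le.
have CHn : 0 <= C * H / n%:R by rewrite divr_ge0 ?mulr_ge0 // ltW.
have WCH : W%:R * (C * H / n%:R) <= K * C * H / x.
  apply: le_trans (ler_wpM2r CHn Wle) _.
  by rewrite le_eqVlt; apply/orP; left; apply/eqP; field; rewrite !gt_eqF.
have Wsmall : W%:R * (C * H / n%:R) <= 1 / 2.
  by apply: (le_trans WCH); rewrite ler_pdivrMr //; move: xKCH; lra.
have WA : r%:R * (p n * (W%:R * (C * H / n%:R)) / e) <= ln A.
  rewrite AE mulrA ler_wpM2r ?invr_ge0 ?(ltW e0) // mulrA.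
  apply: (@le_trans _ _ (3 * x * (K * C * H / x))).
    apply: ler_pM => //; first by rewrite mulr_ge0 // ltW.
    by rewrite mulr_ge0.
  by rewrite le_eqVlt; apply/orP; left; apply/eqP; field; rewrite !gt_eqF.
have As0 : A * s0 <= 1 / 2.
  have : s0 <= 1 / (2 * A).
    by apply: (le_trans s_half); apply: le_trans small; rewrite (_ : x / 2 = 1 / 2 * x) //; ring.
  rewrite ler_pdivlMr ?mulr_gt0 //; lra.
have s0r : 4 * r%:R <= n%:R * s0.
  apply: le_trans ns'; have : 32 <= x * e by rewrite -ler_pdivrMr.
  by move=> /(ler_wpM2l (ler0n R r)); lra.
pose g k m := expected_dominating m k (p m).
pose L := drop_rate p h n r.
have Lmono m m' : (m <= m')%N -> L m' <= L m := @drop_rate_mono R p h e n e0 hd pm r m m'.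
have Lge m : s0 <= L m := @drop_rate_ge R p h e H n e0 hH pm r m.
have dge m : (n <= m)%N -> (m < n + W)%N -> g r m.+1 <= g r m * expR (- (c1 * L m)).
  rewrite c1E; exact: (@threshold_drop_ge R p h e c C H n e0 c0 C0 n0 hH pm rat W r A
    Wsmall WA A0 rn As0 s0r m).
have dle k m : (n <= m)%N -> (m < n + W)%N -> (r <= k <= r.+1)%N ->
    g k m * expR (- (C1 * L m)) <= g k m.+1.
  rewrite C1E; exact: (@threshold_drop_le R p h e c C H n e0 c0 C0 n0 hH pm rat W r A
    r0 WA A0 rn As0 k m).
have nxt m : (n <= m <= n + W)%N -> g r m * expR (n%:R * p n * s0 / 8) <= g r.+1 m.
  exact: (@near_next R p h e c C H n e0 c0 C0 n0 hH pm rat W r A Wsmall WA A0 rn As0 m).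
have gpos k m : (n <= m)%N -> 0 <= g k m.
  move=> nm; have /andP[h1 h2] := pm m nm; apply: expected_dominating_ge0; first exact: ltW.
  by move: h2; have := e0; lra.
have om1 : 13 * x / (c1 * s0) + 1 <= om.
  have h1 : 13 * x / (c1 * s0) <= 208 / (c1 * e ^+ 2) * n%:R / x.
    rewrite ler_pdivrMr ?mulr_gt0 //.
    rewrite [leRHS](_ : _ = 208 / (e ^+ 2 * x) * (n%:R * s0)); last first.
      by field; rewrite !gt_eqF.
    apply: (@le_trans _ _ (208 / (e ^+ 2 * x) * (e ^+ 2 * x ^+ 2 / 16))).
      by rewrite le_eqVlt; apply/orP; left; apply/eqP; field; rewrite !gt_eqF.
    apply: ler_wpM2l => //; apply: divr_ge0; first by rewrite ler0n.
    by rewrite mulr_ge0 // ltW.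
  have h2 : 1 <= n%:R / x.
    rewrite ler_pdivlMr // mul1r nx; apply: le_trans (expR_ge1Dx _); lra.
  rewrite /om K1E [leRHS](_ : _ = 208 / (c1 * e ^+ 2) * n%:R / x + n%:R / x).
    exact: lerD.
  by rewrite (mulrDl _ 1) [1 * _]mul1r mulrDl.
have omW j : j%:R <= om * (2 + 1 / eps) -> (j <= W)%N.
  move=> jle; rewrite /W truncn_ge_nat //; apply: (le_trans jle).
  by rewrite /om KE le_eqVlt; apply/orP; left; apply/eqP; field; rewrite !gt_eqF.
have Wn : (W <= n)%N.
  rewrite -(ler_nat R); apply: (le_trans Wle).
  by rewrite ler_pdivrMr // mulrC ler_wpM2l // ltW.
have Ln1 : L n <= 1.
  rewrite /L /drop_rate -/s0.
  have h1 : 1 + r%:R * p n * h n <= (1 + 3 * H) * x.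
    have hn : r%:R * p n * h n <= 3 * x * H.
      apply: ler_pM => //; first by rewrite mulr_ge0 // ltW.
      by case/andP: (hH n).
    by move: hn x1; lra.
  apply: (@le_trans _ _ (expR (- (x / 2)) * expR (1 / 2 * x))).
    apply: ler_pM; [exact: ltW | | exact: s_half | exact: le_trans h1 xH].
    by rewrite addr_ge0 // mulr_ge0 // mulr_ge0 // ltW.
  by rewrite -expRD (_ : - (x / 2) + 1 / 2 * x = 0) ?expR0 //; ring.
have gam1 : 24 * x + C1 + C1 * ((1 / eps + 1) * (13 / c1 + 1) * x) <= n%:R * p n * s0 / 8.
  rewrite -DE; apply: (@le_trans _ _ ((26 + C1 + C1 * D) * x)).
    have := mulr_ge0 C10 x0; have : C1 <= C1 * x by rewrite ler_peMr.
    by move: x0; clear; lra.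
  have h1 : 128 * (26 + C1 + C1 * D) <= x * e ^+ 2 by rewrite -ler_pdivrMr.
  have h2 : e / 8 * x * (e / 2 * x) <= n%:R * p n * s0.
    apply: (@le_trans _ _ (e / 8 * x * (r%:R * p n))).
      by rewrite ler_wpM2l // mulr_ge0 // divr_ge0 // ltW.
    rewrite [leLHS](_ : _ = e / 8 * r%:R * x * p n); last by ring.
    by rewrite [leRHS]mulrAC ler_wpM2r // ltW.
  have := ler_wpM2r x0 h1.
  rewrite (_ : x * e ^+ 2 * x = 16 * (e / 8 * x * (e / 2 * x))); last by field.
  by move: h2; clear; lra.
have fbad : g r n <= expR (11 * x).
  rewrite leNgt; apply/negP => lt; move: nI; apply/negP; rewrite negbK inE /typical /=.
  exact: ltW.
have pp01 m : (n <= m)%N -> 0 < p m <= 1.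
  by move=> /pm/andP[-> h1] /=; apply: (le_trans h1); rewrite gerBl ltW.
have ppS m : (n <= m)%N -> p m.+1 <= p m :=
  @probability_step R p h e c C H n c0 hH pm rat m.
have [n1 [n2 [nn1 n12 n2W le12 good]]] := @run_then_typical g p L n r W x c1 C1 eps om s0
  (n%:R * p n * s0 / 8) nx x1 c10 C10 eps0 s00 Lmono Lge Ln1 gpos dge dle nxt pp01 ppS
  c1ns fr fbad om1 omW Wn gam1.
exists n1, n2; split => //.
  by apply: (leq_trans n2W); rewrite mul2n -addnn leq_add2l.
move=> m mn; have [gr gr1] := good m mn; have /andP[n1m mn2] := mn.
have nm : (n <= m)%N := leq_trans (ltnW nn1) n1m.
have mW : (m <= n + W)%N := leq_trans (ltnW mn2) n2W.
have /andP[pm0 pm1] := pp01 m nm.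
have ph : p n / 2 <= p m.
  by apply: (@half_probability R p h e c C H n c0 C0 n0 hH pm rat W Wsmall m); rewrite nm.
have ex2 : 1 <= expR (22 * x).
  by rewrite -[leLHS]expR0 ler_expR mulr_ge0.
have pnn : 2 <= p n * n%:R.
  rewrite nx; apply: (@le_trans _ _ (expR ((- (1 / 3) + e) * x) * expR x)); last first.
    by rewrite ler_wpM2r ?expR_ge0.
  rewrite -expRD; apply: le_trans (expR_ge1Dx _); have ex0 : 0 <= e * x by rewrite mulr_ge0 // ltW.
  have : 32 <= x * e by rewrite -ler_pdivrMr.
  by move: x0; lra.
have thr1 : 1 / (p m * m%:R) <= 1.
  have : 1 <= p m * m%:R.
    apply: (@le_trans _ _ (p n / 2 * n%:R)); first by move: pnn; lra.
    by apply: ler_pM => //; [rewrite divr_ge0 // ltW | rewrite ler_nat].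
  by move=> h1; rewrite ler_pdivrMr ?mul1r // (lt_le_trans ltr01 h1).
(* This is why [n ^ 22] was secured for size [r + 1]: it is at least [m ^ 11] on the whole
   window. *)
have ln_m : ln (m%:R : R) <= 2 * x.
  have mR : (0 : R) < m%:R by apply: lt_le_trans nR _; rewrite ler_nat.
  rewrite -[leRHS]expRK ler_ln ?posrE ?expR_gt0 // (_ : 2 * x = x + x); last by ring.
  rewrite expRD -nx; apply: (@le_trans _ _ (2 * n)%:R).
    by rewrite ler_nat; apply: (leq_trans mW); rewrite mul2n -addnn leq_add2l.
  rewrite natrM ler_wpM2r // nx; apply: le_trans (expR_ge1Dx _); move: x1; lra.
have rE : dom_threshold m (p m) = r.+1.
  apply: dom_threshold_eq.
    apply: (le_lt_trans thr1); apply: lt_le_trans gr1.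
    by rewrite expR_gt1 mulr_gt0 // ltr0n.
  move=> j; rewrite ltnS => jr; apply: le_trans gr.
  apply: expected_dominating_mono => //; first exact: ltW.
  by move: rn nm; clear; lia.
rewrite inE /typical /= rE; apply: le_trans gr1; rewrite ler_expR.
by move: ln_m; clear; lra.
Unshelve. all: by end_near. Qed.
End Covering.

(** * Passage to the limit along the typical orders *)

Lemma near_admissible (R : realType) (eps e : R) (p : nat -> R) : e <= eps ->
  (\forall n \near \oo, n%:R `^ (- (1 / 3) + eps) <= p n /\ p n <= 1 - eps) ->
  \forall n \near \oo, admissible e n (p n).
Proof.
move=> ee hp; near=> n.
have n1 : (0 < n)%N by near: n; exact: nbhs_infty_gt.
have [pl pu] : n%:R `^ (- (1 / 3) + eps) <= p n /\ p n <= 1 - eps by near: n.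
split; last by apply: (le_trans pu); rewrite lerD2l lerN2.
apply: le_trans pl; rewrite /powR gt_eqF ?ltr0n // ler_expR ler_wpM2r ?lerD2l //.
by rewrite ln_ge0 // ler1n.
Unshelve. all: by end_near. Qed.

Lemma gnp_prob_le1 (R : realType) n (p : R) (A : pred {set {set 'I_n}}) :
  0 <= p -> p <= 1 -> gnp_prob p A <= 1.
Proof.
move=> p0 p1; rewrite gnp_probE -[leRHS](expect_cst p (enum (vpairs 'I_n)) 1).
by apply: expect_le => // E; case: (A E).
Qed.

Theorem theorem2p2 (R : realType) (eps : R) (p h : nat -> R)
  (heps : 0 < eps)
  (hp : \forall n \near \oo,
     n%:R `^ (- (1 / 3) + eps) <= p n /\ p n <= 1 - eps)
  (h_noninc : nonincreasing_seq h)
  (h_ge0 : forall n : nat, 0 <= h n)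
  (hratio : exists c C : R, 0 < c /\ 0 < C /\
     \forall n \near \oo,
       c * (h n / n%:R) <= 1 - p n.+1 / p n /\
       1 - p n.+1 / p n <= C * (h n / n%:R)) :
  exists I : set nat, density_one R I /\
  exists c C : R, 0 < c /\ 0 < C /\
    aas_along I p (fun n (E : {set {set 'I_n}}) =>
      [&& domination_number E == dom_threshold n (p n),
          c * (max_degree E)%:R <= (bondage_number E)%:R,
          (bondage_number E)%:R <= C * (max_degree E)%:R,
          c * (p n * n%:R) <= (max_degree E)%:R &
          (max_degree E)%:R <= C * (p n * n%:R)]).
Proof.
(* A smaller [e] weakens admissibility, and [1 / 32] leaves room for the fixed powers of [n] in the
   estimates. *)
have [e [e0 e1 ee]] : exists e : R, [/\ 0 < e, e <= 1 / 32 & e <= eps].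
  exists (Num.min eps (1 / 32)); split.
  - by rewrite lt_min heps divr_gt0.
  - by rewrite ge_min lexx orbT.
  - by rewrite ge_min lexx.
have adm := near_admissible ee hp.
have [c [C [c0 [C0 ratio]]]] := hratio.
exists (typical p); split.
  exact: density_one_covered (near_covered e0 e1 c0 C0 h_noninc h_ge0 adm ratio).
have [delta delta0 main] := near_gnp e0 e1.
(* [delta / 4] because the maximum degree is at most [4 p n], and [1 / 8] because it is at least
   [p n / 8]. *)
pose b := Num.min (delta / 4) (1 / 8).
have bd : b <= delta / 4 by rewrite ge_min lexx.
have b8 : b <= 1 / 8 by rewrite ge_min lexx orbT.
exists b, 4; split; first by rewrite lt_min !divr_gt0.
split; first by [].
apply/cvgrPdist_le => eps' eps'0; rewrite near_withinE; near=> n => nI.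
have adn : admissible e n (p n) by near: n.
have [pl pu] := adn.
have p0 : 0 < p n by apply: lt_le_trans pl; exact: expR_gt0.
have p1 : p n <= 1 by apply: (le_trans pu); rewrite gerBl ltW.
rewrite ger0_norm ?subr_ge0 ?gnp_prob_le1 ?(ltW p0) //.
rewrite lerBlDl -lerBlDr.
have mn : forall p0 : R, admissible e n p0 -> let r := dom_threshold n p0 in
      expR (11 * ln n%:R) <= expected_dominating n r p0 ->
      forall A : pred {set {set 'I_n}},
      (forall E, domination_number E = r ->
         delta * (p0 * n%:R) <= (bondage_number E)%:R ->
         (bondage_number E <= 2 * max_degree E)%N ->
         p0 * n%:R / 8 <= (max_degree E)%:R ->
         (max_degree E)%:R <= 4 * (p0 * n%:R) -> A E) ->
      1 - eps' <= gnp_prob p0 A.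
  by near: n; exact: main eps' eps'0.
apply: mn => // E gE bl bu dl du.
have pn0 : 0 <= p n * n%:R by rewrite mulr_ge0 // ltW.
have D0 : 0 <= (max_degree E)%:R :> R by [].
apply/and5P; split => //.
- exact/eqP.
- apply: le_trans bl; apply: (@le_trans _ _ (delta / 4 * (max_degree E)%:R)).
    by rewrite ler_wpM2r.
  apply: (@le_trans _ _ (delta / 4 * (4 * (p n * n%:R)))).
    by rewrite ler_wpM2l // divr_ge0 // ltW.
  by rewrite mulrA divfK.
- rewrite -natrM ler_nat; apply: (leq_trans bu).
  by rewrite leq_mul2r; apply/orP; right.
- by apply: le_trans dl; rewrite [leRHS]mulrC -div1r ler_wpM2r.
Unshelve. all: by end_near. Qed.
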